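(* Let $\ell\in\mathbb{Z}_{\ge 0}$, and let $f:\mathbb{C}_+\to\mathbb{C}$ and $g:\mathbb{C}_+\to\mathbb{C}_+$ be analytic functions. Then the maximal weighted composition operator $W_{f,g,\max}$ is hermitian on $\mathbb{B}_\ell(\mathbb{C}_+)$ if and only if one of the following three cases holds (for all $w\in\mathbb{C}_+$): (1) $g(w)=\mu$ and $f(w)=\dfrac{\varepsilon}{(w+\overline{\mu})^{\ell+2}}$, where $\mu\in\mathbb{C}_+$ and $\varepsilon\in\mathbb{R}$; (2) $g(w)=w+\gamma$ and $f(w)=\lambda$, where $\gamma\in\mathbb{R}_{\ge 0}$ and $\lambda\in\mathbb{R}$; (3) $g(w)=-\dfrac{\beta}{\alpha}-\dfrac{2}{\alpha w-\overline{\beta}}$ and $f(w)=\dfrac{\delta}{(\alpha w-\overline{\beta})^{\ell+2}}$, where $\alpha,\delta\in\mathbb{R}\setminus\{0\}$, $\beta\in\mathbb{C}$, and either $\operatorname{Re}\beta<0<\alpha\le\frac{(\operatorname{Re}\beta)^2}{2}$, or $\alpha<0=\operatorname{Re}\beta$. In this case, the operator $W_{f,g,\max}$ is bounded.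
   Context: $\mathbb{C}_+=\{z\in\mathbb{C}:\operatorname{Re}z>0\}$. For $\ell\in\mathbb{Z}_{\ge0}$, the weighted Bergman space $\mathbb{B}_\ell(\mathbb{C}_+)$ is the Hilbert space of analytic functions $h:\mathbb{C}_+\to\mathbb{C}$ with $\|h\|^2=\frac1\pi\int_{-\infty}^{\infty}\int_0^\infty x^\ell|h(x+iy)|^2\,dx\,dy<\infty$. For analytic $f:\mathbb{C}_+\to\mathbb{C}$ and $g:\mathbb{C}_+\to\mathbb{C}_+$, the maximal weighted composition operator $W_{f,g,\max}$ has domain $\{h\in\mathbb{B}_\ell(\mathbb{C}_+): f\cdot(h\circ g)\in\mathbb{B}_\ell(\mathbb{C}_+)\}$ and acts by $W_{f,g,\max}h=f\cdot(h\circ g)$. A linear (not necessarily bounded) operator $K$ is called hermitian if $K=K^*$, equality including equality of domains ($K$ being densely defined so that $K^*$ makes sense). The operator is called bounded on $\mathbb{B}_\ell(\mathbb{C}_+)$ if its domain is all of $\mathbb{B}_\ell(\mathbb{C}_+)$ and there is $L>0$ with $\|W_{f,g,\max}h\|\le L\|h\|$ for every $h$.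
   Formalization: The ''only if'' direction is false as stated; the formal theorem adds two further cases: f identically zero with g arbitrary, and the formulas of (3) with α < 0 < Re β (so the condition there becomes α < 0 ≤ Re β). *)

(* Defs.v *)
From HB Require Import structures.
From mathcomp Require Import all_boot all_order all_algebra.
From mathcomp Require Import complex.
From mathcomp Require Import all_classical all_reals all_analysis.

Set Implicit Arguments.
Unset Strict Implicit.
Unset Printing Implicit Defensive.

Import Order.TTheory GRing.Theory Num.Theory.
Import numFieldNormedType.Exports.

Local Open Scope classical_set_scope.
Local Open Scope complex_scope.
Local Open Scope ring_scope.

(* A function on the half-plane is represented by a total function on R[i];
   its values outside Cplus are irrelevant to every notion below. *)
Definition Cplus (R : realType) : set R[i] := [set w | 0 < complex.Re w].
Arguments Cplus {R}.

(* Complex differentiability: the scalar field of R[i]^o is R[i] itself. *)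
Definition analytic_Cplus (R : realType) (f : R[i] -> R[i]) : Prop :=
  forall w, Cplus w -> derivable (f : R[i]^o -> R[i]^o) w 1.

(* Area integrals over Cplus are taken in the coordinates (x, y), w = x + iy. *)
Local Notation plane_measure R :=
  (@lebesgue_measure R \x @lebesgue_measure R)%E.

Definition Cplus_xy (R : realType) :
    set (measurableTypeR R * measurableTypeR R) :=
  [set p | Cplus (p.1 +i* p.2)].

Definition bergman_sqnorm (R : realType) (l : nat) (h : R[i] -> R[i]) :
    \bar R :=
  ((pi^-1)%:E *
   \int[plane_measure R]_(p in @Cplus_xy R)
      (p.1 ^+ l * Normc.normc (h (p.1 +i* p.2)) ^+ 2)%:E)%E.

Definition bergman (R : realType) (l : nat) : set (R[i] -> R[i]) :=
  [set h | analytic_Cplus h /\ (bergman_sqnorm l h < +oo)%E].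

Definition bergman_norm (R : realType) (l : nat) (h : R[i] -> R[i]) : R :=
  Num.sqrt (fine (bergman_sqnorm l h)).

(* The inner product inducing bergman_norm; the complex-valued integral is
   computed from its real and imaginary parts. *)
Definition bergman_dot (R : realType) (l : nat) (h k : R[i] -> R[i]) : R[i] :=
  let F (p : measurableTypeR R * measurableTypeR R) : R[i] :=
    (p.1 ^+ l)%:C * (h (p.1 +i* p.2) * (k (p.1 +i* p.2))^*) in
  (pi^-1)%:C *
  (Rintegral (plane_measure R) (@Cplus_xy R) (fun p => complex.Re (F p)) +i*
   Rintegral (plane_measure R) (@Cplus_xy R) (fun p => complex.Im (F p))).

(* A possibly unbounded operator on the Bergman space; op_act is only
   meaningful on op_dom. *)
Record operator (R : realType) := Operator {
  op_dom : set (R[i] -> R[i]);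
  op_act : (R[i] -> R[i]) -> R[i] -> R[i] }.

Definition Wmax (R : realType) (l : nat) (f g : R[i] -> R[i]) : operator R :=
  {| op_dom := [set h | bergman l h /\ bergman l (fun w => f w * h (g w))];
     op_act := fun h w => f w * h (g w) |}.

Definition densely_defined (R : realType) (l : nat) (K : operator R) : Prop :=
  forall u, bergman l u -> forall e : R, 0 < e ->
    exists2 h, op_dom K h & bergman_norm l (fun w => h w - u w) < e.

Definition adjoint_value (R : realType) (l : nat) (K : operator R)
    (u : R[i] -> R[i]) : set (R[i] -> R[i]) :=
  [set v | bergman l v /\
     forall h, op_dom K h -> bergman_dot l (op_act K h) u = bergman_dot l h v].

(* For densely defined K, two elements of adjoint_value l K u agree on Cplus,
   so the choice made by xget is immaterial. *)
Definition adjoint (R : realType) (l : nat) (K : operator R) : operator R :=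
  {| op_dom := [set u | bergman l u /\ exists v, adjoint_value l K u v];
     op_act := fun u => xget (fun=> 0) (adjoint_value l K u) |}.

Definition op_eq (R : realType) (K L : operator R) : Prop :=
  op_dom K = op_dom L /\
  forall h, op_dom K h -> forall w, Cplus w -> op_act K h w = op_act L h w.

Definition hermitian_op (R : realType) (l : nat) (K : operator R) : Prop :=
  densely_defined l K /\ op_eq K (adjoint l K).

Definition bounded_op (R : realType) (l : nat) (K : operator R) : Prop :=
  op_dom K = bergman l /\
  exists2 L : R, 0 < L &
    forall h, bergman l h -> bergman_norm l (op_act K h) <= L * bergman_norm l h.

Definition case_constant (R : realType) (l : nat) (f g : R[i] -> R[i]) : Prop :=
  exists (mu : R[i]) (eps : R), Cplus mu /\
    forall w, Cplus w -> g w = mu /\ f w = eps%:C / (w + mu^*) ^+ l.+2.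

Definition case_translation (R : realType) (f g : R[i] -> R[i]) : Prop :=
  exists gamma lambda : R, 0 <= gamma /\
    forall w, Cplus w -> g w = w + gamma%:C /\ f w = lambda%:C.

Definition moebius_form (R : realType) (l : nat) (alpha delta : R)
    (beta : R[i]) (f g : R[i] -> R[i]) : Prop :=
  forall w, Cplus w ->
    g w = - (beta / alpha%:C) - 2%:R / (alpha%:C * w - beta^*) /\
    f w = delta%:C / (alpha%:C * w - beta^*) ^+ l.+2.

Definition case_moebius (R : realType) (l : nat) (f g : R[i] -> R[i]) : Prop :=
  exists (alpha delta : R) (beta : R[i]),
    [/\ alpha != 0, delta != 0,
        (complex.Re beta < 0 /\ 0 < alpha /\
           alpha <= complex.Re beta ^+ 2 / 2%:R) \/
        (alpha < 0 /\ complex.Re beta = 0)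
      & moebius_form l alpha delta beta f g].

(* Wmax l f g is hermitian in two situations that none of the three cases above
   covers, so the characterization must list them as well.
   - f vanishes identically: Wmax l f g is the zero operator with full domain,
     whatever g is.
   - The formulas of case_moebius with alpha < 0 < Re beta: then
     Re (alpha w - conj beta) < 0 on Cplus, g maps Cplus into a relatively
     compact subset of Cplus, f lies in the Bergman space, so that the operator
     is bounded, and f w / (g w + conj z)^(l+2) equals
     delta / (alpha w conj z - beta w - conj (beta z) + |beta|^2/alpha - 2)^(l+2),
     which is a hermitian kernel.  E.g. alpha = -1, beta = 1, l = 0, delta = 1:
     g w = (w + 3) / (w + 1), f w = 1 / (w + 1)^2. *)
Definition case_zero (R : realType) (f : R[i] -> R[i]) : Prop :=
  forall w, Cplus w -> f w = 0.

Definition case_moebius_pos (R : realType) (l : nat) (f g : R[i] -> R[i]) :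
    Prop :=
  exists (alpha delta : R) (beta : R[i]),
    [/\ alpha < 0, delta != 0, 0 < complex.Re beta
      & moebius_form l alpha delta beta f g].

(* Main.v *)
(** With n = l + 2, the functions k_z(w) = (w + z^* )^-n represent point
    evaluations on the Bergman space up to a constant factor: apply the Cauchy
    formula on vertical lines, then integrate over the lines.  Hence the adjoint
    of W maps k_z to (f z)^* k_(g z), and if W is hermitian then
      f(w) (w + g(z)^* )^n = f(z)^* (g(w) + z^* )^n  for all w, z.
    The logarithmic derivative in w at w = 1 of this identity shows that g is a
    Moebius map, a dilation followed by a translation, or constant; f is then
    given by the identity itself at z = 1, and comparing coefficients leaves only
    the listed parameters.

    Conversely, in each case W is, up to a real factor, a rank one operator or a
    product of translations h |-> h(w + a) with Re a >= 0, whose adjoint is the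
    translation by a^*, and of inversions h |-> w^-n h(q / w), which are
    symmetric.  So W is bounded, everywhere defined and symmetric. *)

Require Import Defs.
From HB Require Import structures.
From mathcomp Require Import all_boot all_order all_algebra.
From mathcomp Require Import complex.
From mathcomp Require Import all_classical all_reals all_analysis.
From mathcomp Require Import measurable_realfun.
From mathcomp Require Import ring lra zify.

Set Implicit Arguments.
Unset Strict Implicit.
Unset Printing Implicit Defensive.

Import Order.TTheory GRing.Theory Num.Def Num.Theory.
Import numFieldNormedType.Exports.
Import Normc.

Local Open Scope classical_set_scope.
Local Open Scope complex_scope.
Local Open Scope ring_scope.

(** * Complex derivatives *)

Section ComplexDerivative.
Context {R : realType}.
Implicit Types (h k : R[i] -> R[i]) (w v d : R[i]) (e : R).

(** A Bergman function need not be square integrable on every vertical line, and it has no pointwise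
    decay along the horizontal edges of a contour. Integrals are therefore moved only between lines
    on which the function is square integrable, which are almost all lines, and the horizontal edges
    are controlled through square integrability over the strip between them.

    Inner products become contour integrals because on the line Re w = x the conjugate of w is 2x -
    w: the conjugate of a holomorphic factor agrees there with a function that is again holomorphic
    in w. This yields the reproducing formula as well as the adjoint of a real translation.

    Real parts are computed first; since Im u = Re (-i u), the complex statements follow by
    replacing h with -i h.

    The power l + 2 in the kernel identity has no canonical root, which is why the identity is
    differentiated logarithmically. This needs f(1) to be nonzero, but the identity shows that f
    vanishes everywhere as soon as it vanishes at one point. *)

Lemma normcE' w : `|w| = (normc w)%:C.
Proof. by case: w. Qed.

Lemma normc_ge0 w : 0 <= normc w.
Proof. by case: w => a b; exact: sqrtr_ge0. Qed.

Lemma normc_gt0 w : (0 < normc w) = (w != 0).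
Proof.
rewrite lt_neqAle normc_ge0 andbT eq_sym; congr negb.
by apply/eqP/eqP => [/eq0_normc|->] //; exact: normc0.
Qed.

Lemma normc_distC v w : normc (v - w) = normc (w - v).
Proof. by rewrite -normcN opprB. Qed.

Lemma normcX w n : normc (w ^+ n) = normc w ^+ n.
Proof. by elim: n => [|n IH]; rewrite ?expr0 ?normc1 // !exprS normcM IH. Qed.

Lemma normc_conj w : normc w^* = normc w.
Proof. by case: w => a b /=; rewrite sqrrN. Qed.

Lemma normc_real (a : R) : normc a%:C = `|a|.
Proof. by rewrite /= expr0n /= addr0 sqrtr_sqr. Qed.

Lemma sqr_normcE w : normc w ^+ 2 = complex.Re w ^+ 2 + complex.Im w ^+ 2.
Proof. by case: w => a b /=; rewrite sqr_sqrtr // addr_ge0 ?sqr_ge0. Qed.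

Lemma ler_Re_normc w : `|complex.Re w| <= normc w.
Proof.
by case: w => a b /=; rewrite -sqrtr_sqr ler_wsqrtr // lerDl sqr_ge0.
Qed.

Lemma ler_Im_normc w : `|complex.Im w| <= normc w.
Proof.
by case: w => a b /=; rewrite -sqrtr_sqr ler_wsqrtr // lerDr sqr_ge0.
Qed.

Lemma ler_normc_ReIm w : normc w <= `|complex.Re w| + `|complex.Im w|.
Proof.
case: w => a b /=; rewrite -[leRHS]ger0_norm ?addr_ge0 // -sqrtr_sqr.
rewrite ler_wsqrtr // sqrrD !real_normK ?num_real // addrAC lerDl.
by rewrite mulrn_wge0 // mulr_ge0.
Qed.

(** Division-free form of the complex derivative: it also makes sense at [v = w], and its remainder
    estimate is the one that Goursat's argument integrates. *)
Definition cdiff h w d := forall e, 0 < e -> exists2 dl : R, 0 < dl &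
  forall v, normc (v - w) < dl ->
    normc (h v - h w - d * (v - w)) <= e * normc (v - w).

Lemma is_derive_cdiff h w d :
  is_derive (w : R[i]^o) (1 : R[i]^o) (h : R[i]^o -> R[i]^o) d <-> cdiff h w d.
Proof.
split=> [[hw hd] e e0|hd].
  have : (fun t : R[i]^o => t^-1 *: ((h \o shift w) (t *: 1) - h w) : R[i]^o) t @[t --> (0 : R[i]^o)^'] --> (d : R[i]^o).
    by rewrite -hd; exact: hw.
  (* Radii of balls in [R[i]] are themselves complex; a positive one has zero imaginary part, so its
     real part is the radius wanted here. *)
  move=> /cvgrPdist_le /(_ e%:C); rewrite ltcR => /(_ e0).
  case=> dl /= dl0 H; exists (complex.Re dl).
    by move: dl0; rewrite ltcE /= => /andP[].
  have Edl : dl = (complex.Re dl)%:C.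
    by case: {H} dl dl0 => a b; rewrite ltcE /= => /andP[/eqP ->].
  move=> v vw; have [->|nvw] := eqVneq v w.
    by rewrite !subrr mulr0 subrr normc0 mulr0.
  have := H (v - w).
  rewrite /= sub0r normrN normcE' Edl ltcR subr_eq0 => /(_ vw nvw).
  rewrite normcE' lecR => H1.
  have vw0 : 0 < normc (v - w) by rewrite normc_gt0 subr_eq0.
  move: H1; rewrite -(ler_pM2r vw0) -normcM => H1.
  apply: le_trans H1; rewrite le_eqVlt; apply/orP; left; apply/eqP.
  rewrite normc_distC; congr normc.
  rewrite [_%:A]mulr1 subrK mulrBl; congr (_ - _).
  by rewrite /GRing.scale /= mulrAC mulVf ?mul1r // subr_eq0.
suff H : (fun t : R[i]^o => t^-1 *: ((h \o shift w) (t *: 1) - h w) : R[i]^o) t @[t --> (0 : R[i]^o)^'] --> (d : R[i]^o).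
  split; first by apply/cvg_ex; exists d.
  exact/cvg_lim.
apply/cvgrPdist_le => -[e1 e2]; rewrite ltcE /= => /andP[/eqP -> e0].
have [dl dl0 H] := hd _ e0.
exists dl%:C; first by rewrite /= ltcR.
move=> t /=; rewrite sub0r normrN normcE' ltcR => tdl t0.
rewrite normcE' lecR.
have t0' : 0 < normc t by rewrite normc_gt0.
have := H (t + w); rewrite addrK => /(_ tdl).
move=> H1; rewrite -(ler_pM2r t0') -normcM; apply: le_trans H1.
rewrite le_eqVlt; apply/orP; left; apply/eqP.
rewrite [RHS]normc_distC [_%:A]mulr1; congr normc.
rewrite mulrBl; congr (_ - _).
by rewrite /GRing.scale /= mulrAC mulVf ?mul1r.
Qed.

Lemma cdiff_ex h w :
  derivable (h : R[i]^o -> R[i]^o) (w : R[i]^o) 1 <-> exists d, cdiff h w d.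
Proof.
split=> [hw|[d /is_derive_cdiff[]//]].
exists ('D_1 (h : R[i]^o -> R[i]^o) (w : R[i]^o)).
exact/is_derive_cdiff/derivableP.
Qed.

Lemma cdiff_cont h w d : cdiff h w d -> forall e, 0 < e -> exists2 dl : R, 0 < dl &
  forall v, normc (v - w) < dl -> normc (h v - h w) <= e.
Proof.
move=> hd e e0; have [dl dl0 H] := hd 1 ltr01.
have K0 : 0 < 1 + normc d by rewrite ltr_wpDr ?normc_ge0.
exists (Num.min dl (e / (1 + normc d))); first by rewrite lt_min dl0 divr_gt0.
move=> v; rewrite lt_min => /andP[/H vd ve].
rewrite -(subrK (d * (v - w)) (h v - h w)).
apply: (le_trans (le_normcD _ _)); rewrite normcM.
apply: (le_trans (lerD vd (lexx _))); rewrite -mulrDl.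
by rewrite mulrC -ler_pdivlMr // ltW.
Qed.

Lemma cdiff_eq h k w d (r : R) : 0 < r -> (forall v, normc (v - w) < r -> h v = k v) ->
  cdiff h w d -> cdiff k w d.
Proof.
move=> r0 E hd e /hd[dl dl0 H]; exists (Num.min dl r); first by rewrite lt_min dl0.
move=> v; rewrite lt_min => /andP[vd vr].
by rewrite -!E ?subrr ?normc0 //; exact: H.
Qed.

Lemma cdiff_comp h k w d1 d2 : cdiff k w d1 -> cdiff h (k w) d2 ->
  cdiff (h \o k) w (d2 * d1).
Proof.
move=> kd hd e e0.
(* Adding 1 keeps the divisors below positive when a derivative vanishes; each of the two error
   terms gets half of [e]. *)
have K1 : 0 < 1 + normc d1 by rewrite ltr_wpDr ?normc_ge0.
have K2 : 0 < 1 + normc d2 by rewrite ltr_wpDr ?normc_ge0.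
have [dl1 dl10 H1] := kd 1 ltr01.
have [dl3 dl30 H3] := kd (e / (2 * (1 + normc d2))) (divr_gt0 e0 (mulr_gt0 (ltr0n R 2) K2)).
have [dl2 dl20 H2] := hd (e / (2 * (1 + normc d1))) (divr_gt0 e0 (mulr_gt0 (ltr0n R 2) K1)).
exists (Num.min dl1 (Num.min dl3 (dl2 / (1 + normc d1)))).
  by rewrite !lt_min dl10 dl30 divr_gt0.
move=> v; rewrite !lt_min ltr_pdivlMr // => /and3P[/H1 {}H1 /H3 {}H3 v2].
have L : normc (k v - k w) <= (1 + normc d1) * normc (v - w).
  rewrite -(subrK (d1 * (v - w)) (k v - k w)).
  apply: (le_trans (le_normcD _ _)); rewrite normcM mulrDl.
  exact: lerD.
have {}H2 := H2 (k v); have {}H2 := H2 (le_lt_trans L _).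
rewrite mulrC in v2; have {}H2 := H2 v2.
have -> : (h \o k) v - (h \o k) w - d2 * d1 * (v - w) =
  (h (k v) - h (k w) - d2 * (k v - k w)) + d2 * (k v - k w - d1 * (v - w)).
  by rewrite /=; ring.
apply: (le_trans (le_normcD _ _)); rewrite normcM.
have -> : e * normc (v - w) = e / 2 * normc (v - w) + e / 2 * normc (v - w).
  by field.
apply: lerD.
  apply: (le_trans H2); apply: (le_trans (ler_wpM2l _ L)).
    by rewrite divr_ge0 ?ltW // mulr_gt0.
  rewrite le_eqVlt; apply/orP; left; apply/eqP; field.
  by rewrite lt0r_neq0.
apply: (@le_trans _ _ ((1 + normc d2) * (e / (2 * (1 + normc d2)) * normc (v - w)))).
  apply: ler_pM => //; try exact: normc_ge0.
  by rewrite lerDr.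
rewrite le_eqVlt; apply/orP; left; apply/eqP; field.
by rewrite lt0r_neq0.
Qed.

Lemma cdiffM h k w d1 d2 : cdiff h w d1 -> cdiff k w d2 ->
  cdiff (fun v => h v * k v) w (d1 * k w + h w * d2).
Proof.
move=> /is_derive_cdiff H1 /is_derive_cdiff H2.
set g := fun v => h v * k v; set d := _ + _.
suff : is_derive (w : R[i]^o) (1 : R[i]^o) (g : R[i]^o -> R[i]^o) d by exact: (is_derive_cdiff g w d).1.
have := @is_deriveM _ _ (h : R[i]^o -> R[i]^o) (k : R[i]^o -> R[i]^o) w 1 d1 d2 H1 H2.
by move/is_derive_eq; apply; rewrite addrC /GRing.scale /= [k w * _]mulrC.
Qed.

Lemma cdiffD h k w d1 d2 : cdiff h w d1 -> cdiff k w d2 ->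
  cdiff (fun v => h v + k v) w (d1 + d2).
Proof.
move=> /is_derive_cdiff H1 /is_derive_cdiff H2; apply/is_derive_cdiff.
Qed.

Lemma cdiff_cst (c : R[i]) w : cdiff (fun=> c) w 0.
Proof. by apply/is_derive_cdiff; exact: is_derive_cst. Qed.

Lemma cdiff_id w : cdiff id w 1.
Proof. by apply/is_derive_cdiff; exact: is_derive_id. Qed.

Lemma cdiffV w : w != 0 -> cdiff (fun v => v^-1) w (- w ^- 2).
Proof.
move=> w0 e e0; have nw0 : 0 < normc w by rewrite normc_gt0.
(* The remainder is (v - w)^2 / (v w^2). The first radius gives |v| > |w| / 2, and the second then
   makes the remainder at most e |v - w|. *)
exists (Num.min (normc w / 2) (e * normc w ^+ 3 / 2)).
  by rewrite lt_min !divr_gt0 // mulr_gt0 // exprn_gt0.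
move=> v; rewrite lt_min => /andP[v1 v2].
have nv : normc w / 2 < normc v.
  have := le_normcD (w - v) v; rewrite subrK normc_distC; lra.
have nv0 : 0 < normc v by apply: lt_trans nv; rewrite divr_gt0.
have v0 : v != 0 by rewrite -normc_gt0.
have -> : v^-1 - w^-1 - - w ^- 2 * (v - w) = (v - w) ^+ 2 / (v * w ^+ 2).
  by field; rewrite v0 w0.
rewrite !(normcM, normcX, normcV) expr2 -mulrA mulrC ler_wpM2r ?normc_ge0 //.
rewrite ler_pdivrMr ?mulr_gt0 ?exprn_gt0 //.
apply: (le_trans (ltW v2)).
have -> : e * normc w ^+ 3 / 2 = e * (normc w / 2 * normc w ^+ 2) by field.
by rewrite ler_wpM2l ?ltW // ltr_pM2r // exprn_gt0.
Qed.

Lemma cdiff_inv k w d : cdiff k w d -> k w != 0 ->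
  cdiff (fun v => (k v)^-1) w (- (k w) ^- 2 * d).
Proof.
move=> kd kw0.
exact: (cdiff_comp (h := fun v => v^-1) kd (cdiffV kw0)).
Qed.

Lemma cdiffX h w d n : cdiff h w d ->
  cdiff (fun v => h v ^+ n.+1) w (n.+1%:R * h w ^+ n * d).
Proof.
move=> hd; elim: n => [|n IH].
  by rewrite expr0 !mul1r; apply: (cdiff_eq (r := 1)) hd => // v _; rewrite expr1.
have := cdiffM hd IH.
have -> : d * h w ^+ n.+1 + h w * (n.+1%:R * h w ^+ n * d) = n.+2%:R * h w ^+ n.+1 * d.
  by rewrite -[n.+2%:R]natr1 exprS; ring.
by apply: (cdiff_eq (r := 1)) => // v _; rewrite exprS.
Qed.

Lemma cdiff_unique h w d1 d2 : cdiff h w d1 -> cdiff h w d2 -> d1 = d2.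
Proof.
move=> /is_derive_cdiff H1 /is_derive_cdiff H2.
by rewrite -(@derive_val _ _ _ _ _ _ _ H1) (@derive_val _ _ _ _ _ _ _ H2).
Qed.

End ComplexDerivative.

(** * Goursat's theorem on rectangles *)

Section Goursat.
Context {R : realType}.
Local Notation mu := (@lebesgue_measure R).
Implicit Types (f g : R -> R) (h : R[i] -> R[i]).

(** Continuity in the ambient line, two-sided even at the endpoints, which the holomorphic
    integrands have anyway; it passes to subintervals at once. *)
Definition cont_in f (a b : R) := forall x, a <= x <= b -> {for x, continuous f}.

Lemma cont_in_sub f a b c d : a <= c -> d <= b -> cont_in f a b -> cont_in f c d.
Proof.
move=> ac db H x /andP[cx xd]; apply: H.
by rewrite (le_trans ac cx) (le_trans xd db).
Qed.

Lemma cont_inB f g a b : cont_in f a b -> cont_in g a b ->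
  cont_in (fun x => f x - g x) a b.
Proof. by move=> F G x xab; apply: cvgB; [exact: F|exact: G]. Qed.

Lemma cont_in_within f a b : cont_in f a b -> {within `[a, b], continuous f}.
Proof.
move=> H; apply: continuous_in_subspaceT => x; rewrite inE /= in_itv /=.
exact: H.
Qed.

Lemma cont_in_integrable f a b : cont_in f a b ->
  mu.-integrable `[a, b] (EFin \o f).
Proof.
move=> H; apply: (@continuous_compact_integrable R f); first exact: segment_compact.
exact: cont_in_within.
Qed.

Lemma Rint_split f a c b : a <= c -> c <= b -> cont_in f a b ->
  \int[mu]_(x in `[a, b]) f x =
  \int[mu]_(x in `[a, c]) f x + \int[mu]_(x in `[c, b]) f x.
Proof.
move=> ac cb H; apply/eqP; rewrite addrC -subr_eq; apply/eqP.
rewrite Rintegral_itvB ?bnd_simp //; last exact: cont_in_integrable.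
rewrite Rintegral_itv_obnd_cbnd //.
apply: integrableS (cont_in_integrable H) => //.
by move=> x /=; rewrite !in_itv /= => /andP[cx ->]; rewrite (le_trans ac) // ltW.
Qed.

Lemma Rint_cst_itv (k : R) a b : a <= b -> \int[mu]_(x in `[a, b]) k = k * (b - a).
Proof.
move=> ab; rewrite Rintegral_cst //= lebesgue_measure_itv /= lte_fin.
move: ab; rewrite le_eqVlt => /orP[/eqP ->|->] //=.
by rewrite ltxx subrr.
Qed.

Lemma Rint_near_cst f a b (k e : R) : a <= b -> cont_in f a b ->
  (forall x, a <= x <= b -> `|f x - k| <= e) ->
  `|\int[mu]_(x in `[a, b]) f x - k * (b - a)| <= e * (b - a).
Proof.
move=> ab cf H.
have I1 := cont_in_integrable cf.
have I2 : mu.-integrable `[a, b] (EFin \o (fun=> k)).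
  by apply: cont_in_integrable => x _; exact: cst_continuous.
have I3 : mu.-integrable `[a, b] (EFin \o (fun=> e)).
  by apply: cont_in_integrable => x _; exact: cst_continuous.
have C : cont_in (fun x => f x - k) a b.
  by move=> x xab; apply: (@cvgB _ _ _ _ _ f (fun=> k)); [exact: cf|exact: cvg_cst].
have I4 := cont_in_integrable C.
have I5 : mu.-integrable `[a, b] (EFin \o (fun x => `|f x - k|)).
  by apply: cont_in_integrable => x xab; apply: cvg_norm; exact: C.
rewrite -(Rint_cst_itv k ab) -(Rint_cst_itv e ab) -RintegralB //.
apply: (le_trans (le_normr_Rintegral _ I4)) => //.
apply: le_Rintegral => // x /=; rewrite in_itv /=; exact: H.
Qed.

(* The imaginary part of the contour integral of h along the boundary of
   [a, a + p] x [c, c + q]. *)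
Definition rect_defect h (a c p q : R) :=
  \int[mu]_(y in `[c, c + q]) (complex.Re (h ((a + p) +i* y)) - complex.Re (h (a +i* y)))
  - \int[mu]_(x in `[a, a + p]) (complex.Im (h (x +i* (c + q))) - complex.Im (h (x +i* c))).

Definition holo_rect h (a c p q : R) := forall x y,
  a <= x <= a + p -> c <= y <= c + q -> exists d, cdiff h (x +i* y) d.

Lemma cdiff_cont_lines h x y d : cdiff h (x +i* y) d ->
  [/\ {for x, continuous (fun t => complex.Re (h (t +i* y)))},
      {for x, continuous (fun t => complex.Im (h (t +i* y)))},
      {for y, continuous (fun t => complex.Re (h (x +i* t)))} &
      {for y, continuous (fun t => complex.Im (h (x +i* t)))}].
Proof.
move=> /cdiff_cont hc; split; apply/cvgrPdist_le => e /hc[dl dl0 H];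
exists dl => //= t /= tx.
- have /H : normc (t +i* y - x +i* y) < dl.
    by simpc; rewrite /= expr0n /= addr0 sqrtr_sqr distrC.
  rewrite normc_distC; apply: le_trans; apply: le_trans (ler_Re_normc _).
  by case: (h _) (h _) => [a b] [c f].
- have /H : normc (t +i* y - x +i* y) < dl.
    by simpc; rewrite /= expr0n /= addr0 sqrtr_sqr distrC.
  rewrite normc_distC; apply: le_trans; apply: le_trans (ler_Im_normc _).
  by case: (h _) (h _) => [a b] [c f].
- have /H : normc (x +i* t - x +i* y) < dl.
    by simpc; rewrite /= expr0n /= add0r sqrtr_sqr distrC.
  rewrite normc_distC; apply: le_trans; apply: le_trans (ler_Re_normc _).
  by case: (h _) (h _) => [a b] [c f].
- have /H : normc (x +i* t - x +i* y) < dl.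
    by simpc; rewrite /= expr0n /= add0r sqrtr_sqr distrC.
  rewrite normc_distC; apply: le_trans; apply: le_trans (ler_Im_normc _).
  by case: (h _) (h _) => [a b] [c f].
Qed.

Lemma holo_cont_y h a c p q x : holo_rect h a c p q -> a <= x <= a + p ->
  cont_in (fun y => complex.Re (h (x +i* y))) c (c + q).
Proof. by move=> H xab y /(H _ _ xab)[d /cdiff_cont_lines[]]. Qed.

Lemma holo_cont_x h a c p q y : holo_rect h a c p q -> c <= y <= c + q ->
  cont_in (fun x => complex.Im (h (x +i* y))) a (a + p).
Proof. by move=> H ycd x /H /(_ ycd)[d /cdiff_cont_lines[]]. Qed.

Definition cont_Re h x c d := cont_in (fun y => complex.Re (h (x +i* y))) c d.
Definition cont_Im h y a b := cont_in (fun x => complex.Im (h (x +i* y))) a b.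

(** The integrals over the common edge cancel. Continuity is assumed along the edges alone, so that
    the splitting also applies around a singularity. *)
Lemma rect_defect_hsplit h a c p1 p2 q : 0 <= p1 -> 0 <= p2 ->
  cont_Re h a c (c + q) -> cont_Re h (a + p1) c (c + q) ->
  cont_Re h (a + p1 + p2) c (c + q) ->
  cont_Im h c a (a + p1 + p2) -> cont_Im h (c + q) a (a + p1 + p2) ->
  rect_defect h a c (p1 + p2) q = rect_defect h a c p1 q + rect_defect h (a + p1) c p2 q.
Proof.
move=> p10 p20 r1 r2 r3 i1 i2; rewrite /rect_defect addrA.
have I1 := cont_in_integrable r1; have I2 := cont_in_integrable r2.
have I3 := cont_in_integrable r3.
have S y : cont_Im h y a (a + p1 + p2) -> [/\ mu.-integrable `[a, a + p1 + p2] (EFin \o (fun x => complex.Im (h (x +i* y)))),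
    mu.-integrable `[a, a + p1] (EFin \o (fun x => complex.Im (h (x +i* y)))),
    mu.-integrable `[a + p1, a + p1 + p2] (EFin \o (fun x => complex.Im (h (x +i* y)))) &
    \int[mu]_(x in `[a, (a + p1 + p2)]) complex.Im (h (x +i* y)) =
  \int[mu]_(x in `[a, (a + p1)]) complex.Im (h (x +i* y)) +
  \int[mu]_(x in `[(a + p1), (a + p1 + p2)]) complex.Im (h (x +i* y))].
  move=> C; split; last by apply: Rint_split => //; lra.
  - exact: cont_in_integrable.
  - by apply: cont_in_integrable; apply: cont_in_sub C; lra.
  - by apply: cont_in_integrable; apply: cont_in_sub C; lra.
have [a1 a2 a3 a4] := S _ i1; have [b1 b2 b3 b4] := S _ i2.
rewrite !RintegralB // a4 b4; ring.
Qed.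

Lemma rect_defect_vsplit h a c p q1 q2 : 0 <= q1 -> 0 <= q2 ->
  cont_Im h c a (a + p) -> cont_Im h (c + q1) a (a + p) ->
  cont_Im h (c + q1 + q2) a (a + p) ->
  cont_Re h a c (c + q1 + q2) -> cont_Re h (a + p) c (c + q1 + q2) ->
  rect_defect h a c p (q1 + q2) = rect_defect h a c p q1 + rect_defect h a (c + q1) p q2.
Proof.
move=> q10 q20 r1 r2 r3 i1 i2; rewrite /rect_defect addrA.
have I1 := cont_in_integrable r1; have I2 := cont_in_integrable r2.
have I3 := cont_in_integrable r3.
have S x : cont_Re h x c (c + q1 + q2) -> [/\ mu.-integrable `[c, c + q1 + q2] (EFin \o (fun y => complex.Re (h (x +i* y)))),
    mu.-integrable `[c, c + q1] (EFin \o (fun y => complex.Re (h (x +i* y)))),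
    mu.-integrable `[c + q1, c + q1 + q2] (EFin \o (fun y => complex.Re (h (x +i* y)))) &
    \int[mu]_(y in `[c, (c + q1 + q2)]) complex.Re (h (x +i* y)) =
  \int[mu]_(y in `[c, (c + q1)]) complex.Re (h (x +i* y)) +
  \int[mu]_(y in `[(c + q1), (c + q1 + q2)]) complex.Re (h (x +i* y))].
  move=> C; split; last by apply: Rint_split => //; lra.
  - exact: cont_in_integrable.
  - by apply: cont_in_integrable; apply: cont_in_sub C; lra.
  - by apply: cont_in_integrable; apply: cont_in_sub C; lra.
have [a1 a2 a3 a4] := S _ i1; have [b1 b2 b3 b4] := S _ i2.
rewrite !RintegralB // a4 b4; ring.
Qed.

Lemma rect_defect_split h a c p q : 0 <= p -> 0 <= q -> holo_rect h a c (p + p) (q + q) ->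
  rect_defect h a c (p + p) (q + q) =
  rect_defect h a c p q + rect_defect h (a + p) c p q +
  (rect_defect h a (c + q) p q + rect_defect h (a + p) (c + q) p q).
Proof.
move=> p0 q0 H.
have CR x c' d' : a <= x <= a + (p + p) -> c <= c' -> d' <= c + (q + q) -> cont_Re h x c' d'.
  by move=> xa cc dd; apply: cont_in_sub cc dd _; exact: holo_cont_y H xa.
have CI y a' b' : c <= y <= c + (q + q) -> a <= a' -> b' <= a + (p + p) -> cont_Im h y a' b'.
  by move=> yc aa bb; apply: cont_in_sub aa bb _; exact: holo_cont_x H yc.
rewrite addrACA rect_defect_hsplit; try first [by apply: CR; lra | by apply: CI; lra | lra].
by congr (_ + _); apply: rect_defect_vsplit; first [exact: q0 | by apply: CR; lra | by apply: CI; lra].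
Qed.

(** The affine part of [h] contributes nothing, since it makes both integrals of the defect equal to
    Re d p q. The rest is at most [e * (p + q)] on each of two opposite edges, integrated over the
    lengths [p] and [q]. *)
Lemma rect_defect_small h a c p q z d (e : R) : 0 <= p -> 0 <= q -> 0 <= e ->
  a <= complex.Re z <= a + p -> c <= complex.Im z <= c + q -> holo_rect h a c p q ->
  (forall x y, a <= x <= a + p -> c <= y <= c + q ->
    normc (h (x +i* y) - h z - d * (x +i* y - z)) <= e * normc (x +i* y - z)) ->
  `|rect_defect h a c p q| <= 2 * e * (p + q) ^+ 2.
Proof.
move=> p0 q0 e0 zx zy H hz; rewrite /rect_defect.
have B x y : a <= x <= a + p -> c <= y <= c + q ->
    normc (h (x +i* y) - h z - d * (x +i* y - z)) <= e * (p + q).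
  move=> xab ycd; apply: (le_trans (hz _ _ xab ycd)); apply: ler_wpM2l => //.
  apply: (le_trans (ler_normc_ReIm _)); case: z zx zy {hz} => z1 z2 /= zx zy.
  apply: lerD; rewrite ler_norml; apply/andP; split; lra.
have Pa : a <= a <= a + p by apply/andP; split; lra.
have Pb : a <= a + p <= a + p by apply/andP; split; lra.
have Qa : c <= c <= c + q by apply/andP; split; lra.
have Qb : c <= c + q <= c + q by apply/andP; split; lra.
set I1 := Rintegral _ _ _; set I2 := Rintegral _ _ _.
have E1 : `|I1 - complex.Re (d * p%:C) * q| <= 2 * e * (p + q) * q.
  have := @Rint_near_cst (fun y => complex.Re (h ((a + p) +i* y)) - complex.Re (h (a +i* y)))
    c (c + q) (complex.Re (d * p%:C)) (2 * e * (p + q)).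
  have -> : c + q - c = q by ring.
  apply; first by lra.
    by apply: cont_inB; [exact: holo_cont_y H Pb|exact: holo_cont_y H Pa].
  move=> y ycd; have b1 := B _ _ Pb ycd; have b2 := B _ _ Pa ycd.
  have -> : complex.Re (h ((a + p) +i* y)) - complex.Re (h (a +i* y)) - complex.Re (d * p%:C) =
    complex.Re ((h ((a + p) +i* y) - h z - d * ((a + p) +i* y - z)) -
     (h (a +i* y) - h z - d * (a +i* y - z))).
    case: (h (_ +i* _)) (h (a +i* y)) (h z) => [? ?] [? ?] [? ?].
    by case: z {B hz b1 b2 zx zy} => ? ?; case: (d) => ? ? /=; ring.
  apply: (le_trans (ler_Re_normc _)); apply: (le_trans (le_normcD _ _)).
  rewrite normcN; lra.
have E2 : `|I2 - complex.Re (d * p%:C) / p * q * p| <= 2 * e * (p + q) * p.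
  have := @Rint_near_cst (fun x => complex.Im (h (x +i* (c + q))) - complex.Im (h (x +i* c)))
    a (a + p) (complex.Re d * q) (2 * e * (p + q)).
  have -> : a + p - a = p by ring.
  have -> : complex.Re (d * p%:C) / p * q * p = complex.Re d * q * p.
    have [->|p1] := eqVneq p 0; first by rewrite !mulr0.
    by case: d {hz B E1} => d1 d2 /=; field.
  apply; first by lra.
    by apply: cont_inB; [exact: holo_cont_x H Qb|exact: holo_cont_x H Qa].
  move=> x xab; have b1 := B _ _ xab Qb; have b2 := B _ _ xab Qa.
  have -> : complex.Im (h (x +i* (c + q))) - complex.Im (h (x +i* c)) - complex.Re d * q =
    complex.Im ((h (x +i* (c + q)) - h z - d * (x +i* (c + q) - z)) -
     (h (x +i* c) - h z - d * (x +i* c - z))).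
    case: (h (_ +i* _)) (h (x +i* c)) (h z) => [? ?] [? ?] [? ?].
    by case: z {B hz b1 b2 E1 zx zy} => ? ?; case: (d) => ? ? /=; ring.
  apply: (le_trans (ler_Im_normc _)); apply: (le_trans (le_normcD _ _)).
  rewrite normcN; lra.
have E3 : complex.Re (d * p%:C) * q = complex.Re (d * p%:C) / p * q * p.
  have [->|p1] := eqVneq p 0; first by case: d {hz B E1 E2} => d1 d2 /=; ring.
  by field.
rewrite E3 in E1.
have -> : I1 - I2 = (I1 - complex.Re (d * p%:C) / p * q * p) - (I2 - complex.Re (d * p%:C) / p * q * p) by ring.
apply: (le_trans (ler_normB _ _)); apply: (le_trans (lerD E1 E2)).
by rewrite le_eqVlt; apply/orP; left; apply/eqP; ring.
Qed.

(** Complex differentiability carries no continuity of the derivative, so the argument is repeated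
    bisection: some quarter always keeps a quarter of the defect, while around the limit point the
    defect of a rectangle of size s is o(s^2). *)
Theorem goursat_rect h a c p q : 0 <= p -> 0 <= q -> holo_rect h a c p q ->
  rect_defect h a c p q = 0.
Proof.
move=> p0 q0 H; apply/eqP/negPn/negP => E0.
pose K := `|rect_defect h a c p q|.
have K0 : 0 < K by rewrite normr_gt0.
pose E n (z : R * R) := `|rect_defect h z.1 z.2 (p / 2 ^+ n) (q / 2 ^+ n)|.
(* Lower left corner of the first quarter whose defect is large enough; the last quarter is the
   default, and [big] shows that it qualifies when the other three do not. *)
pose step n (z : R * R) : R * R :=
  let p' := p / 2 ^+ n.+1 in let q' := q / 2 ^+ n.+1 in
  if K / 4 ^+ n.+1 <= E n.+1 z then z else
  if K / 4 ^+ n.+1 <= E n.+1 (z.1 + p', z.2) then (z.1 + p', z.2) else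
  if K / 4 ^+ n.+1 <= E n.+1 (z.1, z.2 + q') then (z.1, z.2 + q') else
  (z.1 + p', z.2 + q').
pose z := fix F n := if n is m.+1 then step m (F m) else (a, c).
have p2 n : 0 <= p / 2 ^+ n by rewrite divr_ge0 // exprn_ge0.
have q2 n : 0 <= q / 2 ^+ n by rewrite divr_ge0 // exprn_ge0.
have half (x : R) n : x / 2 ^+ n = x / 2 ^+ n.+1 + x / 2 ^+ n.+1.
  by rewrite exprS; field; rewrite expf_neq0.
have zS n : [/\ (z n).1 <= (z n.+1).1, (z n).2 <= (z n.+1).2,
    (z n.+1).1 + p / 2 ^+ n.+1 <= (z n).1 + p / 2 ^+ n &
    (z n.+1).2 + q / 2 ^+ n.+1 <= (z n).2 + q / 2 ^+ n].
  rewrite /= /step (half p n) (half q n); have := p2 n.+1; have := q2 n.+1.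
  set P := p / _; set Q := q / _ => Q0 P0.
  by clear -P0 Q0; do 3?case: ifP => _ /=; split; lra.
have zle m n : (m <= n)%N -> [/\ (z m).1 <= (z n).1, (z m).2 <= (z n).2,
    (z n).1 + p / 2 ^+ n <= (z m).1 + p / 2 ^+ m &
    (z n).2 + q / 2 ^+ n <= (z m).2 + q / 2 ^+ m].
  elim: n => [|n IH]; first by rewrite leqn0 => /eqP ->.
  rewrite leq_eqVlt => /orP[/eqP ->//|]; rewrite ltnS => /IH[i1 i2 i3 i4].
  have [j1 j2 j3 j4] := zS n.
  by split; [exact: le_trans i1 j1|exact: le_trans i2 j2|exact: le_trans j3 i3|exact: le_trans j4 i4].
have holo n : holo_rect h (z n).1 (z n).2 (p / 2 ^+ n) (q / 2 ^+ n).
  have [/= i1 i2 i3 i4] := zle 0 n (leq0n n); move: i3 i4; rewrite !expr0 !divr1 => i3 i4.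
  move=> x y /andP[x1 x2] /andP[y1 y2]; apply: H; apply/andP; split; lra.
have big n : K / 4 ^+ n <= E n (z n).
  elim: n => [|n IH]; first by rewrite /E /= !expr0 !divr1.
  rewrite /= /step; case: ifP => // /negbT n1; case: ifP => // /negbT n2.
  case: ifP => // /negbT n3; move: n1 n2 n3; rewrite -!ltNge => n1 n2 n3.
  have := IH; have hn := holo n; rewrite (half p n) (half q n) in hn.
  rewrite {1}/E (half p n) (half q n) rect_defect_split // => J.
  have := le_trans J (ler_normD _ _).
  move=> /le_trans /(_ (lerD (ler_normD _ _) (ler_normD _ _))).
  move: n1 n2 n3; rewrite /E /=.
  have -> : K / 4 ^+ n = 4 * (K / 4 ^+ n.+1).
    by rewrite exprS; field; rewrite expf_neq0.
  lra.
(* The corners increase and stay below every right or upper edge, so their suprema lie in all the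
   nested rectangles. *)
pose x := sup (range (fun n => (z n).1)); pose y := sup (range (fun n => (z n).2)).
have xub n : ubound (range (fun m => (z m).1)) ((z n).1 + p / 2 ^+ n).
  move=> _ [m _ <-]; have [mn|/ltnW nm] := leqP m n.
    by have [i _ _ _] := zle _ _ mn; rewrite (le_trans i) // lerDl.
  by have [_ _ i _] := zle _ _ nm; apply: le_trans i; rewrite lerDl.
have yub n : ubound (range (fun m => (z m).2)) ((z n).2 + q / 2 ^+ n).
  move=> _ [m _ <-]; have [mn|/ltnW nm] := leqP m n.
    by have [_ i _ _] := zle _ _ mn; rewrite (le_trans i) // lerDl.
  by have [_ _ _ i] := zle _ _ nm; apply: le_trans i; rewrite lerDl.
have xin n : (z n).1 <= x <= (z n).1 + p / 2 ^+ n.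
  apply/andP; split; last by apply: ge_sup; [exists (z 0).1; exists 0%N|exact: xub].
  by apply: ub_le_sup; [eexists; exact: (xub 0%N)|exists n].
have yin n : (z n).2 <= y <= (z n).2 + q / 2 ^+ n.
  apply/andP; split; last by apply: ge_sup; [exists (z 0).2; exists 0%N|exact: yub].
  by apply: ub_le_sup; [eexists; exact: (yub 0%N)|exists n].
have [d hd] : exists d, cdiff h (x +i* y) d.
  have := H x y; have := xin 0%N; have := yin 0%N; rewrite /= !expr0 !divr1 => -> -> H'.
  exact: H'.
(* Chosen to make 2 e (p + q)^2 less than [K]; adding 1 covers the degenerate case p + q = 0. *)
pose e := K / (4 * ((p + q) ^+ 2 + 1)).
have S0 : 0 < (p + q) ^+ 2 + 1 by rewrite ltr_wpDl // sqr_ge0.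
have e0 : 0 < e by rewrite divr_gt0 // mulr_gt0.
have [dl dl0 hdl] := hd e e0.
have [n hn] : exists n : nat, (p + q) / 2 ^+ n < dl.
  pose N := Num.truncn ((p + q) / dl); exists N.+1.
  rewrite ltr_pdivrMr ?exprn_gt0 // mulrC -ltr_pdivrMr //.
  apply: (lt_trans (truncnS_gt _)); rewrite -natrX ltr_nat.
  exact: ltn_expl.
have S := @rect_defect_small h _ _ _ _ (x +i* y) d e (p2 n) (q2 n) (ltW e0)
  (xin n) (yin n) (holo n).
have : E n (z n) <= 2 * e * (p / 2 ^+ n + q / 2 ^+ n) ^+ 2.
  apply: S => x' y' x'in y'in; apply: hdl.
  apply: le_lt_trans hn; apply: (le_trans (ler_normc_ReIm _)) => /=.
  have := xin n; have := yin n; rewrite mulrDl => ? ?.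
  by apply: lerD; rewrite ler_norml; apply/andP; split; lra.
apply/negP; rewrite -ltNge; apply: lt_le_trans (big n).
rewrite -mulrDl expr_div_n -exprM mulnC exprM (_ : 2 ^+ 2 = 4); last by ring.
rewrite mulrA ltr_pM2r ?invr_gt0 ?exprn_gt0 // /e.
rewrite -[ltRHS]mulr1 (_ : 2 * _ * _ = K * ((p + q) ^+ 2 / (2 * ((p + q) ^+ 2 + 1)))); last first.
  by field; apply: lt0r_neq0.
rewrite ltr_pM2l // ltr_pdivrMr ?mulr_gt0 // mul1r; have := sqr_ge0 (p + q); lra.
Qed.

End Goursat.

(** * Measurability of functions continuous in the plane *)

Section Measurability.
Context {R : realType}.
Local Notation mu := (@lebesgue_measure R).
Local Notation RR := (measurableTypeR R * measurableTypeR R)%type.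

Definition open2 (U : set RR) := forall p, U p -> exists2 r : R, 0 < r &
  forall x y : R, `|x - p.1| < r -> `|y - p.2| < r -> U (x, y).

(** The sigma-algebra is that of the product, so [U] is exhibited as a countable union of boxes with
    rational centres and radii. *)
Lemma open2_measurable (U : set RR) : open2 U -> measurable U.
Proof.
move=> oU.
pose box (q1 q2 r : rat) : set RR :=
  `]ratr q1 - ratr r, ratr q1 + ratr r[%classic `*` `]ratr q2 - ratr r, ratr q2 + ratr r[%classic.
(* Boxes that stick out of [U] are replaced by the empty set, so that the union runs over all
   rational triples. *)
pose B q1 q2 r := if `[< box q1 q2 r `<=` U >] then box q1 q2 r else set0.
have -> : U = \bigcup_q1 \bigcup_q2 \bigcup_r B q1 q2 r.
  apply/seteqP; split => [[p1 p2] Up|p [q1 _ [q2 _ [r _]]]]; last first.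
    by rewrite /B; case: asboolP => // H /H.
  have [e e0 He] := oU _ Up.
  have [r] : exists r : rat, ratr r \in `]0, (e / 2)[.
    by apply: rat_in_itvoo; rewrite divr_gt0.
  rewrite in_itv /= => /andP[r0 re].
  have [q1] : exists q : rat, ratr q \in `](p1 - ratr r), (p1 + ratr r)[.
    by apply: rat_in_itvoo; rewrite ltrBlDr -addrA ltrDl addr_gt0.
  have [q2] : exists q : rat, ratr q \in `](p2 - ratr r), (p2 + ratr r)[.
    by apply: rat_in_itvoo; rewrite ltrBlDr -addrA ltrDl addr_gt0.
  rewrite !in_itv /= => /andP[q21 q22] /andP[q11 q12].
  exists q1 => //; exists q2 => //; exists r => //.
  rewrite /B; case: asboolP => [_|H].
    by split; rewrite /= in_itv /=; apply/andP; split; lra.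
  exfalso; apply: H => -[x y] [/=]; rewrite !in_itv /= => /andP[x1 x2] /andP[y1 y2].
  by apply: He => /=; rewrite ltr_norml; apply/andP; split; lra.
apply: bigcupT_measurable_rat => q1; apply: bigcupT_measurable_rat => q2.
apply: bigcupT_measurable_rat => r; rewrite /B; case: ifP => // _.
by apply: measurableX; exact: measurable_itv.
Qed.

Lemma cont2_measurable (D : set RR) (F : RR -> R) : measurable D ->
  (forall p, D p -> forall e, 0 < e -> exists2 r : R, 0 < r &
    forall x y : R, `|x - p.1| < r -> `|y - p.2| < r -> `|F (x, y) - F p| < e) ->
  measurable_fun D F.
Proof.
move=> mD cF; apply: (measurability _ (RGenOInfty.measurableE R)) => // _ [_ [a ->] <-].
(* The interior of the superlevel set: it is open in the whole plane, and continuity at the points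
   of [D] makes it agree with the superlevel set there. *)
pose U : set RR := [set p | exists2 r : R, 0 < r &
   forall x y : R, `|x - p.1| < r -> `|y - p.2| < r -> a < F (x, y)].
have -> : D `&` F @^-1` `]a, +oo[%classic = D `&` U.
  apply/seteqP; split => p [Dp /=]; rewrite in_itv /= andbT.
    move=> aF; split => //; have [r r0 H] := cF _ Dp (F p - a) ltac:(by rewrite subr_gt0).
    exists r => // x y xr yr; have := H _ _ xr yr; rewrite ltr_norml => /andP[]; lra.
  by case=> r r0 H; split => //; case: p Dp H => x y _; apply => /=; rewrite subrr normr0.
apply: measurableI => //; apply: open2_measurable => p [r r0 H].
exists (r / 2); first by rewrite divr_gt0.
move=> x y xr yr; exists (r / 2); first by rewrite divr_gt0.
move=> x' y' /= xr' yr'; apply: H.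
  by have := ler_normD (x' - x) (x - p.1); rewrite addrA subrK; lra.
by have := ler_normD (y' - y) (y - p.2); rewrite addrA subrK; lra.
Qed.

Lemma cdiff_measurable (D : set RR) (h : R[i] -> R[i]) : measurable D ->
  (forall p, D p -> exists d, cdiff h (p.1 +i* p.2) d) ->
  measurable_fun D (fun p => complex.Re (h (p.1 +i* p.2))) /\
  measurable_fun D (fun p => complex.Im (h (p.1 +i* p.2))).
Proof.
move=> mD hD.
have K p (Dp : D p) e : 0 < e -> exists2 r : R, 0 < r &
    forall x y : R, `|x - p.1| < r -> `|y - p.2| < r ->
    normc (h (x +i* y) - h (p.1 +i* p.2)) < e.
  move=> e0; have [d /cdiff_cont hd] := hD _ Dp.
  have [dl dl0 H] := hd (e / 2) ltac:(by rewrite divr_gt0).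
  exists (dl / 2) => [|x y xd yd]; first by rewrite divr_gt0.
  apply: (@le_lt_trans _ _ (e / 2)); last by lra.
  apply: H; apply: (le_lt_trans (ler_normc_ReIm _)); simpc => /=; lra.
split; apply: cont2_measurable => // p Dp e /(K _ Dp)[r r0 H]; exists r => // x y xr yr.
  apply: le_lt_trans (H _ _ xr yr); apply: le_trans (ler_Re_normc _).
  by case: (h _) (h _) => [? ?] [? ?].
apply: le_lt_trans (H _ _ xr yr); apply: le_trans (ler_Im_normc _).
by case: (h _) (h _) => [? ?] [? ?].
Qed.

End Measurability.

(** * Affine substitution on the line *)

Section AffineSubstitution.
Context {R : realType}.
Local Notation mu := (@lebesgue_measure R).

(** Lebesgue measure is determined by its values on half-open intervals, where the identity is a
    computation. *)
Lemma lebesgue_measure_affine (a b : R) (A : set (measurableTypeR R)) : 0 < a ->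
  measurable A ->
  (a%:E * pushforward mu (fun x : measurableTypeR R => (a * x + b)%R : measurableTypeR R) A = mu A)%E.
Proof.
move=> a0 mA.
have mphi : measurable_fun setT (fun x : measurableTypeR R => a * x + b : measurableTypeR R).
  apply: measurable_funD; last exact: measurable_cst.
  by apply: measurable_funM; [exact: measurable_cst|exact: measurable_id].
pose nu := mscale (NngNum (ltW a0)) (pushforward mu (fun x : measurableTypeR R => a * x + b : measurableTypeR R)).
apply/esym.
have := @lebesgue_measure_unique R (nu mphi).
move=> -> //.
move=> _ [[u v]] _ <-.
transitivity (a%:E * mu ((fun x : measurableTypeR R => (a * x + b)%R) @^-1` `]u, v]%classic))%E; last by [].
rewrite (_ : preimage _ _ = `]((u - b) / a), ((v - b) / a)]%classic); last first.
  apply/seteqP; split => x /=; rewrite !in_itv /= ltr_pdivrMr // ler_pdivlMr // => /andP[? ?];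
  apply/andP; split; lra.
rewrite !lebesgue_measure_itv /= !lte_fin ltr_pM2r ?invr_gt0 // ltrD2r.
case: ifP => _; last by rewrite mule0.
by rewrite -!EFinD -EFinM; congr EFin; field; rewrite lt0r_neq0.
Qed.

Lemma ge0_integral_affine (a b : R) (f : R -> \bar R) : 0 < a ->
  measurable_fun setT f -> (forall x, 0 <= f x)%E ->
  (\int[mu]_x f x = a%:E * \int[mu]_x f (a * x + b)%R)%E.
Proof.
move=> a0 mf f0.
have mphi : measurable_fun setT (fun x : measurableTypeR R => a * x + b : measurableTypeR R).
  apply: measurable_funD; last exact: measurable_cst.
  by apply: measurable_funM; [exact: measurable_cst|exact: measurable_id].
pose phi := (fun x : measurableTypeR R => a * x + b : measurableTypeR R).
have := ge0_integral_pushforward mphi mu measurableT mf (fun x _ => f0 x).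
rewrite preimage_setT => /esym E1.
transitivity (a%:E * \int[pushforward mu phi]_x f x)%E; last by rewrite -E1.
rewrite -(ge0_integral_mscale (pushforward mu phi) measurableT (NngNum (ltW a0)) mf) //.
apply: eq_measure_integral => A mA _.
exact/esym/lebesgue_measure_affine.
Qed.

End AffineSubstitution.

(** * Goursat's theorem around a removable singularity *)

Section RemovableSingularity.
Context {R : realType}.
Local Notation mu := (@lebesgue_measure R).
Implicit Types (h : R[i] -> R[i]).

Definition punct_holo h (z : R[i]) a c p q := forall x y,
  a <= x <= a + p -> c <= y <= c + q -> x +i* y <> z -> exists d, cdiff h (x +i* y) d.

Lemma punct_holo_rect h z a c p q a' c' p' q' : punct_holo h z a c p q ->
  a <= a' -> a' + p' <= a + p -> c <= c' -> c' + q' <= c + q ->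
  (complex.Re z < a' \/ a' + p' < complex.Re z \/ complex.Im z < c' \/ c' + q' < complex.Im z) ->
  holo_rect h a' c' p' q'.
Proof.
move=> H a1 a2 c1 c2 zout x y /andP[x1 x2] /andP[y1 y2]; apply: H.
- by apply/andP; split; lra.
- by apply/andP; split; lra.
- by move=> Ez; move: zout; rewrite -Ez /=; lra.
Qed.

Lemma punct_cont_Re h z a c p q x c' d' : punct_holo h z a c p q -> a <= x <= a + p ->
  x <> complex.Re z -> c <= c' -> d' <= c + q -> cont_Re h x c' d'.
Proof.
move=> H xa xz cc dd y /andP[y1 y2].
have [||d /cdiff_cont_lines[] //] := H x y xa; first by apply/andP; split; lra.
by move=> Ez; apply: xz; rewrite -Ez.
Qed.

Lemma punct_cont_Im h z a c p q y a' b' : punct_holo h z a c p q -> c <= y <= c + q ->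
  y <> complex.Im z -> a <= a' -> b' <= a + p -> cont_Im h y a' b'.
Proof.
move=> H yc yz aa bb x /andP[x1 x2].
have [||d /cdiff_cont_lines[] //] := H x y _ yc; first by apply/andP; split; lra.
by move=> Ez; apply: yz; rewrite -Ez.
Qed.

Lemma punct_holo_sub h z a c p q a' c' p' q' : punct_holo h z a c p q ->
  a <= a' -> a' + p' <= a + p -> c <= c' -> c' + q' <= c + q -> punct_holo h z a' c' p' q'.
Proof. by move=> H a1 a2 c1 c2 x y /andP[x1 x2] /andP[y1 y2]; apply: H; apply/andP; split; lra. Qed.

(** The two side strips avoid [z], so Goursat's theorem removes them. *)
Lemma punct_hshrink h z a c p1 p2 p3 q : 0 <= p1 -> 0 <= p3 -> 0 <= q ->
  a + p1 < complex.Re z < a + p1 + p2 -> c < complex.Im z < c + q ->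
  punct_holo h z a c (p1 + (p2 + p3)) q ->
  rect_defect h a c (p1 + (p2 + p3)) q = rect_defect h (a + p1) c p2 q.
Proof.
move=> p10 p30 q0 /andP[z1 z2] /andP[z3 z4] H.
have CR x : a <= x <= a + (p1 + (p2 + p3)) -> x <> complex.Re z -> cont_Re h x c (c + q).
  by move=> xa xz; exact: punct_cont_Re H xa xz _ _.
have CI y a' b' : c <= y <= c + q -> y <> complex.Im z -> a <= a' -> b' <= a + (p1 + (p2 + p3)) -> cont_Im h y a' b'.
  by move=> yc yz; exact: punct_cont_Im H yc yz.
rewrite rect_defect_hsplit; try first [by apply: CR; lra | by apply: CI; lra | lra].
rewrite goursat_rect ?add0r //; last by apply: (punct_holo_rect H); lra.
rewrite rect_defect_hsplit; try first [by apply: CR; lra | by apply: CI; lra | lra].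
by rewrite [X in _ + X]goursat_rect ?addr0 //; apply: (punct_holo_rect H); lra.
Qed.

Lemma punct_vshrink h z a c p q1 q2 q3 : 0 <= q1 -> 0 <= q3 -> 0 <= p ->
  a < complex.Re z < a + p -> c + q1 < complex.Im z < c + q1 + q2 ->
  punct_holo h z a c p (q1 + (q2 + q3)) ->
  rect_defect h a c p (q1 + (q2 + q3)) = rect_defect h a (c + q1) p q2.
Proof.
move=> q10 q30 p0 /andP[z1 z2] /andP[z3 z4] H.
have CI y : c <= y <= c + (q1 + (q2 + q3)) -> y <> complex.Im z -> cont_Im h y a (a + p).
  by move=> yc yz; exact: punct_cont_Im H yc yz _ _.
have CR x c' d' : a <= x <= a + p -> x <> complex.Re z -> c <= c' -> d' <= c + (q1 + (q2 + q3)) -> cont_Re h x c' d'.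
  by move=> xa xz; exact: punct_cont_Re H xa xz.
rewrite rect_defect_vsplit; try first [by apply: CR; lra | by apply: CI; lra | lra].
rewrite goursat_rect ?add0r //; last by apply: (punct_holo_rect H); lra.
rewrite rect_defect_vsplit; try first [by apply: CR; lra | by apply: CI; lra | lra].
by rewrite [X in _ + X]goursat_rect ?addr0 //; apply: (punct_holo_rect H); lra.
Qed.

Lemma rect_defect_le h a c p q B : 0 <= p -> 0 <= q ->
  cont_Re h a c (c + q) -> cont_Re h (a + p) c (c + q) ->
  cont_Im h c a (a + p) -> cont_Im h (c + q) a (a + p) ->
  (forall y, c <= y <= c + q -> normc (h (a +i* y)) <= B /\ normc (h ((a + p) +i* y)) <= B) ->
  (forall x, a <= x <= a + p -> normc (h (x +i* c)) <= B /\ normc (h (x +i* (c + q))) <= B) ->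
  `|rect_defect h a c p q| <= 2 * B * (p + q).
Proof.
move=> p0 q0 r1 r2 i1 i2 HR HI; rewrite /rect_defect.
have E1 := @Rint_near_cst R _ c (c + q) 0 (2 * B) _ (cont_inB r2 r1) _.
have E2 := @Rint_near_cst R _ a (a + p) 0 (2 * B) _ (cont_inB i2 i1) _.
have s (x y : R) : x + y - x = y by ring.
rewrite mul0r subr0 s in E1; rewrite mul0r subr0 s in E2.
apply: (le_trans (ler_normB _ _)); rewrite mulrDr [leRHS]addrC; apply: lerD.
- apply: E1; first by rewrite lerDl.
  move=> y /HR[b1 b2]; rewrite subr0 mulr_natl mulr2n; apply: (le_trans (ler_normB _ _)).
  by apply: lerD; apply: (le_trans (ler_Re_normc _)).
- apply: E2; first by rewrite lerDl.
  move=> y /HI[b1 b2]; rewrite subr0 mulr_natl mulr2n; apply: (le_trans (ler_normB _ _)).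
  by apply: lerD; apply: (le_trans (ler_Im_normc _)).
Qed.

(** Shrinking to a square of side 2t around [z] does not change the defect, and boundedness of [h]
    makes it O(t). *)
Lemma goursat_rect_removable h z a c p q (B r : R) : 0 < r ->
  a < complex.Re z < a + p -> c < complex.Im z < c + q ->
  punct_holo h z a c p q ->
  (forall w, w <> z -> normc (w - z) < r -> normc (h w) <= B) ->
  rect_defect h a c p q = 0.
Proof.
move=> r0 /andP[az zp] /andP[cz zq] H hB.
have B0 : 0 <= B.
  have n1 : z + (r / 2)%:C <> z by case: (z) => u v; simpc => -[]; lra.
  have n2 : normc (z + (r / 2)%:C - z) < r.
    rewrite addrAC subrr add0r normc_real ger0_norm; lra.
  exact: le_trans (normc_ge0 _) (hB _ n1 n2).
set z1 := complex.Re z in az zp *; set z2 := complex.Im z in cz zq *.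
(* The small square has defect at most 2 B (4 t), hence the factor 8 B; adding 1 keeps the divisor
   positive. *)
suff K e : 0 < e -> `|rect_defect h a c p q| <= e * (8 * B + 1).
  have K1 : 0 < 8 * B + 1 by lra.
  apply/eqP; rewrite -normr_eq0 eq_le normr_ge0 andbT; apply/ler_addgt0Pr => e e0.
  by have := K (e / (8 * B + 1)) (divr_gt0 e0 K1); rewrite divfK ?lt0r_neq0 // add0r.
move=> e0.
(* [3 * t <= r] places the boundary of the square, whose points are within 2t of [z], inside the
   disc where [B] bounds [h]. *)
have [t [t0 te tr [ta tp tc tq]]] : exists t, [/\ 0 < t, t <= e, 3 * t <= r &
   [/\ t < z1 - a, t < a + p - z1, t < z2 - c & t < c + q - z2]].
  pose m := Num.min e (Num.min r (Num.min (Num.min (z1 - a) (a + p - z1)) (Num.min (z2 - c) (c + q - z2)))).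
  have m0 : 0 < m by rewrite !lt_min; do ?(apply/andP; split); lra.
  have : m <= m by []; rewrite {2}/m !le_min => /and3P[m1 m2 /andP[/andP[m3 m4] /andP[m5 m6]]].
  by exists (m / 3); split; [lra|lra|lra|split; lra].
have -> : rect_defect h a c p q = rect_defect h (z1 - t) (z2 - t) (t + t) (t + t).
  have Ep : p = (z1 - t - a) + ((t + t) + (a + p - z1 - t)) by ring.
  have Eq : q = (z2 - t - c) + ((t + t) + (c + q - z2 - t)) by ring.
  have H1 := H; rewrite Ep in H1; rewrite {1}Ep (punct_hshrink (z := z)) ?subrKC -/z1 -/z2 //; try lra.
  have H2 : punct_holo h z (z1 - t) c (t + t) q by apply: (punct_holo_sub H); lra.
  rewrite Eq in H2; rewrite {1}Eq (punct_vshrink (z := z)) ?subrKC -/z1 -/z2 //; lra.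
have H' : punct_holo h z (z1 - t) (z2 - t) (t + t) (t + t) by apply: (punct_holo_sub H); lra.
have tn (u v : R) : v - t <= u <= v - t + (t + t) -> `|u - v| <= t.
  by move=> /andP[u1 u2]; rewrite ler_norml; clear -u1 u2; lra.
have hb x y : z1 - t <= x <= z1 - t + (t + t) -> z2 - t <= y <= z2 - t + (t + t) ->
    x != z1 \/ y != z2 -> normc (h (x +i* y)) <= B.
  move=> /tn xt /tn yt nz; apply: hB.
    by move=> E; move: nz; rewrite /z1 /z2 -E /= !eqxx; case.
  have -> : x +i* y - z = (x - z1) +i* (y - z2) by rewrite /z1 /z2; case: (z).
  apply: (le_lt_trans (ler_normc_ReIm _)) => /=.
  by apply: (le_lt_trans (lerD xt yt)); clear -t0 tr; lra.
have tt : 0 <= t + t by clear -t0; lra.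
have t1 (u : R) : u - t <= u - t <= u - t + (t + t) by clear -t0; lra.
have t2 (u : R) : u - t <= u - t + (t + t) <= u - t + (t + t) by clear -t0; lra.
have n1 (u : R) : u - t != u by clear -t0; lra.
have n2 (u : R) : u - t + (t + t) != u by clear -t0; lra.
apply: (@le_trans _ _ (2 * B * ((t + t) + (t + t)))).
  apply: (rect_defect_le tt tt).
  - by apply: (punct_cont_Re H' (t1 _)) => //; exact/eqP.
  - by apply: (punct_cont_Re H' (t2 _)) => //; exact/eqP.
  - by apply: (punct_cont_Im H' (t1 _)) => //; exact/eqP.
  - by apply: (punct_cont_Im H' (t2 _)) => //; exact/eqP.
  - by move=> y yy; split; apply: hb => //; left.
  - by move=> x xx; split; apply: hb => //; right.
have : t * (8 * B + 1) <= e * (8 * B + 1) by apply: ler_wpM2r => //; clear -B0; lra.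
by clear -t0; lra.
Qed.

End RemovableSingularity.

(** * Shifting integrals between vertical lines *)

Section StripShift.
Context {R : realType}.
Local Notation mu := (@lebesgue_measure R).
Local Notation RR := (measurableTypeR R * measurableTypeR R)%type.

Lemma ge0_integral_opp (f : R -> \bar R) :
  measurable_fun setT f -> (forall x, 0 <= f x)%E ->
  (\int[mu]_x f x = \int[mu]_x f (- x)%R)%E.
Proof.
move=> mf f0.
have mphi : measurable_fun setT (-%R : measurableTypeR R -> measurableTypeR R).
  exact: oppr_measurable.
have := ge0_integral_pushforward mphi mu measurableT mf (fun x _ => f0 x).
rewrite preimage_setT => <-.
by apply: eq_measure_integral => A mA _; exact/esym/lebesgue_measureN.
Qed.

(** Monotone convergence for |f| on the intervals [-n, n] bounds the tail for all larger [y] at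
    once. *)
Lemma integrable_tail (f : R -> R) : mu.-integrable setT (EFin \o f) ->
  forall e, 0 < e -> exists N : R, forall y, N <= y ->
  `|Rintegral mu setT f - \int[mu]_(x in `[(- y), y]) f x| < e.
Proof.
move=> If e e0.
have Ia : mu.-integrable setT (EFin \o (normr \o f)) by exact: integrable_norm.
pose F (n : nat) : set (measurableTypeR R) := `[(- n%:R), n%:R]%classic.
have FT : \bigcup_n F n = setT.
  apply/seteqP; split => // x _; exists (Num.truncn `|x|).+1 => //.
  rewrite /F /= in_itv /= -ler_norml; exact/ltW/truncnS_gt.
have mF i : measurable (F i) by exact: measurable_itv.
have ndF : nondecreasing_seq F.
  move=> m n mn; apply/subsetPset => x; rewrite /F /= !in_itv /= -!ler_norml => /le_trans; apply.
  by rewrite ler_nat.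
have := @ge0_nondecreasing_set_cvg_integral _ _ R F (EFin \o (normr \o f)) mu ndF mF.
have mfa : measurable_fun setT (EFin \o (normr \o f)) by exact: measurable_int Ia.
move=> /(_ (fun i => measurable_funS measurableT (subsetT _) mfa)) H.
have {}H := H ltac:(by move=> i x _; rewrite lee_fin /=; exact: normr_ge0).
rewrite FT in H.
have fin D : measurable D -> (\int[mu]_(x in D) (EFin \o (normr \o f)) x)%E \is a fin_num.
  by move=> mD; apply: integrable_fin_num => //; exact: integrableS Ia.
have [N _ HN] : \forall n \near \oo, `|Rintegral mu setT (normr \o f) - Rintegral mu (F n) (normr \o f)| < e.
  have C : (fun n => Rintegral mu (F n) (normr \o f)) @ \oo --> Rintegral mu setT (normr \o f); last by have /cvgrPdist_lt /(_ _ e0) := C.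
  apply: fine_cvg.
  rewrite -/(Rintegral mu setT _) /Rintegral fineK //; exact: fin.
exists N%:R => y Ny.
have IS (D : set (measurableTypeR R)) g : measurable D -> mu.-integrable setT (EFin \o g) -> mu.-integrable D (EFin \o g).
  by move=> mD; apply: integrableS.
have mI : measurable (`[(- y), y]%classic : set (measurableTypeR R)) by exact: measurable_itv.
have mC : measurable (~` `[(- y), y]%classic : set (measurableTypeR R)) by exact: measurableC.
have SU g : mu.-integrable setT (EFin \o g) -> Rintegral mu setT g = \int[mu]_(x in `[(- y), y]) g x + \int[mu]_(x in ~` `[(- y), y]%classic) g x.
  move=> Ig; rewrite -Rintegral_setU ?setUv //.
  by apply/disj_setPS; rewrite setICr.
rewrite (SU _ If) addrAC subrr add0r.
apply: (le_lt_trans (le_normr_Rintegral mC (IS _ _ mC If))).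
have -> : \int[mu]_(x in ~` `[(- y), y]%classic) `|f x| = Rintegral mu setT (normr \o f) - \int[mu]_(x in `[(- y), y]) (normr \o f) x.
  by rewrite (SU _ Ia) addrAC subrr add0r.
apply: le_lt_trans (HN N (leqnn _)); apply: le_trans (ler_norm _); rewrite lerD2l lerN2.
rewrite fine_le ?fin //.
apply: ge0_subset_integral => //; first exact: measurable_funS mfa.
  by move=> x _; rewrite lee_fin /=; exact: normr_ge0.
by move=> x; rewrite /F /= !in_itv /= -!ler_norml => /le_trans; apply.
Qed.

(** The horizontal edges need not become small at every height, but their sizes are dominated by an
    integrable function of the height. If the vertical integrals differed by L, the edges at heights
    y and -y would together carry at least |L| / 2 for all large y, contradicting integrability.
    Asking for edge bounds from [Y] on leaves room for a singularity at a lower height. *)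
Lemma strip_shift (G : R[i] -> R[i]) (a b Y : R) (P : RR -> \bar R) : a <= b ->
  (forall y, Y <= y -> rect_defect G a (- y) (b - a) (y + y) = 0) ->
  mu.-integrable setT (EFin \o (fun y => complex.Re (G (a +i* y)))) ->
  mu.-integrable setT (EFin \o (fun y => complex.Re (G (b +i* y)))) ->
  (forall y, Y <= `|y| -> cont_Im G y a b) ->
  measurable_fun setT P -> (forall p, 0 <= P p)%E -> (\int[mu \x mu]_p P p < +oo)%E ->
  (forall x y, a <= x <= b -> Y <= `|y| -> (`|complex.Im (G (x +i* y))|%:E <= P (x, y))%E) ->
  (\int[mu]_y (complex.Re (G (a +i* y)))%:E = \int[mu]_y (complex.Re (G (b +i* y)))%:E)%E.
Proof.
move=> ab GD Ia Ib cI mP P0 Pfin GP.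
pose f y := complex.Re (G (b +i* y)) - complex.Re (G (a +i* y)).
have If : mu.-integrable setT (EFin \o f) by apply: (integrableB _ Ib Ia).
pose L := Rintegral mu setT f.
have LE : L = \int[mu]_y (complex.Re (G (b +i* y))) - \int[mu]_y (complex.Re (G (a +i* y))).
  by rewrite /L RintegralB.
suff L0 : L = 0.
  have : \int[mu]_y (complex.Re (G (a +i* y))) = \int[mu]_y (complex.Re (G (b +i* y))).
    by apply/eqP; rewrite eq_sym -subr_eq0 -LE L0.
  move=> H; have := congr1 EFin H.
  by rewrite /Rintegral !fineK //; exact: integrable_fin_num.
apply/eqP/negPn/negP => L0.
pose K := `|L| / 2; have K0 : 0 < K by rewrite divr_gt0 // normr_gt0.
have [N HN] := integrable_tail If K0.
pose M := Num.max N (Num.max Y 0).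
pose Psi y := (\int[mu]_x P (x, y))%E.
have mPsi : measurable_fun setT Psi by exact: (measurable_fun_fubini_tonelli_G P).
have Psi0 y : (0 <= Psi y)%E by apply: integral_ge0.
have Psifin : (\int[mu]_y Psi y < +oo)%E by rewrite -(fubini_tonelli2 P).
have B y : Y <= `|y| -> (`|\int[mu]_(x in `[a, b]) complex.Im (G (x +i* y))|%:E <= Psi y)%E.
  move=> Yy; have I1 := cont_in_integrable (cI _ Yy).
  have mI : measurable (`[a, b]%classic : set (measurableTypeR R)) by exact: measurable_itv.
  have mPy : measurable_fun setT (fun x : measurableTypeR R => P (x, y)).
    by apply: measurableT_comp => //; exact: measurable_pair2.
  have mI1 : measurable_fun `[a, b] (fun x => (complex.Im (G (x +i* y)))%:E) by case/integrableP: I1.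
  rewrite EFin_normr_Rintegral //.
  apply: (le_trans (le_abse_integral mu mI mI1)).
  apply: (@le_trans _ _ (\int[mu]_(x in `[a, b]) P (x, y))%E).
    apply: ge0_le_integral => //=.
    - exact: (measurableT_comp (@abse_measurable R setT) mI1).
    - exact: measurable_funS mPy.
    - by move=> x; rewrite in_itv /= => xab; exact: GP.
  by apply: ge0_subset_integral.
(* Between the heights -y and y the vertical edges already differ by more than |L| / 2, and the
   vanishing defect passes this on to the horizontal edges. *)
have K1 y : M <= y -> (K%:E <= Psi y + Psi (- y)%R)%E.
  rewrite /M !ge_max => /and3P[Ny Yy y0].
  have Yay : Y <= `|y| by rewrite ger0_norm.
  have YaNy : Y <= `|- y| by rewrite normrN.
  apply: le_trans (leeD (B _ Yay) (B _ YaNy)).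
  rewrite -EFinD lee_fin; apply: le_trans (ler_normB _ _).
  have Iab z : Y <= `|z| -> mu.-integrable `[a, b] (EFin \o (fun x => complex.Im (G (x +i* z)))).
    by move=> /cI /cont_in_integrable.
  rewrite -RintegralB ?Iab //.
  have := GD _ Yy; rewrite /rect_defect.
  have -> : a + (b - a) = b by ring.
  have -> : - y + (y + y) = y by ring.
  move=> /eqP; rewrite subr_eq0 => /eqP <-.
  have := HN _ Ny; rewrite -/L -/(Rintegral mu `[(- y), y]%classic f) /K.
  set D := Rintegral _ _ _.
  have := ler_normD (L - D) D; rewrite subrK; lra.
have : (\int[mu]_(y in `[M, +oo[) K%:E <= \int[mu]_(y in `[M, +oo[) (Psi y + Psi (- y)%R))%E.
  apply: ge0_le_integral => //=.
  - by move=> *; rewrite lee_fin ltW.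
  - apply: emeasurable_funD; first exact: measurable_funS mPsi.
    apply: (@measurable_funS _ _ _ _ setT) => //; apply: measurableT_comp => //; exact: oppr_measurable.
  - by move=> y; rewrite in_itv /= andbT; exact: K1.
rewrite integral_cst //= lebesgue_measure_itv /= ltry addye // gt0_muley ?lte_fin //.
have mPsiN : measurable_fun setT (fun y : measurableTypeR R => Psi (- y)%R).
  by apply: measurableT_comp => //; exact: oppr_measurable.
have : (\int[mu]_(y in `[M, +oo[) (Psi y + Psi (- y)%R) <= \int[mu]_y (Psi y + Psi (- y)%R))%E.
  apply: ge0_subset_integral => //; first exact: emeasurable_funD.
  by move=> *; exact: adde_ge0.
have E := ge0_integral_opp mPsi Psi0.
move=> H1 H2; have := le_trans H2 H1.
rewrite (ge0_integralD mu measurableT (fun x _ => Psi0 x) mPsi (fun x _ => Psi0 (- x)) mPsiN).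
rewrite leye_eq => /eqP E2.
have : (\int[mu]_y Psi y + \int[mu]_y Psi (- y)%R < +oo)%E.
  by apply: (lte_add_pinfty Psifin); rewrite -E.
by rewrite E2 ltxx.
Qed.

End StripShift.

(** * The Cauchy density *)

Section CauchyKernel.
Context {R : realType}.
Local Notation mu := (@lebesgue_measure R).

Lemma cauchyE (d t y : R) : 0 < d ->
  (d ^+ 2 + (y - t) ^+ 2)^-1 = d ^- 2 * (oneDsqr (d^-1 * y + - (t / d)))^-1.
Proof.
move=> d0; have d1 : d != 0 by rewrite lt0r_neq0.
rewrite -invfM /oneDsqr; congr (_^-1); by field.
Qed.

Lemma measurable_cauchy (d t : R) : 0 < d ->
  measurable_fun setT (fun y : measurableTypeR R => (d ^+ 2 + (y - t) ^+ 2)^-1).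
Proof.
move=> d0; under eq_fun do rewrite cauchyE //.
apply: measurable_funM => //.
apply: (@measurableT_comp _ _ _ _ _ _ (fun x : measurableTypeR R => (oneDsqr x)^-1)).
  by apply: continuous_measurable_fun; exact: continuous_oneDsqrV.
by apply: measurable_funD => //; exact: measurable_funM.
Qed.

Lemma integral_oneDsqr : (\int[mu]_x ((oneDsqr x)^-1)%:E = pi%:E)%E.
Proof.
rewrite (@ge0_symfun_integralT _ (fun x => (oneDsqr x)^-1)).
- rewrite -set_itvcy.
  by rewrite integral0y_oneDsqr -EFinM; congr EFin; field.
- by move=> x; rewrite invr_ge0 addr_ge0 // sqr_ge0.
- exact: continuous_oneDsqrV.
- by move=> x; rewrite /= /oneDsqr sqrrN.
Qed.

Lemma integral_cauchy (d t : R) : 0 < d ->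
  (\int[mu]_y ((d ^+ 2 + (y - t) ^+ 2)^-1)%:E = (pi / d)%:E)%E.
Proof.
move=> d0; have d1 : d != 0 by rewrite lt0r_neq0.
rewrite (@ge0_integral_affine _ d t) //; last 2 first.
- by apply/measurable_EFinP; exact: measurable_cauchy.
- by move=> x; rewrite lee_fin invr_ge0 addr_ge0 // sqr_ge0.
transitivity (d%:E * \int[mu]_x ((d ^- 2)%:E * ((oneDsqr x)^-1)%:E))%E.
  congr (_ * _)%E; apply: eq_integral => x _; rewrite -EFinM; congr EFin.
  by rewrite cauchyE //; congr (_ * (oneDsqr _)^-1); field.
have mO : measurable_fun setT (fun x : measurableTypeR R => (oneDsqr x)^-1).
  by apply: continuous_measurable_fun; exact: continuous_oneDsqrV.
rewrite (ge0_integralZl mu measurableT (f := fun x : measurableTypeR R => ((oneDsqr x)^-1)%:E)).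
- by rewrite integral_oneDsqr -!EFinM; congr EFin; field.
- exact/measurable_EFinP.
- by move=> x _; rewrite lee_fin invr_ge0 addr_ge0 // sqr_ge0.
- by rewrite lee_fin invr_ge0; exact: sqr_ge0.
Qed.

End CauchyKernel.

(** * Square integrability on lines and strips *)

Section VerticalLines.
Context {R : realType}.
Local Notation mu := (@lebesgue_measure R).
Local Notation RR := (measurableTypeR R * measurableTypeR R)%type.
Implicit Types (h k : R[i] -> R[i]).

Definition line_sqnorm h (x : R) := (\int[mu]_y (normc (h (x +i* y)) ^+ 2)%:E)%E.

Definition holo_at h (w : R[i]) := exists d, cdiff h w d.

Lemma holo_atM h k w : holo_at h w -> holo_at k w -> holo_at (fun v => h v * k v) w.
Proof. by move=> [d1 H1] [d2 H2]; eexists; exact: cdiffM H1 H2. Qed.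

Lemma measurable_line_Re h x : (forall y, holo_at h (x +i* y)) ->
  measurable_fun setT (fun y : measurableTypeR R => complex.Re (h (x +i* y))).
Proof. by move=> H; apply: continuous_measurable_fun => y; have [d /cdiff_cont_lines[]] := H y. Qed.

Lemma measurable_line_Im h x : (forall y, holo_at h (x +i* y)) ->
  measurable_fun setT (fun y : measurableTypeR R => complex.Im (h (x +i* y))).
Proof. by move=> H; apply: continuous_measurable_fun => y; have [d /cdiff_cont_lines[]] := H y. Qed.

Lemma measurable_line_sqr h x : (forall y, holo_at h (x +i* y)) ->
  measurable_fun setT (fun y : measurableTypeR R => normc (h (x +i* y)) ^+ 2).
Proof.
move=> H; under eq_fun do rewrite sqr_normcE.
by apply: measurable_funD; apply: measurable_funX;
  [exact: measurable_line_Re|exact: measurable_line_Im].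
Qed.

Lemma measurable_plane_sqr h (D : set RR) : measurable D ->
  (forall p, D p -> holo_at h (p.1 +i* p.2)) ->
  measurable_fun D (fun p => normc (h (p.1 +i* p.2)) ^+ 2).
Proof.
move=> mD H; have [m1 m2] := cdiff_measurable mD H.
under eq_fun do rewrite sqr_normcE.
by apply: measurable_funD; apply: measurable_funX.
Qed.

(** A crude form of AM-GM that stands in for the Cauchy-Schwarz inequality in the integrability
    arguments. *)
Lemma Re_mul_le (u v : R[i]) : `|complex.Re (u * v)| <= normc u ^+ 2 + normc v ^+ 2.
Proof.
apply: (le_trans (ler_Re_normc _)); rewrite normcM.
have := sqr_ge0 (normc u - normc v); have := normc_ge0 u; have := normc_ge0 v; nra.
Qed.

Lemma Im_mul_le (u v : R[i]) : `|complex.Im (u * v)| <= normc u ^+ 2 + normc v ^+ 2.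
Proof.
apply: (le_trans (ler_Im_normc _)); rewrite normcM.
have := sqr_ge0 (normc u - normc v); have := normc_ge0 u; have := normc_ge0 v; nra.
Qed.

Lemma integrable_lineM h k x : (forall y, holo_at h (x +i* y)) ->
  (forall y, holo_at k (x +i* y)) ->
  (line_sqnorm h x < +oo)%E -> (line_sqnorm k x < +oo)%E ->
  mu.-integrable setT (EFin \o (fun y => complex.Re (h (x +i* y) * k (x +i* y)))).
Proof.
move=> Hh Hk fh fk.
have mh := measurable_line_sqr Hh; have mk := measurable_line_sqr Hk.
have m : measurable_fun setT (fun y : measurableTypeR R => complex.Re (h (x +i* y) * k (x +i* y))).
  apply: (@measurable_line_Re (fun w => h w * k w)) => y.
  exact: holo_atM.
apply/integrableP; split; first exact/measurable_EFinP.
apply: (@le_lt_trans _ _ (line_sqnorm h x + line_sqnorm k x)%E); last exact: lte_add_pinfty.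
rewrite /line_sqnorm -ge0_integralD //; last 4 first.
- by move=> y _; rewrite lee_fin sqr_ge0.
- exact/measurable_EFinP.
- by move=> y _; rewrite lee_fin sqr_ge0.
- exact/measurable_EFinP.
apply: ge0_le_integral => //.
- by apply: measurableT_comp => //; exact/measurable_EFinP.
- by apply: emeasurable_funD; exact/measurable_EFinP.
- by move=> y _; rewrite /= -EFinD lee_fin; exact: Re_mul_le.
Qed.

Definition in_strip (a b : R) : set RR := `[a, b]%classic `*` setT.

Lemma measurable_in_strip a b : measurable (in_strip a b).
Proof. by apply: measurableX => //; exact: measurable_itv. Qed.

Definition strip_sqnorm h a b :=
  (\int[mu \x mu]_(p in in_strip a b) (normc (h (p.1 +i* p.2)) ^+ 2)%:E)%E.

(** Conditions on two functions under which the integral of their product can be moved across the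
    strip: finite energy on both edges and on the strip itself. *)
Definition L2strip h a b := [/\ forall x y, a <= x <= b -> holo_at h (x +i* y),
  (line_sqnorm h a < +oo)%E, (line_sqnorm h b < +oo)%E & (strip_sqnorm h a b < +oo)%E].

(** On the strip |h|^2 + |k|^2 dominates the product, and it is integrable there; this is the bound
    that [strip_shift] asks for. *)
Lemma strip_shiftM h k a b : a <= b -> L2strip h a b -> L2strip k a b ->
  (\int[mu]_y (complex.Re (h (a +i* y) * k (a +i* y)))%:E =
   \int[mu]_y (complex.Re (h (b +i* y) * k (b +i* y)))%:E)%E.
Proof.
move=> ab [Hh ha hb hs] [Hk ka kb ks].
have aab : a <= a <= b by rewrite lexx ab.
have bab : a <= b <= b by rewrite lexx ab.
have HG x y : a <= x <= b -> holo_at (fun w => h w * k w) (x +i* y).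
  by move=> xab; apply: holo_atM; [exact: Hh|exact: Hk].
pose S (j : R[i] -> R[i]) : RR -> \bar R :=
  (fun p : RR => (normc (j (p.1 +i* p.2)) ^+ 2)%:E) \_ (in_strip a b).
have mS := measurable_in_strip a b.
have mP j : (forall x y, a <= x <= b -> holo_at j (x +i* y)) ->
    measurable_fun setT (S j).
  move=> Hj; apply/(measurable_restrictT _ mS)/measurable_EFinP.
  by apply: measurable_plane_sqr => // -[x y] [/=]; rewrite in_itv /= => xab _; exact: Hj.
have P0 j p : (0 <= S j p)%E.
  by apply: erestrict_ge0 => q _; rewrite lee_fin sqr_ge0.
apply: (@strip_shift _ (fun w => h w * k w) a b 0 (fun p => S h p + S k p)%E) => //.
- move=> y y0; apply: goursat_rect; [lra|lra|] => u v /andP[u1 u2] _.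
  by apply: HG; rewrite u1 /=; lra.
- by apply: integrable_lineM => // y; [exact: Hh|exact: Hk].
- by apply: integrable_lineM => // y; [exact: Hh|exact: Hk].
- by move=> y _ x xab; have [d /cdiff_cont_lines[]] := HG _ y xab.
- by apply: emeasurable_funD; exact: mP.
- by move=> p; apply: adde_ge0; exact: P0.
- rewrite ge0_integralD //; [|exact: mP|exact: mP].
  by apply: lte_add_pinfty; rewrite -integral_mkcond.
- move=> x y xab _; rewrite /S !patchE mem_set /=; last by split; rewrite //= in_itv.
  by rewrite -EFinD lee_fin; exact: Im_mul_le.
Qed.

End VerticalLines.

(** * Bergman functions on vertical lines *)

Section BergmanLines.
Context {R : realType}.
Local Notation mu := (@lebesgue_measure R).
Local Notation RR := (measurableTypeR R * measurableTypeR R)%type.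
Local Notation D := (@Cplus_xy R).
Implicit Types (h k : R[i] -> R[i]).

Lemma Cplus_xyE : D = `]0, +oo[%classic `*` setT.
Proof.
apply/seteqP; split => -[x y]; rewrite /Cplus_xy /Cplus /= in_itv /= andbT //.
by case.
Qed.

Lemma measurable_Cplus_xy : measurable D.
Proof. by rewrite Cplus_xyE; apply: measurableX => //; exact: measurable_itv. Qed.

Lemma analytic_holo h : analytic_Cplus h <-> forall w, Cplus w -> holo_at h w.
Proof. by split=> H w /H /cdiff_ex. Qed.

Lemma integral_Cplus_xy (F : RR -> \bar R) : measurable_fun D F ->
  (forall p, D p -> 0 <= F p)%E ->
  (\int[mu \x mu]_(p in D) F p = \int[mu]_(x in `]0%R, +oo[) \int[mu]_y F (x, y))%E.
Proof.
move=> mF F0; rewrite integral_mkcond fubini_tonelli1; last 2 first.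
- exact/(measurable_restrictT _ measurable_Cplus_xy).
- by move=> p; apply: erestrict_ge0.
rewrite [RHS]integral_mkcond; apply: eq_integral => x _; rewrite patchE.
rewrite /fubini_F; case: ifPn => [|].
  rewrite inE /= in_itv /= andbT => x0; apply: eq_integral => y _.
  by rewrite patchE mem_set.
rewrite notin_setE /= in_itv /= andbT => x0.
rewrite -[RHS](@integral0 _ _ _ mu setT); apply: eq_integral => y _.
by rewrite patchE memNset.
Qed.

Lemma measurable_inner_integral (F : RR -> \bar R) : measurable_fun D F ->
  (forall p, D p -> 0 <= F p)%E ->
  measurable_fun (`]0%R, +oo[%classic : set (measurableTypeR R)) (fun x : measurableTypeR R => \int[mu]_y F (x, y))%E.
Proof.
move=> mF F0.
have mP : measurable_fun setT (F \_ D) by exact/(measurable_restrictT _ measurable_Cplus_xy).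
have P0 p : (0 <= (F \_ D) p)%E by apply: erestrict_ge0.
have mG := measurable_fun_fubini_tonelli_F (m2 := mu) (F \_ D) mP P0.
have : measurable_fun (`]0%R, +oo[%classic : set (measurableTypeR R)) (fubini_F mu (F \_ D)).
  exact: measurable_funS mG.
apply: eq_measurable_fun => x; rewrite inE /= in_itv /= andbT => x0.
by apply: eq_integral => y _; rewrite patchE mem_set.
Qed.

Lemma holo_plane h : analytic_Cplus h -> forall p, D p -> holo_at h (p.1 +i* p.2).
Proof. by move=> /analytic_holo H p /H. Qed.

Lemma measurable_weight l h : analytic_Cplus h ->
  measurable_fun D (fun p : RR => (p.1 ^+ l * normc (h (p.1 +i* p.2)) ^+ 2)%:E).
Proof.
move=> /holo_plane H; apply/measurable_EFinP/measurable_funM.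
  by apply: measurable_funX; exact: measurable_funS measurable_fst.
exact: measurable_plane_sqr measurable_Cplus_xy H.
Qed.

Lemma weight_ge0 l h (p : RR) : D p -> (0 <= (p.1 ^+ l * normc (h (p.1 +i* p.2)) ^+ 2)%:E)%E.
Proof.
by rewrite /Cplus_xy /Cplus /= => p0; rewrite lee_fin mulr_ge0 ?sqr_ge0 // exprn_ge0 // ltW.
Qed.

(** The squared Bergman norm without the factor 1 / pi, kept as an extended real so that it makes
    sense outside the space. *)
Definition weighted_sqint l h :=
  (\int[mu \x mu]_(p in D) (p.1 ^+ l * normc (h (p.1 +i* p.2)) ^+ 2)%:E)%E.

Lemma weighted_sqint_ge0 l h : (0 <= weighted_sqint l h)%E.
Proof. by apply: integral_ge0 => p; exact: weight_ge0. Qed.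

Lemma bergmanE l h : bergman l h <-> analytic_Cplus h /\ (weighted_sqint l h < +oo)%E.
Proof.
rewrite /bergman /= /bergman_sqnorm -/(weighted_sqint l h).
have p0 : 0 < pi^-1 :> R by rewrite invr_gt0 pi_gt0.
have := weighted_sqint_ge0 l h.
case: (weighted_sqint l h) => [r||] //; first by rewrite -EFinM !ltry.
by rewrite gt0_muley ?lte_fin.
Qed.

Lemma line_sqnorm_ge0 h x : (0 <= line_sqnorm h x)%E.
Proof. by apply: integral_ge0 => y _; rewrite lee_fin sqr_ge0. Qed.

Lemma measurable_line_sqnorm h : analytic_Cplus h ->
  measurable_fun (`]0%R, +oo[%classic : set (measurableTypeR R)) (line_sqnorm h).
Proof.
move=> ah; apply: (measurable_inner_integral (F := fun p : RR => (normc (h (p.1 +i* p.2)) ^+ 2)%:E)).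
  by apply/measurable_EFinP; apply: measurable_plane_sqr measurable_Cplus_xy _; exact: holo_plane.
by move=> p _; rewrite lee_fin sqr_ge0.
Qed.

Lemma analytic_line h x : analytic_Cplus h -> 0 < x -> forall y, holo_at h (x +i* y).
Proof. by move=> /analytic_holo H x0 y; exact: H. Qed.

Lemma weighted_sqint_lines l h : analytic_Cplus h ->
  (weighted_sqint l h = \int[mu]_(x in `]0%R, +oo[) ((x ^+ l)%:E * line_sqnorm h x))%E.
Proof.
move=> ah; rewrite /weighted_sqint integral_Cplus_xy; last 2 first.
- exact: measurable_weight.
- by move=> p; exact: weight_ge0.
apply: eq_integral => x; rewrite inE /= in_itv /= andbT => x0.
rewrite /line_sqnorm -ge0_integralZl //=.
- by apply/measurable_EFinP; apply: measurable_line_sqr; exact: analytic_line.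
- by move=> y _; rewrite lee_fin sqr_ge0.
- by rewrite lee_fin exprn_ge0 // ltW.
Qed.

Lemma measurable_weighted_lines l h : analytic_Cplus h ->
  measurable_fun (`]0%R, +oo[%classic : set (measurableTypeR R))
    (fun x : measurableTypeR R => ((x ^+ l)%:E * line_sqnorm h x)%E).
Proof.
move=> ah; apply: emeasurable_funM; last exact: measurable_line_sqnorm.
by apply/measurable_EFinP; apply: measurable_funX; exact: measurable_id.
Qed.

Lemma good_lines_ae l h : bergman l h ->
  {ae mu, forall x : measurableTypeR R, 0 < x -> (line_sqnorm h x < +oo)%E}.
Proof.
move=> /bergmanE[ah]; rewrite weighted_sqint_lines // => fin.
have I : mu.-integrable (`]0%R, +oo[%classic : set (measurableTypeR R))
    (fun x : measurableTypeR R => ((x ^+ l)%:E * line_sqnorm h x)%E).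
  apply/integrableP; split; first exact: measurable_weighted_lines.
  apply: le_lt_trans fin; apply: ge0_le_integral => //.
  - by apply: measurableT_comp => //; exact: measurable_weighted_lines.
  - exact: measurable_weighted_lines.
  - move=> x; rewrite /= in_itv /= andbT => x0; rewrite gee0_abs //.
    by rewrite mule_ge0 ?line_sqnorm_ge0 // lee_fin exprn_ge0 // ltW.
have mI : measurable (`]0%R, +oo[%classic : set (measurableTypeR R)) by exact: measurable_itv.
have := integrable_ae mI I.
apply: filterS => x H x0; have := H ltac:(by rewrite /= in_itv /= x0).
have := line_sqnorm_ge0 h x.
case: (line_sqnorm h x) => [r||] //; rewrite ?ltry // => _.
by rewrite gt0_muley // lte_fin exprn_gt0.
Qed.

(** The lines of infinite energy form a null set, which cannot contain the interval ]0, c[. *)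
Lemma good_line_exists l h c : bergman l h -> 0 < c ->
  exists s, [/\ 0 < s, s < c & (line_sqnorm h s < +oo)%E].
Proof.
move=> /good_lines_ae [N [mN N0 HN]] c0; apply: contrapT => H.
have : (mu `]0%R, c[%classic <= mu N)%E.
  have mI : measurable (`]0%R, c[%classic : set (measurableTypeR R)) by exact: measurable_itv.
  apply: le_measure; rewrite ?inE //.
  move=> x; rewrite /= in_itv /= => /andP[x0 xc]; apply: HN => /= Hx; apply: H.
  by exists x; split => //; exact: Hx.
by rewrite N0 lebesgue_measure_itv /= lte_fin c0 oppr0 adde0 lee_fin leNgt c0.
Qed.

(** Beyond x = 1 the weight x^l is at least 1, so energies bounded below by [e] would make the norm
    infinite. This replaces decay of [h] at infinity. *)
Lemma small_line_exists l h (M e : R) : bergman l h -> 0 < e ->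
  exists2 s, M < s & (line_sqnorm h s < e%:E)%E.
Proof.
move=> /bergmanE[ah]; rewrite weighted_sqint_lines // => fin e0.
apply: contrapT => H.
pose m := Num.max M 1.
have m1 : 1 <= m by rewrite /m le_max lexx orbT.
have mM : M <= m by rewrite /m le_max lexx.
have sub : `]m, +oo[%classic `<=` `]0, +oo[%classic.
  by move=> x /=; rewrite !in_itv /= !andbT; apply: lt_trans; lra.
have : (\int[mu]_(x in `]m, +oo[) e%:E <= \int[mu]_(x in `]m, +oo[) ((x ^+ l)%:E * line_sqnorm h x))%E.
  apply: ge0_le_integral => //=.
  - by move=> *; rewrite lee_fin ltW.
  - by apply: measurable_funS (measurable_weighted_lines l ah).
  - move=> x; rewrite in_itv /= andbT => mx.
    have ex : (e%:E <= line_sqnorm h x)%E.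
      by rewrite leNgt; apply/negP => ?; apply: H; exists x => //; exact: le_lt_trans mM mx.
    apply: (le_trans ex); rewrite -[leLHS]mul1e; apply: lee_pmul => //.
    + exact: line_sqnorm_ge0.
    + by rewrite lee_fin; apply: exprn_ege1; apply: (le_trans m1); exact: ltW.
have : (\int[mu]_(x in `]m, +oo[) ((x ^+ l)%:E * line_sqnorm h x) <=
   \int[mu]_(x in `]0%R, +oo[) ((x ^+ l)%:E * line_sqnorm h x))%E.
  apply: ge0_subset_integral => //; first exact: measurable_weighted_lines.
  move=> x /=; rewrite in_itv /= andbT => x0.
  by rewrite mule_ge0 ?line_sqnorm_ge0 // lee_fin exprn_ge0 // ltW.
rewrite integral_cst //= lebesgue_measure_itv /= ltry addye // gt0_muley ?lte_fin //.
move=> H1 H2; have := le_trans H2 H1; rewrite leye_eq => /eqP E.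
by move: fin; rewrite E ltxx.
Qed.

(** Away from the imaginary axis the weight is bounded below, on this strip by a^l. *)
Lemma bergman_strip l h a b : bergman l h -> 0 < a -> (strip_sqnorm h a b < +oo)%E.
Proof.
move=> /bergmanE[ah fin] a0.
have sub : in_strip a b `<=` D.
  move=> [x y] [/=]; rewrite in_itv /= => /andP[ax _] _; rewrite /Cplus_xy /Cplus /=.
  exact: lt_le_trans ax.
have mS := measurable_in_strip a b.
have m1 : measurable_fun (in_strip a b) (fun p : RR => (normc (h (p.1 +i* p.2)) ^+ 2)%:E).
  apply/measurable_EFinP; apply: measurable_plane_sqr => // p /sub.
  exact: holo_plane.
have al0 : 0 < a ^+ l by rewrite exprn_gt0.
have : ((a ^+ l)%:E * strip_sqnorm h a b <= weighted_sqint l h)%E.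
  rewrite /strip_sqnorm -ge0_integralZl //; last 2 first.
  - by move=> p _; rewrite lee_fin sqr_ge0.
  - by rewrite lee_fin ltW.
  apply: (@le_trans _ _ (\int[mu \x mu]_(p in in_strip a b) (p.1 ^+ l * normc (h (p.1 +i* p.2)) ^+ 2)%:E)%E).
    apply: ge0_le_integral => //.
    - by move=> p _; rewrite -EFinM lee_fin mulr_ge0 ?sqr_ge0 // ltW.
    - by apply: emeasurable_funM.
    - by apply: measurable_funS (measurable_weight l ah) => //; exact: measurable_Cplus_xy.
    - move=> [x y] [/=]; rewrite in_itv /= => /andP[ax _] _.
      by rewrite -EFinM lee_fin ler_wpM2r ?sqr_ge0 // lerXn2r // nnegrE ltW // (lt_le_trans a0).
  apply: ge0_subset_integral => //; first exact: measurable_Cplus_xy.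
  - exact: measurable_weight.
  - by move=> p; exact: weight_ge0.
move=> /le_lt_trans /(_ fin).
have : (0 <= strip_sqnorm h a b)%E by apply: integral_ge0 => p _; rewrite lee_fin sqr_ge0.
case: (strip_sqnorm h a b) => [r||] //; rewrite ?ltry // => _.
by rewrite gt0_muley // lte_fin.
Qed.

Lemma bergman_L2strip l h a b : bergman l h -> 0 < a ->
  (line_sqnorm h a < +oo)%E -> (line_sqnorm h b < +oo)%E -> L2strip h a b.
Proof.
move=> bh a0 ha hb; split => //; last exact: bergman_strip bh a0.
move=> x y /andP[ax _]; apply: analytic_line (lt_le_trans a0 ax) y.
by case/bergmanE: bh.
Qed.

End BergmanLines.

(** * Measurability of complex-valued functions *)

Section ComplexMeasurable.
Context {R : realType} d (T : measurableType d).
Implicit Types (D : set T) (u v : T -> R[i]).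

Definition cmeas D u := measurable_fun D (fun p => complex.Re (u p)) /\
  measurable_fun D (fun p => complex.Im (u p)).

Lemma Re_mulc (a b : R[i]) : complex.Re (a * b) =
  complex.Re a * complex.Re b - complex.Im a * complex.Im b.
Proof. by case: a b => [? ?] [? ?]. Qed.

Lemma Im_mulc (a b : R[i]) : complex.Im (a * b) =
  complex.Re a * complex.Im b + complex.Im a * complex.Re b.
Proof. by case: a b => [? ?] [? ?]. Qed.

Lemma Re_addc (a b : R[i]) : complex.Re (a + b) = complex.Re a + complex.Re b.
Proof. by case: a b => [? ?] [? ?]. Qed.

Lemma Im_addc (a b : R[i]) : complex.Im (a + b) = complex.Im a + complex.Im b.
Proof. by case: a b => [? ?] [? ?]. Qed.

Lemma Re_oppc (a : R[i]) : complex.Re (- a) = - complex.Re a.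
Proof. by case: a. Qed.

Lemma Im_oppc (a : R[i]) : complex.Im (- a) = - complex.Im a.
Proof. by case: a. Qed.

Lemma Re_invc (a : R[i]) : complex.Re a^-1 = complex.Re a / normc a ^+ 2.
Proof. by rewrite sqr_normcE; case: a. Qed.

Lemma Im_invc (a : R[i]) : complex.Im a^-1 = - complex.Im a / normc a ^+ 2.
Proof. by rewrite sqr_normcE mulNr; case: a. Qed.

Lemma cmeasM D u v : cmeas D u -> cmeas D v -> cmeas D (fun p => u p * v p).
Proof.
move=> [u1 u2] [v1 v2]; split.
  under eq_fun do rewrite Re_mulc.
  by apply: measurable_funB; apply: measurable_funM.
under eq_fun do rewrite Im_mulc.
by apply: measurable_funD; apply: measurable_funM.
Qed.

Lemma cmeasD D u v : cmeas D u -> cmeas D v -> cmeas D (fun p => u p + v p).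
Proof.
move=> [u1 u2] [v1 v2]; split.
  by under eq_fun do rewrite Re_addc; exact: measurable_funD.
by under eq_fun do rewrite Im_addc; exact: measurable_funD.
Qed.

Lemma cmeas_cst D (c : R[i]) : cmeas D (fun=> c).
Proof. by split; exact: measurable_cst. Qed.

Lemma cmeas_ReIm D (f g : T -> R) : measurable_fun D f -> measurable_fun D g ->
  cmeas D (fun p => f p +i* g p).
Proof. by []. Qed.

Lemma cmeasX D u n : cmeas D u -> cmeas D (fun p => u p ^+ n).
Proof.
move=> mu; elim: n => [|n IH]; first exact: cmeas_cst.
by under eq_fun do rewrite exprS; exact: cmeasM.
Qed.

Lemma cmeas_sqr D u : cmeas D u -> measurable_fun D (fun p => normc (u p) ^+ 2).
Proof.
move=> [u1 u2]; under eq_fun do rewrite sqr_normcE.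
by apply: measurable_funD; apply: measurable_funX.
Qed.

Lemma cmeasV D u : cmeas D u -> cmeas D (fun p => (u p)^-1).
Proof.
move=> mu; have mV : measurable_fun D (fun p => (normc (u p) ^+ 2)^-1).
  under eq_fun do rewrite -powR_inv1 ?sqr_ge0 //.
  by apply: (measurableT_comp (measurable_powR _)); exact: cmeas_sqr.
case: mu => u1 u2; split.
  by under eq_fun do rewrite Re_invc; exact: measurable_funM.
by under eq_fun do rewrite Im_invc; apply: measurable_funM => //; exact: measurable_funN.
Qed.

Lemma cmeas_conj D u : cmeas D u -> cmeas D (fun p => (u p)^*).
Proof.
move=> [u1 u2]; split.
  by apply: eq_measurable_fun u1 => p _; case: (u p).
by apply: (@eq_measurable_fun _ _ _ _ _ (fun p => - complex.Im (u p))) => [p _|];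
  [case: (u p)|exact: measurable_funN].
Qed.

End ComplexMeasurable.

(** * The Cauchy formula and the reproducing kernel *)

Section HalfLineFTC.
Context {R : realType}.
Local Notation mu := (@lebesgue_measure R).

Implicit Types (x : R).

Lemma ge0_FTCy (f F : R -> R) (L : R) :
  (forall x, 0 <= x -> is_derive x 1 F (f x)) ->
  (forall x, 0 <= x -> {for x, continuous f}) ->
  (forall x, 0 <= x -> 0 <= f x) ->
  F x @[x --> +oo] --> L ->
  (\int[mu]_(x in `[0%R, +oo[) (f x)%:E = (L - F 0)%:E)%E.
Proof.
move=> dF cf f0 FL; rewrite (ge0_continuous_FTC2y f0 _ FL) //.
- apply: continuous_in_subspaceT => x; rewrite inE /= in_itv /= andbT; exact: cf.
- by move=> x /ltW /dF [].
- have [dF0 _] := dF 0 (lexx 0).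
  apply: cvg_at_right_filter.
  by apply: differentiable_continuous; exact/derivable1_diffP.
- move=> x; rewrite in_itv /= andbT => /ltW x0; rewrite derive1E.
  exact: (@derive_val _ _ _ _ _ _ _ (dF _ x0)).
Qed.

(** Both [f + g] and [g] are nonnegative, so the nonnegative version applies to each of them, and
    [f] is their difference. *)
Lemma dominated_FTCy (f F g G : R -> R) (L M : R) :
  (forall x, 0 <= x -> is_derive x 1 F (f x)) ->
  (forall x, 0 <= x -> {for x, continuous f}) ->
  (forall x, 0 <= x -> is_derive x 1 G (g x)) ->
  (forall x, 0 <= x -> {for x, continuous g}) ->
  (forall x, 0 <= x -> `|f x| <= g x) ->
  F x @[x --> +oo] --> L -> G x @[x --> +oo] --> M ->
  (\int[mu]_(x in `[0%R, +oo[) (f x)%:E = (L - F 0)%:E)%E.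
Proof.
move=> dF cf dG cg fg FL GM.
have g0 x : 0 <= x -> 0 <= g x by move=> /fg; exact: le_trans.
have Ig := ge0_FTCy dG cg g0 GM.
have Ifg : (\int[mu]_(x in `[0%R, +oo[) (f x + g x)%:E = ((L + M) - (F 0 + G 0))%:E)%E.
  apply: (@ge0_FTCy (fun x => f x + g x) (fun x => F x + G x)).
  - by move=> x x0; apply: is_deriveD; [exact: dF|exact: dG].
  - by move=> x x0; apply: cvgD; [exact: cf|exact: cg].
  - by move=> x /fg; rewrite ler_norml => /andP[]; lra.
  - exact: cvgD.
have mI : measurable (`[0%R, +oo[%classic : set (measurableTypeR R)) by exact: measurable_itv.
have mc (k : R -> R) : (forall x, 0 <= x -> {for x, continuous k}) ->
    measurable_fun (`[0%R, +oo[%classic : set (measurableTypeR R)) k.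
  move=> ck; apply: subspace_continuous_measurable_fun => //.
  by apply: continuous_in_subspaceT => x; rewrite inE /= in_itv /= andbT; exact: ck.
have i1 : mu.-integrable `[0%R, +oo[ (EFin \o g).
  apply/integrableP; split; first by apply/measurable_EFinP; exact: mc.
  have -> : (\int[mu]_(x in `[0%R, +oo[) `|(EFin \o g) x| = \int[mu]_(x in `[0%R, +oo[) (g x)%:E)%E.
    by apply: eq_integral => x; rewrite inE /= in_itv /= andbT => /g0 gx; rewrite ger0_norm.
  by rewrite Ig ltry.
have i2 : mu.-integrable `[0%R, +oo[ (EFin \o (fun x => f x + g x)).
  apply/integrableP; split.
    by apply/measurable_EFinP; apply: measurable_funD; exact: mc.
  have -> : (\int[mu]_(x in `[0%R, +oo[) `|(EFin \o (fun x => (f x + g x)%R)) x| =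
      \int[mu]_(x in `[0%R, +oo[) (f x + g x)%:E)%E.
    apply: eq_integral => x; rewrite inE /= in_itv /= andbT => /fg.
    by rewrite ler_norml => /andP[? ?]; rewrite ger0_norm //; lra.
  by rewrite Ifg ltry.
transitivity (\int[mu]_(x in `[0%R, +oo[) ((f x + g x)%:E - (g x)%:E))%E.
  by apply: eq_integral => x _; rewrite -EFinB addrK.
rewrite (integralB_EFin mI i2 i1) Ifg Ig -EFinB; congr EFin; ring.
Qed.

(** Restriction to the real axis: antiderivatives are found with complex calculus and then used in
    real integrals. *)
Lemma cdiff_is_derive (K : R[i] -> R[i]) (x : R) d : cdiff K x%:C d ->
  is_derive x 1 (fun t : R => complex.Re (K t%:C)) (complex.Re d).
Proof.
move=> Kd.
have H : (fun t : R => t^-1 *: (((fun t : R => complex.Re (K t%:C)) \o shift x) (t *: 1) - complex.Re (K x%:C))) @ 0^' --> complex.Re d.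
  apply/cvgrPdist_le => e e0; have [dl dl0 H] := Kd _ e0.
  exists dl => // t /=; rewrite sub0r normrN => tdl t0.
  have := H (t + x)%:C; rewrite -rmorphB addrK normc_real => /(_ tdl).
  rewrite /= /GRing.scale /= mulr1 => H2.
  have nt0 : 0 < `|t| by rewrite normr_gt0.
  rewrite -(ler_pM2r nt0) -normrM.
  apply: le_trans H2; rewrite -normcN; apply: le_trans (ler_Re_normc _).
  rewrite le_eqVlt; apply/orP; left; apply/eqP; congr (`|_|).
  rewrite Re_oppc !Re_addc !Re_oppc Re_mulc /= mulr0 subr0; field.
  exact: t0.
split; first by apply/cvg_ex; eexists; exact: H.
exact/cvg_lim.
Qed.

Lemma cdiff_real_continuous (K : R[i] -> R[i]) (x : R) d : cdiff K x%:C d ->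
  {for x, continuous (fun t : R => complex.Re (K t%:C))}.
Proof. by move=> /cdiff_cont_lines[]. Qed.

Lemma Re_realM (a : R) (u : R[i]) : complex.Re (a%:C * u) = a * complex.Re u.
Proof. by rewrite Re_mulc /= mul0r subr0. Qed.

Lemma cdiff_val (h : R[i] -> R[i]) w d d' : cdiff h w d -> d = d' -> cdiff h w d'.
Proof. by move=> + <-. Qed.

(** With [H = h w] and [zeta = z - w], integrating the kernel against the weight over all x turns it
    into the Cauchy kernel 1 / (z - w). The last two claims supply the absolute integrability that
    Fubini's theorem requires. *)
Lemma kernel_weight_integral (l : nat) (H zeta : R[i]) : 0 < complex.Re zeta ->
  [/\ (\int[mu]_(x in `[0%R, +oo[) (x ^+ l * complex.Re (H * (2 * x%:C + zeta) ^- l.+2))%:E =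
    (complex.Re (H / zeta) / (2 ^+ l.+1 * l.+1%:R))%:E)%E,
   (\int[mu]_(x in `[0%R, +oo[) (normc H * (2 / (2 * x + normc zeta) ^+ 2))%:E = (normc H / normc zeta)%:E)%E &
   forall x, 0 <= x -> `|x ^+ l * complex.Re (H * (2 * x%:C + zeta) ^- l.+2)| <= normc H * (2 / (2 * x + normc zeta) ^+ 2)].
Proof.
move=> z0.
have zn : zeta != 0 by apply/eqP => E; move: z0; rewrite E ltxx.
pose rho := normc zeta; have rho0 : 0 < rho by rewrite normc_gt0.
pose g x := normc H * (2 / (2 * x + rho) ^+ 2).
pose G x := - (normc H / (2 * x + rho)).
pose f x := x ^+ l * complex.Re (H * (2 * x%:C + zeta) ^- l.+2).
pose c := H / (l.+1%:R * zeta).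
(* w / (2 w + zeta) has derivative zeta / (2 w + zeta)^2, so this is an antiderivative of the
   integrand; it vanishes at 0. *)
pose K (w : R[i]) := c * (w * (2 * w + zeta)^-1) ^+ l.+1.
pose F x := complex.Re (K x%:C).
have l1 : l.+1%:R != 0 :> R[i] by rewrite pnatr_eq0.
have nz x : 0 <= x -> 2 * x%:C + zeta != 0.
  move=> x0; apply/eqP => /(congr1 (@complex.Re R)); case: (zeta) z0 => u v /=; lra.
have dW (x : R) : cdiff (fun w : R[i] => 2 * w + zeta) x%:C 2.
  have := cdiffD (cdiffM (cdiff_cst 2 x%:C) (cdiff_id x%:C)) (cdiff_cst zeta x%:C).
  by rewrite mul0r add0r mulr1 addr0.
have dV (x : R) : 0 <= x -> cdiff (fun w : R[i] => (2 * w + zeta)^-1) x%:C (- (2 * x%:C + zeta) ^- 2 * 2).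
  by move=> x0; exact: cdiff_inv (dW x) (nz _ x0).
have dK (x : R) : 0 <= x -> cdiff K x%:C (x%:C ^+ l * (H * (2 * x%:C + zeta) ^- l.+2)).
  move=> x0; apply: (cdiff_val (cdiffM (cdiff_cst c x%:C) (cdiffX l (cdiffM (cdiff_id x%:C) (dV _ x0))))).
  rewrite mul0r add0r /=.
  have := nz _ x0; rewrite /c; set W := 2 * x%:C + zeta => W0.
  have -> : 1 * W^-1 + x%:C * (- W ^- 2 * 2) = zeta * W ^- 2.
    have -> : zeta = W - 2 * x%:C by rewrite /W addrAC subrr add0r.
    by field.
  rewrite exprMn exprVn !exprS; field.
  by rewrite expf_neq0 // W0 zn /= nat1r.
have fE x : f x = complex.Re (x%:C ^+ l * (H * (2 * x%:C + zeta) ^- l.+2)).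
  by rewrite /f -(rmorphXn (real_complex R)) Re_realM.
have dF x : 0 <= x -> is_derive x 1 F (f x).
  by move=> x0; rewrite fE; exact/cdiff_is_derive/dK.
have cf x : 0 <= x -> {for x, continuous f}.
  (* [cdiffX] treats positive exponents, so the power 0 is handled apart. *)
  move=> x0; have [d cd] : exists d, cdiff (fun w : R[i] => w ^+ l.+1.-1 * (H * ((2 * w + zeta)^-1) ^+ l.+2)) x%:C d.
    case: (l) => [|m] /=.
      eexists; apply: (cdiffM (cdiff_cst 1 _)).
      exact: (cdiffM (cdiff_cst H x%:C) (cdiffX 1 (dV _ x0))).
    eexists; apply: (cdiffM (cdiffX m (cdiff_id _))).
    exact: (cdiffM (cdiff_cst H x%:C) (cdiffX m.+2 (dV _ x0))).
  have := cdiff_real_continuous cd.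
  rewrite (_ : (fun t : R => _) = f) //; apply/funext => t.
  by rewrite fE /= exprVn.
have fg x : 0 <= x -> `|f x| <= g x.
  move=> x0; rewrite fE; apply: (le_trans (ler_Re_normc _)).
  have P0 : 0 < 2 * x + rho by lra.
  set W := 2 * x%:C + zeta; have W0 : 0 < normc W by rewrite normc_gt0 nz.
  have ReW : complex.Re W = 2 * x + complex.Re zeta.
    by rewrite /W Re_addc -(rmorph_nat (real_complex R) 2) Re_realM.
  have ImW : complex.Im W = complex.Im zeta.
    by rewrite /W Im_addc -(rmorph_nat (real_complex R) 2) -rmorphM /= add0r.
  rewrite !(normcM, normcX, normcV) normc_real ger0_norm // mulrCA.
  apply: ler_wpM2l; first exact: normc_ge0.
  (* As Re zeta > 0, |2x + zeta|^2 is at least 4 x^2 + rho^2, and twice this dominates (2x +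
     rho)^2. *)
  have W2 : (2 * x + rho) ^+ 2 / 2 <= normc W ^+ 2.
    rewrite sqr_normcE ReW ImW; have := sqr_normcE zeta; rewrite -/rho.
    have := sqr_ge0 (2 * x - rho); have := mulr_ge0 x0 (ltW z0); lra.
  have Wx : x <= normc W.
    apply: le_trans (ler_Re_normc W); apply: le_trans (ler_norm _).
    by rewrite ReW; lra.
  rewrite exprSr exprSr -mulrA invfM mulrA.
  apply: (@le_trans _ _ (1 * (normc W * normc W)^-1)).
    apply: ler_wpM2r; first by rewrite invr_ge0 mulr_ge0 // ltW.
    by rewrite ler_pdivrMr ?exprn_gt0 // mul1r lerXn2r // nnegrE ltW.
  rewrite mul1r -expr2 -[X in _ <= X]invrK lef_pV2 ?posrE ?invr_gt0 ?divr_gt0 ?exprn_gt0 //.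
  by rewrite invf_div.
have dG x : 0 <= x -> is_derive x 1 G (g x).
  move=> x0; have P0 : 2 * x + rho != 0 by rewrite lt0r_neq0 //; lra.
  pose KG (w : R[i]) := (- normc H)%:C * (2 * w + rho%:C)^-1.
  have dWr : cdiff (fun w : R[i] => 2 * w + rho%:C) x%:C 2.
    have := cdiffD (cdiffM (cdiff_cst 2 x%:C) (cdiff_id x%:C)) (cdiff_cst rho%:C x%:C).
    by rewrite mul0r add0r mulr1 addr0.
  have E2 (t : R) : 2 * t%:C + rho%:C = (2 * t + rho)%:C by rewrite rmorphD rmorphM rmorph_nat.
  have n0 : 2 * x%:C + rho%:C != 0 by rewrite E2 eq_complex /= eqxx andbT.
  have := cdiff_is_derive (cdiffM (cdiff_cst (- normc H)%:C x%:C) (cdiff_inv dWr n0)).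
  rewrite (_ : (fun t : R => _) = G); last first.
    by apply/funext => t; rewrite E2 -fmorphV -rmorphM /= /G mulNr.
  rewrite (_ : complex.Re _ = g x) //.
  rewrite mul0r add0r E2 -rmorphXn -fmorphV -rmorphN -(rmorph_nat (real_complex R) 2) -!rmorphM /= /g.
  by field.
have cg x : 0 <= x -> {for x, continuous g}.
  move=> x0; apply: cvgM; first exact: cvg_cst.
  apply: cvgM; first exact: cvg_cst.
  apply: cvgV; first by rewrite expf_neq0 // lt0r_neq0 //; lra.
  apply: (@continuous_comp _ _ _ (fun x => 2 * x + rho) (fun y => y ^+ 2)).
    by apply: cvgD; [apply: cvgM; [exact: cvg_cst|exact: cvg_id]|exact: cvg_cst].
  exact: exprn_continuous.
have GM : G x @[x --> +oo] --> (0 : R).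
  apply/cvgrPdist_le => e e0; near=> x.
  have x0 : 0 < x by near: x; apply: nbhs_pinfty_gt; exact: num_real.
  have xe : normc H / e < x by near: x; apply: nbhs_pinfty_gt; exact: num_real.
  rewrite sub0r normrN /G normrN ger0_norm; last by rewrite divr_ge0 ?normc_ge0 //; lra.
  rewrite ler_pdivrMr; last lra.
  by move: xe; rewrite ltr_pdivrMr //; nra.
have FL : F x @[x --> +oo] --> complex.Re (H / zeta) / (2 ^+ l.+1 * l.+1%:R).
  (* [K] in the coordinate v = 1 / w, so that the limit at infinity becomes continuity at 0. *)
  pose Q (v : R[i]) := c * ((2 + zeta * v)^-1) ^+ l.+1.
  have dQ : exists d, cdiff Q 0 d.
    have dW0 := cdiffD (cdiff_cst 2 0) (cdiffM (cdiff_cst zeta 0) (cdiff_id 0)).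
    have n0 : 2 + zeta * id 0 != 0 :> R[i] by rewrite mulr0 addr0 pnatr_eq0.
    eexists; apply: cdiffM (cdiff_cst c 0) (cdiffX l (cdiff_inv dW0 n0)).
  have [d /cdiff_cont cQ] := dQ.
  have Q0 : complex.Re (Q 0) = complex.Re (H / zeta) / (2 ^+ l.+1 * l.+1%:R).
    rewrite /Q mulr0 addr0 /c.
    have -> : H / (l.+1%:R * zeta) * 2^-1 ^+ l.+1 = (H / zeta) * ((2 ^+ l.+1 * l.+1%:R)^-1)%:C.
      rewrite fmorphV rmorphM rmorphXn !rmorph_nat exprVn.
      by field; rewrite zn nat1r l1 expf_neq0 ?pnatr_eq0.
    by rewrite Re_mulc /= mulr0 subr0.
  rewrite -Q0; apply/cvgrPdist_le => e /cQ[dl dl0 HQ]; near=> x.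
  have x0 : 0 < x by near: x; apply: nbhs_pinfty_gt; exact: num_real.
  have xd : dl^-1 < x by near: x; apply: nbhs_pinfty_gt; exact: num_real.
  have -> : F x = complex.Re (Q x^-1%:C).
    rewrite /F /K /Q; congr (complex.Re (_ * _ ^+ _)); rewrite fmorphV.
    have xn : x%:C != 0 by rewrite eq_complex /= eqxx andbT lt0r_neq0.
    have := nz _ (ltW x0) => W0.
    by field; apply/andP; split; [exact: xn|exact: W0].
  rewrite -Re_oppc -Re_addc; apply: (le_trans (ler_Re_normc _)).
  rewrite normc_distC; apply: HQ; rewrite subr0 normc_real ger0_norm ?invr_ge0 ?ltW //.
  by rewrite invf_plt // posrE.
split => //.
- rewrite (dominated_FTCy dF cf dG cg fg FL GM); congr EFin.
  by rewrite /F /K mul0r expr0n /= mulr0 subr0.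
- have g0 x : 0 <= x -> 0 <= g x by move=> /fg; exact: le_trans.
  by rewrite (ge0_FTCy dG cg g0 GM) /G mulr0 !add0r opprK.
Unshelve. all: by end_near. Qed.

End HalfLineFTC.

(** * Square integrability by comparison with the Cauchy density *)

Section CauchyLine.
Context {R : realType}.
Local Notation mu := (@lebesgue_measure R).
Local Notation RR := (measurableTypeR R * measurableTypeR R)%type.
Implicit Types (h k : R[i] -> R[i]) (a b s t C delta : R).

Lemma line_sqnorm_le h s C delta t : 0 < delta -> (forall y, holo_at h (s +i* y)) ->
  (forall y, normc (h (s +i* y)) ^+ 2 <= C * (delta ^+ 2 + (y - t) ^+ 2)^-1) ->
  (line_sqnorm h s <= (C * (pi / delta))%:E)%E.
Proof.
move=> d0 Hh B.
have q0 y : 0 < delta ^+ 2 + (y - t) ^+ 2 by rewrite ltr_pwDl ?exprn_gt0 ?sqr_ge0.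
have C0 : 0 <= C.
  by have := le_trans (sqr_ge0 _) (B 0); rewrite pmulr_lge0 // invr_gt0.
rewrite EFinM -(integral_cauchy t d0) -ge0_integralZl ?lee_fin //; last 2 first.
- by apply/measurable_EFinP; exact: measurable_cauchy.
- by move=> y _; rewrite lee_fin invr_ge0 ltW.
apply: ge0_le_integral => //.
- by move=> y _; rewrite lee_fin sqr_ge0.
- by apply/measurable_EFinP; exact: measurable_line_sqr.
- by apply/measurable_EFinP; apply: measurable_funM => //; exact: measurable_cauchy.
- by move=> y _; rewrite -EFinM lee_fin; exact: B.
Qed.

Lemma strip_cauchy_lty a b C delta t : 0 < delta -> 0 <= C ->
  (\int[mu \x mu]_(p in in_strip a b) (C * (delta ^+ 2 + (p.2 - t) ^+ 2)^-1)%:E < +oo)%E.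
Proof.
move=> d0 C0.
have q0 y : 0 < delta ^+ 2 + (y - t) ^+ 2 by rewrite ltr_pwDl ?exprn_gt0 ?sqr_ge0.
have m1 : measurable_fun setT (fun p : RR => (C * (delta ^+ 2 + (p.2 - t) ^+ 2)^-1)%:E).
  apply/measurable_EFinP; apply: measurable_funM => //.
  by apply: (measurableT_comp (measurable_cauchy t d0)); exact: measurable_snd.
rewrite integral_mkcond fubini_tonelli1; last 2 first.
- apply/(measurable_restrictT _ (measurable_in_strip a b)); exact: measurable_funS m1.
- by move=> p; apply: erestrict_ge0 => q _; rewrite lee_fin mulr_ge0 // invr_ge0 ltW.
rewrite /fubini_F.
have -> : (\int[mu]_x \int[mu]_y ((fun p : RR => (C * (delta ^+ 2 + (p.2 - t) ^+ 2)^-1)%:E) \_ (in_strip a b)) (x, y) =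
   \int[mu]_(x in `[a, b]) (C * (pi / delta))%:E)%E.
  rewrite [RHS]integral_mkcond; apply: eq_integral => x _; rewrite patchE.
  case: ifPn => xab.
    rewrite EFinM -(integral_cauchy t d0) -ge0_integralZl ?lee_fin //; last 2 first.
    - by apply/measurable_EFinP; exact: measurable_cauchy.
    - by move=> y _; rewrite lee_fin invr_ge0 ltW.
    apply: eq_integral => y _; rewrite patchE mem_set //.
    by split => //=; move: xab; rewrite inE.
  rewrite -[RHS](@integral0 _ _ _ mu setT); apply: eq_integral => y _.
  rewrite patchE memNset // => -[/=] xab' _; move: xab; rewrite notin_setE; exact.
rewrite integral_cst /=; last exact: measurable_itv.
rewrite lebesgue_measure_itv /=.
by case: ifP => _; rewrite ?mule0 ?ltry // -EFinB -EFinM ltry.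
Qed.

Lemma strip_sqnorm_lty h a b C delta t : 0 < delta ->
  (forall x y, a <= x <= b -> holo_at h (x +i* y)) -> 0 <= C ->
  (forall x y, a <= x <= b -> normc (h (x +i* y)) ^+ 2 <= C * (delta ^+ 2 + (y - t) ^+ 2)^-1) ->
  (strip_sqnorm h a b < +oo)%E.
Proof.
move=> d0 Hh C0 B.
have mS := measurable_in_strip a b.
apply: le_lt_trans (strip_cauchy_lty a b t d0 C0); apply: ge0_le_integral => //.
- by move=> p _; rewrite lee_fin sqr_ge0.
- apply/measurable_EFinP; apply: measurable_plane_sqr => // -[x y] [/=].
  by rewrite in_itv /= => xab _; exact: Hh.
- apply/measurable_EFinP; apply: measurable_funM => //.
  apply: (measurable_funS measurableT (subsetT _)).
  by apply: (measurableT_comp (measurable_cauchy t d0)); exact: measurable_snd.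
- by move=> [x y] [/=]; rewrite in_itv /= => xab _; rewrite lee_fin; exact: B.
Qed.

Lemma L2strip_bound h a b C delta t : a <= b -> 0 < delta -> 0 <= C ->
  (forall x y, a <= x <= b -> holo_at h (x +i* y)) ->
  (forall x y, a <= x <= b -> normc (h (x +i* y)) ^+ 2 <= C * (delta ^+ 2 + (y - t) ^+ 2)^-1) ->
  L2strip h a b.
Proof.
move=> ab d0 C0 Hh B.
have aab : a <= a <= b by rewrite lexx ab.
have bab : a <= b <= b by rewrite lexx ab.
split => //; last exact: strip_sqnorm_lty B.
  by apply: le_lt_trans (ltry _); apply: (line_sqnorm_le (t := t) d0) => y; [exact: Hh|exact: B].
by apply: le_lt_trans (ltry _); apply: (line_sqnorm_le (t := t) d0) => y; [exact: Hh|exact: B].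
Qed.

Lemma sqr_normcB_le (u v : R[i]) : normc (u - v) ^+ 2 <= 2 * normc u ^+ 2 + 2 * normc v ^+ 2.
Proof.
have := le_normcD u (- v); rewrite normcN => H.
apply: (@le_trans _ _ ((normc u + normc v) ^+ 2)).
  by rewrite lerXn2r // nnegrE ?addr_ge0 ?normc_ge0.
have := sqr_ge0 (normc u - normc v); lra.
Qed.

Lemma holo_atB h k w : holo_at h w -> holo_at k w -> holo_at (fun v => h v - k v) w.
Proof.
move=> [d1 H1] [d2 H2]; exists (d1 + (0 * k w + (-1) * d2)).
have := cdiffD H1 (cdiffM (cdiff_cst (-1) w) H2).
by apply: (cdiff_eq (r := 1)) => // v _; rewrite mulN1r.
Qed.

Lemma line_sqnormB h k s : (forall y, holo_at h (s +i* y)) ->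
  (forall y, holo_at k (s +i* y)) ->
  (line_sqnorm (fun w => (h w - k w)%R) s <= 2%:E * line_sqnorm h s + 2%:E * line_sqnorm k s)%E.
Proof.
move=> Hh Hk.
have mh := measurable_line_sqr Hh; have mk := measurable_line_sqr Hk.
have mhk : measurable_fun setT (fun y : measurableTypeR R => normc (h (s +i* y) - k (s +i* y)) ^+ 2).
  by apply: (measurable_line_sqr (h := fun w => h w - k w)) => y; exact: holo_atB.
have n0 (j : R[i] -> R[i]) (y : measurableTypeR R) : (0 <= (normc (j (s +i* y)) ^+ 2)%:E)%E.
  by rewrite lee_fin sqr_ge0.
have n2 (j : R[i] -> R[i]) (y : measurableTypeR R) : (0 <= 2%:E * (normc (j (s +i* y)) ^+ 2)%:E)%E.
  by rewrite mule_ge0.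
rewrite /line_sqnorm -!ge0_integralZl //; [|exact/measurable_EFinP|exact/measurable_EFinP].
have mh2 : measurable_fun setT (fun y : measurableTypeR R => 2%:E * (normc (h (s +i* y)) ^+ 2)%:E)%E.
  by apply: emeasurable_funM => //; exact/measurable_EFinP.
have mk2 : measurable_fun setT (fun y : measurableTypeR R => 2%:E * (normc (k (s +i* y)) ^+ 2)%:E)%E.
  by apply: emeasurable_funM => //; exact/measurable_EFinP.
rewrite -ge0_integralD //.
apply: ge0_le_integral => //.
- by move=> y _; rewrite lee_fin sqr_ge0.
- exact/measurable_EFinP.
- exact: emeasurable_funD.
- by move=> y _; rewrite -!EFinM -EFinD lee_fin; exact: sqr_normcB_le.
Qed.

Lemma strip_sqnormB h k a b : (forall x y, a <= x <= b -> holo_at h (x +i* y)) ->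
  (forall x y, a <= x <= b -> holo_at k (x +i* y)) ->
  (strip_sqnorm h a b < +oo)%E -> (strip_sqnorm k a b < +oo)%E ->
  (strip_sqnorm (fun w => (h w - k w)%R) a b < +oo)%E.
Proof.
move=> Hh Hk fh fk.
have mS := measurable_in_strip a b.
have ms (j : R[i] -> R[i]) : (forall x y, a <= x <= b -> holo_at j (x +i* y)) ->
    measurable_fun (in_strip a b) (fun p : RR => (normc (j (p.1 +i* p.2)) ^+ 2)%:E).
  move=> Hj; apply/measurable_EFinP; apply: measurable_plane_sqr => // -[x y] [/=].
  by rewrite in_itv /= => xab _; exact: Hj.
have mh := ms _ Hh; have mk := ms _ Hk.
have mhk := ms _ (fun x y xab => holo_atB (Hh x y xab) (Hk x y xab)).
have n0 (j : R[i] -> R[i]) (p : RR) : (0 <= (normc (j (p.1 +i* p.2)) ^+ 2)%:E)%E.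
  by rewrite lee_fin sqr_ge0.
have n2 (j : R[i] -> R[i]) (p : RR) : (0 <= 2%:E * (normc (j (p.1 +i* p.2)) ^+ 2)%:E)%E.
  by rewrite mule_ge0.
apply: (@le_lt_trans _ _ (2%:E * strip_sqnorm h a b + 2%:E * strip_sqnorm k a b)%E); last first.
  by apply: lte_add_pinfty; apply: lte_mul_pinfty.
rewrite /strip_sqnorm -!ge0_integralZl //.
have mh2 : measurable_fun (in_strip a b) (fun p : RR => 2%:E * (normc (h (p.1 +i* p.2)) ^+ 2)%:E)%E.
  by apply: emeasurable_funM.
have mk2 : measurable_fun (in_strip a b) (fun p : RR => 2%:E * (normc (k (p.1 +i* p.2)) ^+ 2)%:E)%E.
  by apply: emeasurable_funM.
rewrite -ge0_integralD //.
apply: ge0_le_integral => //.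
- by move=> y _; rewrite lee_fin sqr_ge0.
- exact: emeasurable_funD.
- by move=> y _; rewrite -!EFinM -EFinD lee_fin; exact: sqr_normcB_le.
Qed.

(** One factor |v|^-2 is kept as a Cauchy density in Im v; each of the other [m] is bounded by
    delta^-2. *)
Lemma normc_invX_bound (v : R[i]) delta m : 0 < delta -> delta <= `|complex.Re v| ->
  normc (v ^- m.+1) ^+ 2 <= (delta ^+ 2) ^- m * (delta ^+ 2 + complex.Im v ^+ 2)^-1.
Proof.
move=> d0 dv.
have dv2 : delta ^+ 2 <= complex.Re v ^+ 2.
  by rewrite -[complex.Re v ^+ 2]real_normK ?num_real // lerXn2r // nnegrE ltW.
have q0 : 0 < delta ^+ 2 + complex.Im v ^+ 2 by rewrite ltr_pwDl ?exprn_gt0 ?sqr_ge0.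
have nv : delta ^+ 2 + complex.Im v ^+ 2 <= normc v ^+ 2 by rewrite sqr_normcE lerD2r.
have nv0 : 0 < normc v ^+ 2 := lt_le_trans q0 nv.
have -> : normc (v ^- m.+1) ^+ 2 = ((normc v ^+ 2) ^+ m.+1)^-1.
  by rewrite normcV normcX exprVn -!exprM mulnC.
have d2p : 0 < (delta ^+ 2) ^+ m by rewrite !exprn_gt0.
have nvp : 0 < (normc v ^+ 2) ^+ m.+1 by rewrite exprn_gt0.
rewrite -invfM lef_pV2 ?posrE ?mulr_gt0 //.
have d20 : 0 <= delta ^+ 2 by exact: sqr_ge0.
rewrite [X in _ <= X]exprSr; apply: ler_pM => //; [by rewrite exprn_ge0|exact: ltW|].
apply: lerXn2r; rewrite ?nnegrE //; first exact: ltW.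
by apply: le_trans nv; rewrite lerDl sqr_ge0.
Qed.

End CauchyLine.

(** * Cauchy's formula on a vertical line *)

Section CauchyFormula.
Context {R : realType}.
Local Notation mu := (@lebesgue_measure R).
Local Notation RR := (measurableTypeR R * measurableTypeR R)%type.
Implicit Types (h k : R[i] -> R[i]).

Lemma integrable_cauchy (d t : R) : 0 < d ->
  mu.-integrable setT (fun y : measurableTypeR R => ((d ^+ 2 + (y - t) ^+ 2)^-1)%:E).
Proof.
move=> d0; apply/integrableP; split.
  by apply/measurable_EFinP; exact: measurable_cauchy.
have -> : (\int[mu]_y `|((d ^+ 2 + (y - t) ^+ 2)^-1)%:E| = \int[mu]_y ((d ^+ 2 + (y - t) ^+ 2)^-1)%:E)%E.
  by apply: eq_integral => y _ /=; rewrite ger0_norm // invr_ge0 addr_ge0 // sqr_ge0.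
by rewrite integral_cauchy // ltry.
Qed.

Lemma holo_inv_sub (z w : R[i]) n : w != z -> holo_at (fun v => (z - v) ^- n.+1) w.
Proof.
move=> wz.
have D1 := cdiffD (cdiff_cst z w) (cdiffM (cdiff_cst (-1) w) (cdiff_id w)).
have n0 : z + -1 * id w != 0 by rewrite /= mulN1r subr_eq0 eq_sym.
exists (n.+1%:R * (z + -1 * id w)^-1 ^+ n * (- (z + -1 * id w) ^- 2 * (0 + (0 * id w + -1 * 1)))).
have := cdiffX n (cdiff_inv D1 n0).
by apply: (cdiff_eq (r := 1)) => // v _; rewrite mulN1r exprVn.
Qed.

Lemma holo_inv_add (z w : R[i]) n : w + z != 0 -> holo_at (fun v => (v + z) ^- n.+1) w.
Proof.
move=> n0; have D1 := cdiffD (cdiff_id w) (cdiff_cst z w).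
eexists; have := cdiffX n (cdiff_inv D1 n0).
by apply: (cdiff_eq (r := 1)) => // v _; rewrite exprVn.
Qed.

Lemma holo_at_cst (c w : R[i]) : holo_at (fun=> c) w.
Proof. by exists 0; exact: cdiff_cst. Qed.

Lemma abse_integral_Re_mul_le h k (s e : R) : (forall y, holo_at h (s +i* y)) ->
  (forall y, holo_at k (s +i* y)) ->
  (line_sqnorm h s + line_sqnorm k s <= e%:E)%E ->
  (`|\int[mu]_y (complex.Re (h (s +i* y) * k (s +i* y)))%:E| <= e%:E)%E.
Proof.
move=> Hh Hk; apply: le_trans.
have mh := measurable_line_sqr Hh; have mk := measurable_line_sqr Hk.
have m : measurable_fun setT (fun y : measurableTypeR R => (complex.Re (h (s +i* y) * k (s +i* y)))%:E).
  apply/measurable_EFinP; apply: (@measurable_line_Re _ (fun w => h w * k w)) => y.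
  exact: holo_atM.
apply: (le_trans (le_abse_integral mu measurableT m)).
have n0 (j : R[i] -> R[i]) (y : measurableTypeR R) : (0 <= (normc (j (s +i* y)) ^+ 2)%:E)%E.
  by rewrite lee_fin sqr_ge0.
rewrite /line_sqnorm -ge0_integralD //; [|exact/measurable_EFinP|exact/measurable_EFinP].
apply: ge0_le_integral => //.
- exact: (measurableT_comp (@abse_measurable R setT) m).
- by apply: emeasurable_funD; exact/measurable_EFinP.
- by move=> y _; rewrite /= -EFinD lee_fin; exact: Re_mul_le.
Qed.

(* 2 s0 - z^* is the reflection of z in the line Re w = s0; subtracting the pole
   there makes N vanish at z, so that the integrand has no pole on the right of
   the line, and it can be shifted to infinity. *)
Lemma integral_cauchy_defect l h (z : R[i]) (s0 : R) : bergman l h ->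
  0 < s0 -> s0 < complex.Re z -> (line_sqnorm h s0 < +oo)%E ->
  let N := fun w => h w - h z * (z - (2 * s0%:C - z^*)) * (w - (2 * s0%:C - z^*))^-1 in
  (line_sqnorm N s0 < +oo)%E /\
  (\int[mu]_y (complex.Re (N (s0 +i* y) * (z - (s0 +i* y))^-1))%:E = 0)%E.
Proof.
move=> bh s00 sz fs0 N.
have ah : analytic_Cplus h by case/bergmanE: bh.
set z' := 2 * s0%:C - z^* in N *; set c0 := h z * (z - z') in N *.
pose t := complex.Im z; pose d := complex.Re z - s0.
have d0 : 0 < d by rewrite subr_gt0.
have Rz' : complex.Re z' = s0 - d.
  rewrite /z' Re_addc Re_oppc -(rmorph_nat (real_complex R) 2) Re_realM /= /d.
  by case: (z) => u v /=; ring.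
have Iz' : complex.Im z' = t.
  rewrite /z' Im_addc Im_oppc -(rmorph_nat (real_complex R) 2) -rmorphM /= /t.
  by case: (z) => u v /=; ring.
pose k1 (w : R[i]) := c0 * (w - z')^-1.
have nz' x y : s0 <= x -> x +i* y + - z' != 0.
  move=> sx; apply/eqP => /(congr1 (@complex.Re R)); rewrite Re_addc Re_oppc Rz' /=; lra.
have Hk1 x y : s0 <= x -> holo_at k1 (x +i* y).
  by move=> sx; apply: holo_atM (holo_at_cst _ _) _; exact: (@holo_inv_add _ _ 0 (nz' _ _ sx)).
have B1 x y : s0 <= x -> normc (k1 (x +i* y)) ^+ 2 <= normc c0 ^+ 2 * ((x - complex.Re z') ^+ 2 + (y - t) ^+ 2)^-1.
  move=> sx; rewrite /k1 normcM exprMn; apply: ler_wpM2l; first exact: sqr_ge0.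
  rewrite normcV exprVn sqr_normcE Re_addc Im_addc Re_oppc Im_oppc Iz' /=.
  by [].
have Hh x y : s0 <= x -> holo_at h (x +i* y).
  by move=> sx; apply: analytic_line ah (lt_le_trans s00 sx) y.
have HN x y : s0 <= x -> holo_at N (x +i* y).
  by move=> sx; apply: holo_atB; [exact: Hh|exact: Hk1].
pose k2 (w : R[i]) := (z - w)^-1.
have Hk2 x y : x +i* y <> z -> holo_at k2 (x +i* y).
  by move=> /eqP xz; exact: (@holo_inv_sub _ _ 0 xz).
have B2 x y : normc (k2 (x +i* y)) ^+ 2 = ((x - complex.Re z) ^+ 2 + (y - t) ^+ 2)^-1.
  rewrite /k2 normcV exprVn sqr_normcE Re_addc Im_addc Re_oppc Im_oppc /= /t.
  by congr (_^-1); ring.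
have Hk2l x y : x != complex.Re z -> holo_at k2 (x +i* y).
  by move=> xz; apply: Hk2 => E; move: xz; rewrite -E eqxx.
have L1 x : s0 <= x -> (line_sqnorm k1 x <= (normc c0 ^+ 2 * (pi / (x - complex.Re z')))%:E)%E.
  move=> sx; apply: (line_sqnorm_le (t := t)) => //; first by rewrite Rz'; lra.
    by move=> y; exact: Hk1.
  by move=> y; exact: B1.
have LN x : s0 <= x -> (line_sqnorm N x <= 2%:E * line_sqnorm h x + 2%:E * line_sqnorm k1 x)%E.
  by move=> sx; apply: line_sqnormB => y; [exact: Hh|exact: Hk1].
have LNfin x : s0 <= x -> (line_sqnorm h x < +oo)%E -> (line_sqnorm N x < +oo)%E.
  move=> sx fx; apply: le_lt_trans (LN _ sx) _; apply: lte_add_pinfty; apply: lte_mul_pinfty => //.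
  by apply: le_lt_trans (L1 _ sx) (ltry _).
have L2 x : x != complex.Re z -> (line_sqnorm k2 x <= (pi / `|x - complex.Re z|)%:E)%E.
  move=> xz; rewrite -[pi / _]mul1r; apply: (line_sqnorm_le (t := t)).
  - by rewrite normr_gt0 subr_eq0.
  - by move=> y; exact: Hk2l.
  - by move=> y; rewrite B2 mul1r real_normK // num_real.
have s0z : s0 != complex.Re z by rewrite lt_eqF.
split; first exact: LNfin.
have shift s1 : complex.Re z < s1 -> (line_sqnorm h s1 < +oo)%E ->
  (\int[mu]_y (complex.Re (N (s0 +i* y) * k2 (s0 +i* y)))%:E =
   \int[mu]_y (complex.Re (N (s1 +i* y) * k2 (s1 +i* y)))%:E)%E.
  move=> zs1 fs1.
  have s01 : s0 <= s1 by lra.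
  have s1z : s1 != complex.Re z by rewrite gt_eqF.
  have mS := measurable_in_strip s0 s1.
  have mNS : measurable_fun (in_strip s0 s1) (fun p : RR => (normc (N (p.1 +i* p.2)) ^+ 2)%:E).
    apply/measurable_EFinP; apply: measurable_plane_sqr => // -[x y] [/=].
    by rewrite in_itv /= => /andP[sx _] _; exact: HN.
  have mcS : measurable_fun (in_strip s0 s1) (fun p : RR => (2 * (1 ^+ 2 + (p.2 - t) ^+ 2)^-1)%:E).
    apply/measurable_EFinP; apply: measurable_funM => //.
    apply: (measurable_funS measurableT (subsetT _)).
    by apply: (measurableT_comp (measurable_cauchy t (@ltr01 R))); exact: measurable_snd.
  have q0 y : 0 <= 2 * (1 ^+ 2 + (y - t) ^+ 2)^-1 :> R.
    by rewrite mulr_ge0 // invr_ge0 addr_ge0 // sqr_ge0.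
  (* At distance at least 1 from the height t one has |k2|^2 <= 1 / (y - t)^2 <= 2 / (1 + (y -
     t)^2), which is why [strip_shift] is applied from the height |t| + 1 on. *)
  pose P : RR -> \bar R := (fun p : RR => (normc (N (p.1 +i* p.2)) ^+ 2)%:E + (2 * (1 ^+ 2 + (p.2 - t) ^+ 2)^-1)%:E)%E \_ (in_strip s0 s1).
  (* The zero of [N] cancels the pole of [k2]: near [z] the product is bounded by 1 + |N'(z)|. *)
  have Np : N z = 0.
    rewrite /N /c0 -mulrA divff ?mulr1 ?subrr // subr_eq0; apply/eqP => E.
    by move: Rz'; rewrite -E /d; lra.
  have [dN hN] : holo_at N z by case: (z) sz HN => u v /= sz HN; apply: HN; lra.
  apply: (@strip_shift _ (fun w => N w * k2 w) s0 s1 (`|t| + 1) P) => //.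
  - move=> y yt.
    have ty : `|t| < y by lra.
    have [dl dl0 Hdl] := hN 1 ltr01.
    apply: (@goursat_rect_removable _ _ z _ _ _ _ (1 + normc dN) dl) => //.
    + by rewrite sz /=; lra.
    + by move: ty; rewrite -/t ltr_norml => /andP[? ?]; apply/andP; split; lra.
    + move=> u v /andP[u1 u2] _ uvz; apply: holo_atM; first exact: HN.
      exact: Hk2.
    + move=> w /eqP wz wd; have := Hdl _ wd; rewrite Np subr0 mul1r => H1.
      have wz0 : 0 < normc (w - z) by rewrite normc_gt0 subr_eq0.
      rewrite /k2 normcM normcV normc_distC normc_distC -ler_pdivlMr ?invr_gt0 //; last first.
        by rewrite normc_distC.
      rewrite invrK; have := le_normcD (N w - dN * (w - z)) (dN * (w - z)).
      rewrite subrK => /le_trans; apply; rewrite normcM mulrDl mul1r normc_distC.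
      by rewrite lerD2r.
  - apply: integrable_lineM; [by move=> y; exact: HN|by move=> y; exact: Hk2l|exact: LNfin|].
    by apply: le_lt_trans (L2 _ s0z) (ltry _).
  - apply: integrable_lineM; [by move=> y; exact: HN|by move=> y; exact: Hk2l|exact: LNfin|].
    by apply: le_lt_trans (L2 _ s1z) (ltry _).
  - move=> y yt x /andP[sx _].
    have [d3 cd3] : holo_at (fun w => N w * k2 w) (x +i* y).
      apply: holo_atM; first exact: HN.
      by apply: Hk2 => E; move: yt; rewrite /t -E /=; lra.
    by have [] := cdiff_cont_lines cd3.
  - by apply/(measurable_restrictT _ mS); apply: emeasurable_funD.
  - by move=> p; apply: erestrict_ge0 => q _; rewrite adde_ge0 ?lee_fin ?sqr_ge0.
  - rewrite /P -integral_mkcond ge0_integralD //; last 2 first.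
    + by move=> p _; rewrite lee_fin sqr_ge0.
    + by move=> p _; rewrite lee_fin.
    apply: lte_add_pinfty; last exact: strip_cauchy_lty.
    rewrite -/(strip_sqnorm N s0 s1); apply: (@strip_sqnormB _ h k1).
    + by move=> x y /andP[sx _]; exact: Hh.
    + by move=> x y /andP[sx _]; exact: Hk1.
    + exact: bergman_strip bh s00.
    + apply: (@strip_sqnorm_lty _ k1 s0 s1 (normc c0 ^+ 2) d t) => //; last first.
      * move=> x y /andP[sx _]; apply: (le_trans (B1 _ y sx)).
        apply: ler_wpM2l; first exact: sqr_ge0.
        rewrite lef_pV2 ?posrE ?ltr_pwDl ?exprn_gt0 ?sqr_ge0 //; last by rewrite Rz'; clear -d0 sx; lra.
        by rewrite lerD2r lerXn2r ?nnegrE ?Rz'; clear -d0 sx; lra.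
      * exact: sqr_ge0.
      * by move=> x y /andP[sx _]; exact: Hk1.
  - move=> x y sxs yt; rewrite /P patchE mem_set; last by split => //=; rewrite in_itv.
    rewrite -EFinD lee_fin; apply: (le_trans (Im_mul_le _ _)); rewrite lerD2l.
    rewrite B2 expr1n; set X := (x - _) ^+ 2; have X0 : 0 <= X by exact: sqr_ge0.
    have T1 : 1 <= (y - t) ^+ 2.
      have : 1 <= `|y - t| by have := ler_normD (y - t) t; rewrite subrK; clear -yt; lra.
      by move=> H; rewrite -[(y - t) ^+ 2]real_normK ?num_real //; apply: exprn_ege1.
    set Y2 := (y - t) ^+ 2 in T1 *.
    have p1 : 0 < X + Y2 by clear -X0 T1; lra.
    have p2 : 0 < 1 + Y2 by clear -T1; lra.
    by rewrite -(ler_pM2r p1) mulVf ?lt0r_neq0 // mulrAC ler_pdivlMr // mul1r; clear -X0 T1; lra.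
set I := integral _ _ _.
suff K e : 0 < e -> (`|I| <= e%:E)%E.
  have I1 := K _ (@ltr01 R); case: I K I1 => [r||] // K _; congr EFin.
  apply/eqP; rewrite -normr_eq0 eq_le normr_ge0 andbT; apply/ler_addgt0Pr => e e0.
  by have := K _ e0; rewrite /= lee_fin add0r.
move=> e0.
(* Collects the constants in the bounds [LN], [L1] and [L2]. At distance 2 B / e and beyond, the
   Cauchy terms add up to at most e / 2, and the term of [h] to at most e / 4. *)
pose B := 2 * (normc c0 ^+ 2 * pi) + pi : R.
have pi0 : 0 < pi :> R by exact: pi_gt0.
have c0p : 0 <= normc c0 ^+ 2 * pi by rewrite mulr_ge0 ?sqr_ge0 // ltW.
have Bp : 0 < B by rewrite /B; lra.
have [s1 Ms1 fs1] := small_line_exists (complex.Re z + 2 * B / e) bh (divr_gt0 e0 (ltr0n R 8)).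
have X0 : 0 < 2 * B / e by rewrite divr_gt0 // mulr_gt0.
have zs1 : complex.Re z < s1 by clear -X0 Ms1; lra.
have s1z : s1 != complex.Re z by rewrite gt_eqF.
have s01 : s0 <= s1 by clear -sz zs1; lra.
rewrite /I (shift s1 zs1 (lt_trans fs1 (ltry _))).
apply: abse_integral_Re_mul_le.
- by move=> y; exact: HN.
- by move=> y; exact: Hk2l.
have X1 : 2 * B / e <= s1 - complex.Re z by clear -Ms1; lra.
have X2 : 2 * B / e <= s1 - complex.Re z' by rewrite Rz'; clear -Ms1 d0 sz; lra.
have inv A : 0 <= A -> forall u, 2 * B / e <= u -> A / u <= A * (e / (2 * B)).
  move=> A0 u uu; apply: ler_wpM2l => //.
  have -> : e / (2 * B) = (2 * B / e)^-1 by rewrite invf_div.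
  by rewrite lef_pV2 // posrE; exact: lt_le_trans uu.
apply: le_trans (leeD (LN _ s01) (L2 _ s1z)) _.
apply: (@le_trans _ _ (2%:E * (e / 8)%:E + 2%:E * (normc c0 ^+ 2 * (pi / (s1 - complex.Re z')))%:E + (pi / `|s1 - complex.Re z|)%:E)%E).
  by apply: leeD => //; apply: leeD; apply: lee_pmul => //; [exact: line_sqnorm_ge0|exact: ltW|exact: line_sqnorm_ge0|exact: L1].
rewrite -!EFinM -!EFinD lee_fin gtr0_norm ?subr_gt0 //.
have i1 := inv _ c0p _ X2; have i2 := inv _ (ltW pi0) _ X1.
rewrite mulrA.
have E : 2 * (normc c0 ^+ 2 * pi * (e / (2 * B))) + pi * (e / (2 * B)) = e / 2.
  rewrite (_ : _ + _ = B * (e / (2 * B))); last by rewrite /B; ring.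
  by field; rewrite lt0r_neq0.
lra.
Qed.

(** On the line, the choice of the reflected pole makes the subtracted term times 1 / (z - w) equal
    to h(z) times the Poisson kernel 2 d / (d^2 + (y - t)^2), where d is the distance from [z] to
    the line. Its integral is 2 pi. *)
Lemma cauchy_line l h (z : R[i]) (s0 : R) : bergman l h ->
  0 < s0 -> s0 < complex.Re z -> (line_sqnorm h s0 < +oo)%E ->
  (\int[mu]_y (complex.Re (h (s0 +i* y) * (z - (s0 +i* y))^-1))%:E = (2 * pi * complex.Re (h z))%:E)%E.
Proof.
move=> bh s00 sz fs0; have [LN I0] := integral_cauchy_defect bh s00 sz fs0.
set N := fun w => _ in LN I0.
pose t := complex.Im z; pose d := complex.Re z - s0.
have d0 : 0 < d by rewrite subr_gt0.
have s0z : s0 != complex.Re z by rewrite lt_eqF.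
have Hk y : holo_at (fun w => (z - w)^-1) (s0 +i* y).
  by apply: (@holo_inv_sub _ _ 0); apply: contra s0z => /eqP <-.
have q0 y : 0 < d ^+ 2 + (y - t) ^+ 2 by rewrite ltr_pwDl ?exprn_gt0 ?sqr_ge0.
have E (y : R) : complex.Re (h (s0 +i* y) * (z - (s0 +i* y))^-1) =
   complex.Re (N (s0 +i* y) * (z - (s0 +i* y))^-1) +
   2 * d * complex.Re (h z) * (d ^+ 2 + (y - t) ^+ 2)^-1.
  have -> : h (s0 +i* y) = N (s0 +i* y) +
      h z * (z - (2 * s0%:C - z^*)) * (s0 +i* y - (2 * s0%:C - z^*))^-1 by rewrite /N subrK.
  rewrite mulrDl Re_addc; congr (_ + _).
  have -> : z - (2 * s0%:C - z^*) = (2 * d)%:C.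
    rewrite /d -(rmorph_nat (real_complex R) 2) -rmorphM; case: (z) => u v.
    by apply/eqP; rewrite eq_complex /=; apply/andP; split; apply/eqP; ring.
  have w1 : s0 +i* y - (2 * s0%:C - z^*) = d +i* (y - t).
    rewrite /d /t -(rmorph_nat (real_complex R) 2) -rmorphM; case: (z) => u v.
    by apply/eqP; rewrite eq_complex /=; apply/andP; split; apply/eqP; ring.
  have w2 : z - (s0 +i* y) = d -i* (y - t).
    rewrite /d /t; case: (z) => u v.
    by apply/eqP; rewrite eq_complex /=; apply/andP; split; apply/eqP; ring.
  rewrite w1 w2 -mulrA -invfM.
  have -> : d +i* (y - t) * (d -i* (y - t)) = (d ^+ 2 + (y - t) ^+ 2)%:C.
    by apply/eqP; rewrite eq_complex /=; apply/andP; split; apply/eqP; ring.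
  rewrite -fmorphV -mulrA -rmorphM mulrC Re_realM; ring.
have I1 : mu.-integrable setT (EFin \o (fun y => complex.Re (N (s0 +i* y) * (z - (s0 +i* y))^-1))).
  apply: (@integrable_lineM _ N (fun w => (z - w)^-1)) => //.
  - move=> y; apply: holo_atB; first by apply: analytic_line s00 y; case/bergmanE: bh.
    apply: holo_atM (holo_at_cst _ _) _; apply: (@holo_inv_add _ _ 0).
    apply/eqP => /(congr1 (@complex.Re R)); rewrite /d in d0.
    rewrite !Re_addc Re_oppc Re_addc Re_oppc -(rmorph_nat (real_complex R) 2) Re_realM /=.
    by case: (z) d0 => u v /=; lra.
  - apply: (le_lt_trans _ (ltry (1 * (pi / d)))); apply: (line_sqnorm_le (t := t)) => // y.
    rewrite mul1r normcV exprVn sqr_normcE Re_addc Im_addc Re_oppc Im_oppc /= -/d -/t.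
    by rewrite -(sqrrN (t - y)) opprB.
have I2 : mu.-integrable setT (EFin \o (fun y => 2 * d * complex.Re (h z) * (d ^+ 2 + (y - t) ^+ 2)^-1)).
  rewrite (_ : _ \o _ = (fun y => (2 * d * complex.Re (h z))%:E * ((d ^+ 2 + (y - t) ^+ 2)^-1)%:E)%E); last first.
    by apply/funext => y /=; rewrite EFinM.
  by apply: integrableZl => //; exact: integrable_cauchy.
under eq_integral do rewrite E EFinD.
rewrite (integralD measurableT I1 I2) I0 add0e.
transitivity ((2 * d * complex.Re (h z))%:E * \int[mu]_y ((d ^+ 2 + (y - t) ^+ 2)^-1)%:E)%E.
  by rewrite -integralZl //; exact: integrable_cauchy.
by rewrite integral_cauchy // -EFinM; congr EFin; field; rewrite lt0r_neq0.
Qed.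

End CauchyFormula.

(** * The reproducing kernel *)

Section Reproducing.
Context {R : realType}.
Local Notation mu := (@lebesgue_measure R).
Local Notation RR := (measurableTypeR R * measurableTypeR R)%type.
Local Notation D := (@Cplus_xy R).
Implicit Types (h k : R[i] -> R[i]).

Lemma integral_Cplus_xy_integrable (F : RR -> \bar R) : (mu \x mu)%E.-integrable D F ->
  [/\ (\int[mu \x mu]_(p in D) F p = \int[mu]_(x in `]0%R, +oo[) \int[mu]_y F (x, y))%E,
      (\int[mu \x mu]_(p in D) F p = \int[mu]_y \int[mu]_(x in `]0%R, +oo[) F (x, y))%E &
      measurable_fun (`]0%R, +oo[%classic : set (measurableTypeR R)) (fun x : measurableTypeR R => \int[mu]_y F (x, y))%E].
Proof.
move=> IF; have IP : (mu \x mu)%E.-integrable setT (F \_ D).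
  exact/(integrable_mkcond _ measurable_Cplus_xy).
have E1 (x : measurableTypeR R) : `]0%R, +oo[%classic x -> (\int[mu]_y (F \_ D) (x, y) = \int[mu]_y F (x, y))%E.
  rewrite /= in_itv /= andbT => x0; apply: eq_integral => y _.
  by rewrite patchE mem_set.
split.
- rewrite integral_mkcond -(integral12_prod_meas1 IP) /fubini_F [RHS]integral_mkcond.
  apply: eq_integral => x _; rewrite patchE; case: ifPn => [|].
    by rewrite inE => /E1.
  rewrite notin_setE /= in_itv /= andbT => x0.
  rewrite -[RHS](@integral0 _ _ _ mu setT); apply: eq_integral => y _.
  by rewrite patchE memNset.
- rewrite integral_mkcond -(integral21_prod_meas1 IP) /fubini_G.
  apply: eq_integral => y _; rewrite [RHS]integral_mkcond; apply: eq_integral => x _.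
  rewrite !patchE; case: ifPn => x0.
    by move: x0; rewrite inE /Cplus_xy /Cplus /= => x0; rewrite mem_set //= in_itv /= x0.
  by move: x0; rewrite notin_setE /Cplus_xy /Cplus /= => x0; rewrite memNset //= in_itv /= andbT.
- have m : measurable_fun (`]0%R, +oo[%classic : set (measurableTypeR R)) (fubini_F mu (F \_ D)).
    have mG := measurable_fubini_F IP; exact: measurable_funS mG.
  by apply: eq_measurable_fun m => x; rewrite inE => /E1.
Qed.

Lemma cmeasN d (T : measurableType d) (E : set T) (u : T -> R[i]) :
  cmeas E u -> cmeas E (fun p => - u p).
Proof.
move=> [u1 u2]; split.
  by under eq_fun do rewrite Re_oppc; exact: measurable_funN.
by under eq_fun do rewrite Im_oppc; exact: measurable_funN.
Qed.

Lemma cmeas_holo (E : set RR) h : measurable E ->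
  (forall p, E p -> holo_at h (p.1 +i* p.2)) -> cmeas E (fun p => h (p.1 +i* p.2)).
Proof. exact: cdiff_measurable. Qed.

Lemma measurable_wdot l h k : analytic_Cplus h -> analytic_Cplus k ->
  measurable_fun D (fun p : RR => p.1 ^+ l * complex.Re (h (p.1 +i* p.2) * (k (p.1 +i* p.2))^*)).
Proof.
move=> /holo_plane Hh /holo_plane Hk; have mD := @measurable_Cplus_xy R.
apply: measurable_funM.
  by apply: measurable_funX; apply: (measurable_funS measurableT (subsetT _)); exact: measurable_fst.
by have [] := cmeasM (cmeas_holo mD Hh) (cmeas_conj (cmeas_holo mD Hk)).
Qed.

Lemma integrable_wdot l h k : bergman l h -> bergman l k ->
  (mu \x mu)%E.-integrable D
    (fun p : RR => (p.1 ^+ l * complex.Re (h (p.1 +i* p.2) * (k (p.1 +i* p.2))^*))%:E).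
Proof.
move=> /bergmanE[ah fh] /bergmanE[ak fk]; have mD := @measurable_Cplus_xy R.
have m := measurable_wdot l ah ak.
have mh := measurable_weight l ah; have mk := measurable_weight l ak.
apply/integrableP; split; first exact/measurable_EFinP.
apply: (@le_lt_trans _ _ (weighted_sqint l h + weighted_sqint l k)%E); last exact: lte_add_pinfty.
rewrite /weighted_sqint -ge0_integralD //; last 2 first.
- by move=> p; exact: weight_ge0.
- by move=> p; exact: weight_ge0.
apply: ge0_le_integral => //.
- by apply: measurableT_comp => //; exact/measurable_EFinP.
- exact: emeasurable_funD.
- move=> p; rewrite /Cplus_xy /Cplus /= => p0.
  rewrite -EFinD lee_fin normrM (ger0_norm (exprn_ge0 _ (ltW p0))) -mulrDr.
  apply: ler_wpM2l; first by rewrite exprn_ge0 // ltW.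
  by apply: (le_trans (Re_mul_le _ _)); rewrite normc_conj.
Qed.

Definition ker (l : nat) (z w : R[i]) := (w + z^*) ^- l.+2.

(** On the line Re w = x the conjugate of w is 2x - w, so the conjugated kernel agrees there with a
    function holomorphic in w. Its pole 2x + z lies to the right of this line and of every line to
    the left of [z]. *)
Lemma ker_conj l (z : R[i]) (x y : R) :
  (ker l z (x +i* y))^* = ((2 * x%:C + z) - (x +i* y)) ^- l.+2.
Proof.
rewrite /ker fmorphV rmorphXn; congr ((_ ^+ _)^-1).
rewrite -(rmorph_nat (real_complex R) 2) -rmorphM; case: z => u v.
by apply/eqP; rewrite eq_complex /=; apply/andP; split; apply/eqP; ring.
Qed.

Lemma ker_analytic l (z : R[i]) : Cplus z -> analytic_Cplus (ker l z).
Proof.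
move=> z0; apply/analytic_holo => w w0; apply: holo_inv_add.
apply/eqP => /(congr1 (@complex.Re R)); rewrite Re_addc; move: z0 w0; rewrite /Cplus /=.
by case: (z) => u v /=; lra.
Qed.

Lemma kernel_L2strip (A : R[i]) m (a b : R) : a <= b -> b < complex.Re A ->
  L2strip (fun w => (A - w) ^- m.+1) a b.
Proof.
move=> ab bA; have d0 : 0 < complex.Re A - b by rewrite subr_gt0.
apply: (@L2strip_bound _ _ a b (((complex.Re A - b) ^+ 2) ^- m) (complex.Re A - b) (complex.Im A)) => //.
- by rewrite invr_ge0 exprn_ge0 // sqr_ge0.
- move=> x y /andP[_ xb]; apply: holo_inv_sub.
  by apply/eqP => E; move: bA; rewrite -E /=; lra.
- move=> x y /andP[_ xb].
  have := @normc_invX_bound _ (A - (x +i* y)) (complex.Re A - b) m d0.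
  rewrite Re_addc Im_addc Re_oppc Im_oppc /=.
  rewrite -(sqrrN (_ - y)) opprB; apply.
  by rewrite ger0_norm; lra.
Qed.

Lemma ker_bergman l (z : R[i]) : Cplus z -> bergman l (ker l z).
Proof.
move=> z0; apply/bergmanE; split; first exact: ker_analytic.
set a := complex.Re z; have a0 : 0 < a by [].
pose t := complex.Im z.
have mD := @measurable_Cplus_xy R.
have q0 x t' : 0 < a ^+ 2 + (x - t') ^+ 2 by rewrite ltr_pwDl ?exprn_gt0 ?sqr_ge0.
pose C := a ^- l.
have C0 : 0 <= C by rewrite invr_ge0 exprn_ge0 // ltW.
(* With v = w + conj z, both x^l and a^l are at most |v|^l, and |v|^2 is at least a^2 + x^2 and at
   least a^2 + (y - t)^2. Hence |v|^(2l+4) in the denominator leaves a product of two Cauchy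
   densities. *)
pose P (p : RR) : \bar R := ((a ^+ 2 + (p.1 - 0) ^+ 2)^-1%:E * (C * (a ^+ 2 + (p.2 - t) ^+ 2)^-1)%:E)%E.
have mP : measurable_fun setT P.
  apply: emeasurable_funM; apply/measurable_EFinP.
    by apply: (measurableT_comp (measurable_cauchy 0 a0)); exact: measurable_fst.
  apply: measurable_funM => //.
  by apply: (measurableT_comp (measurable_cauchy t a0)); exact: measurable_snd.
have P0 p : (0 <= P p)%E.
  by rewrite /P -EFinM lee_fin !mulr_ge0 // invr_ge0 ltW.
apply: (@le_lt_trans _ _ (\int[mu \x mu]_p P p)%E).
  apply: (@le_trans _ _ (\int[mu \x mu]_(p in D) P p)%E); last exact: ge0_subset_integral.
  apply: ge0_le_integral => //.
  - by move=> p; exact: weight_ge0.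
  - by apply: measurable_weight; exact: ker_analytic.
  - exact: measurable_funS mP.
  - move=> [x y]; rewrite /Cplus_xy /Cplus /= => x0.
    rewrite /P -EFinM lee_fin /=.
    set v := x +i* y + z^*.
    have Rv : complex.Re v = x + a by rewrite /v /a; case: (z).
    have Iv : complex.Im v = y - t by rewrite /v /t; case: (z) => u w /=; ring.
    have nv2 : normc v ^+ 2 = (x + a) ^+ 2 + (y - t) ^+ 2 by rewrite sqr_normcE Rv Iv.
    have xv : x + a <= normc v.
      by apply: le_trans (ler_Re_normc v); rewrite Rv ler_norm.
    have nv0 : 0 < normc v by apply: lt_le_trans xv; lra.
    rewrite /ker -/v normcV normcX exprVn.
    have -> : (normc v ^+ l.+2) ^+ 2 = normc v ^+ l * (normc v ^+ l * ((normc v ^+ 2) * (normc v ^+ 2))).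
      by rewrite -!exprD -exprM; congr (_ ^+ _); lia.
    have x1 : x ^+ l <= normc v ^+ l.
      by apply: lerXn2r; rewrite ?nnegrE; [exact: ltW|exact: normc_ge0|lra].
    have a1 : a ^+ l <= normc v ^+ l.
      by apply: lerXn2r; rewrite ?nnegrE; [exact: ltW|exact: normc_ge0|lra].
    have n1 : a ^+ 2 + (x - 0) ^+ 2 <= normc v ^+ 2.
      rewrite nv2 subr0; have := mulr_ge0 (ltW x0) (ltW a0); have := sqr_ge0 (y - t).
      by rewrite sqrrD mulr2n; lra.
    have n2 : a ^+ 2 + (y - t) ^+ 2 <= normc v ^+ 2.
      by rewrite nv2 lerD2r lerXn2r ?nnegrE; lra.
    have nl : 0 < normc v ^+ l by rewrite exprn_gt0.
    have nn : 0 < normc v ^+ 2 by rewrite exprn_gt0.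
    have al : 0 < a ^+ l by rewrite exprn_gt0.
    set A := normc v ^+ l in x1 a1 nl *; set Q := normc v ^+ 2 in n1 n2 nn *.
    rewrite (_ : x ^+ l * _ = (x ^+ l * A^-1) * (Q^-1 * (A^-1 * Q^-1))); last first.
      by rewrite !invfM; ring.
    rewrite -[leRHS]mul1r; apply: ler_pM.
    + by rewrite divr_ge0 ?exprn_ge0 // ltW.
    + by rewrite !mulr_ge0 // invr_ge0 ltW.
    + by rewrite ler_pdivrMr // mul1r.
    + apply: ler_pM; [by rewrite invr_ge0 ltW|by rewrite mulr_ge0 // invr_ge0 ltW|by rewrite lef_pV2 // posrE|].
      apply: ler_pM; try by rewrite invr_ge0 ltW.
      * by rewrite /C lef_pV2 // posrE.
      * by rewrite lef_pV2 // posrE.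
have b0 : (\int[mu]_y (C * (a ^+ 2 + (y - t) ^+ 2)^-1)%:E = (C * (pi / a))%:E)%E.
  under eq_integral do rewrite EFinM.
  rewrite ge0_integralZl //.
  - by rewrite integral_cauchy.
  - by apply/measurable_EFinP; exact: measurable_cauchy.
  - by move=> y _; rewrite lee_fin invr_ge0 ltW.
rewrite (fubini_tonelli1 P mP P0) /fubini_F.
have E (x : measurableTypeR R) : (\int[mu]_y P (x, y) = ((a ^+ 2 + (x - 0) ^+ 2)^-1)%:E * (C * (pi / a))%:E)%E.
  rewrite -b0 -ge0_integralZl //.
  - by apply/measurable_EFinP; apply: measurable_funM => //; exact: measurable_cauchy.
  - by move=> y _; rewrite lee_fin mulr_ge0 // invr_ge0 ltW.
  - by rewrite lee_fin invr_ge0 ltW.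
under eq_integral do rewrite E.
rewrite ge0_integralZr //.
- by rewrite integral_cauchy // -EFinM ltry.
- by apply/measurable_EFinP; exact: measurable_cauchy.
- by move=> y _; rewrite lee_fin invr_ge0 ltW.
- by rewrite lee_fin mulr_ge0 // divr_ge0 ?pi_ge0 // ltW.
Qed.

Lemma measurable_shifted l h (z : R[i]) (s0 : R) : (forall y, holo_at h (s0 +i* y)) ->
  measurable_fun setT (fun p : RR => p.1 ^+ l * complex.Re (h (s0 +i* p.2) * (2 * p.1%:C + (z - (s0 +i* p.2))) ^- l.+2)).
Proof.
move=> Hh; apply: measurable_funM; first by apply: measurable_funX; exact: measurable_fst.
have c1 : cmeas setT (fun p : RR => h (s0 +i* p.2)).
  by split; [exact: (measurableT_comp (measurable_line_Re Hh) measurable_snd)|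
    exact: (measurableT_comp (measurable_line_Im Hh) measurable_snd)].
have c2 : cmeas setT (fun p : RR => p.1%:C).
  by apply: (cmeas_ReIm (f := fst) (g := fun=> 0)); [exact: measurable_fst|exact: measurable_cst].
have c3 : cmeas setT (fun p : RR => s0 +i* p.2).
  by apply: (cmeas_ReIm (f := fun=> s0) (g := snd)); [exact: measurable_cst|exact: measurable_snd].
have c4 := cmeasV (cmeasX l.+2 (cmeasD (cmeasM (cmeas_cst _ 2) c2) (cmeasD (cmeas_cst _ z) (cmeasN c3)))).
by have [] := cmeasM c1 c4.
Qed.

(** By [kernel_weight_integral] the modulus integrates in x to at most |h| / |z - w|, and AM-GM
    dominates this by |h|^2 + |z - w|^-2, which is integrable along the line. *)
Lemma integrable_shifted l h (z : R[i]) (s0 : R) : (forall y, holo_at h (s0 +i* y)) ->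
  s0 < complex.Re z -> (line_sqnorm h s0 < +oo)%E ->
  (mu \x mu)%E.-integrable D (fun p : RR => (p.1 ^+ l * complex.Re (h (s0 +i* p.2) * (2 * p.1%:C + (z - (s0 +i* p.2))) ^- l.+2))%:E).
Proof.
move=> Hh sz fs0; have mF := measurable_shifted l z Hh.
pose F (p : RR) : \bar R := (p.1 ^+ l * complex.Re (h (s0 +i* p.2) * (2 * p.1%:C + (z - (s0 +i* p.2))) ^- l.+2))%:E.
have mD := @measurable_Cplus_xy R.
have mFD : measurable_fun D F by apply/measurable_EFinP; exact: measurable_funS mF.
have zp y : 0 < complex.Re (z - (s0 +i* y)) by rewrite Re_addc Re_oppc /= subr_gt0.
apply/(integrable_mkcond _ mD)/integrable21ltyP; first exact/(measurable_restrictT _ mD).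
pose k (w : R[i]) := (z - w)^-1.
have Hk y : holo_at k (s0 +i* y).
  by apply: (@holo_inv_sub _ _ _ 0); apply/eqP => E; move: sz; rewrite -E /= ltxx.
have fk : (line_sqnorm k s0 < +oo)%E.
  have d0 : 0 < complex.Re z - s0 by rewrite subr_gt0.
  apply: (le_lt_trans _ (ltry (1 * (pi / (complex.Re z - s0))))).
  apply: (line_sqnorm_le (t := complex.Im z)) => // y.
  rewrite mul1r normcV exprVn sqr_normcE Re_addc Im_addc Re_oppc Im_oppc /=.
  by rewrite -(sqrrN (complex.Im z - y)) opprB.
apply: (@le_lt_trans _ _ (line_sqnorm h s0 + line_sqnorm k s0)%E); last exact: lte_add_pinfty.
have n0 (j : R[i] -> R[i]) (y : measurableTypeR R) : (0 <= (normc (j (s0 +i* y)) ^+ 2)%:E)%E.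
  by rewrite lee_fin sqr_ge0.
have mh := measurable_line_sqr Hh; have mk := measurable_line_sqr Hk.
rewrite /line_sqnorm -ge0_integralD //; [|exact/measurable_EFinP|exact/measurable_EFinP].
have mA : measurable_fun setT (abse \o (F \_ D)).
  by apply: measurableT_comp => //; exact/(measurable_restrictT _ mD).
apply: ge0_le_integral => //.
- by move=> y _; exact: integral_ge0.
- exact: (measurable_fun_fubini_tonelli_G (m1 := mu) (abse \o (F \_ D)) mA (fun p => abse_ge0 _)).
- by apply: emeasurable_funD; exact/measurable_EFinP.
- move=> y _.
  have [K1 K2 K3] := kernel_weight_integral l (h (s0 +i* y)) (zp y).
  apply: (@le_trans _ _ (normc (h (s0 +i* y)) / normc (z - (s0 +i* y)))%:E); last first.
    rewrite -EFinD lee_fin /k normcV.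
    have := sqr_ge0 (normc (h (s0 +i* y)) - (normc (z - (s0 +i* y)))^-1).
    have := normc_ge0 (h (s0 +i* y)).
    have : 0 <= (normc (z - (s0 +i* y)))^-1 by rewrite invr_ge0 normc_ge0.
    by nra.
  rewrite -K2.
  have mFy : measurable_fun (`[0%R, +oo[%classic : set (measurableTypeR R)) (fun x : measurableTypeR R => `|F (x, y)|)%E.
    apply: (measurable_funS measurableT (subsetT _)).
    apply: (measurableT_comp (@abse_measurable R setT)).
    apply/measurable_EFinP; apply: (measurableT_comp mF); exact: measurable_pair2.
  apply: (@le_trans _ _ (\int[mu]_(x in `[0%R, +oo[) `|F (x, y)|)%E).
    rewrite [leRHS]integral_mkcond; apply: ge0_le_integral => //.
    - by apply: (measurableT_comp mA); exact: measurable_pair2.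
    - exact/(measurable_restrictT _ (measurable_itv _)).
    - move=> x _; rewrite !patchE; case: ifPn => x0.
        rewrite mem_set //; move: x0; rewrite inE /Cplus_xy /Cplus /= in_itv /= andbT.
        exact: ltW.
      by rewrite abse0; case: ifPn.
  apply: ge0_le_integral => //.
  - apply/measurable_EFinP; apply: measurable_funM => //.
    apply: (subspace_continuous_measurable_fun (measurable_itv _)).
    apply: continuous_in_subspaceT => x; rewrite inE /= in_itv /= andbT => x0.
    have P0 : 0 < 2 * x + normc (z - (s0 +i* y)).
      have : 0 < normc (z - (s0 +i* y)); last by lra.
      by rewrite normc_gt0; apply/eqP => E; have := zp y; rewrite E ltxx.
    set rho := normc _ in P0 *.
    have c1 : {for x, continuous (fun u : R => 2 * u + rho)}.
      by apply: cvgD; [apply: cvgM; [exact: cvg_cst|exact: cvg_id]|exact: cvg_cst].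
    have c2 : {for x, continuous (fun u : R => (2 * u + rho) ^+ 2)}.
      exact: (cvgM c1 c1).
    apply: (@cvgM _ _ _ _ (fun=> 2) (fun u : R => (2 * u + rho) ^- 2)); first exact: cvg_cst.
    by apply: cvgV => //; rewrite expf_neq0 // lt0r_neq0.
  - move=> x /=; rewrite in_itv /= andbT => x0; rewrite lee_fin; exact: K3.
Qed.

End Reproducing.

(** * The reproducing formula *)

Section ReproducingFormula.
Context {R : realType}.
Local Notation mu := (@lebesgue_measure R).
Local Notation RR := (measurableTypeR R * measurableTypeR R)%type.
Local Notation D := (@Cplus_xy R).
Implicit Types (h k : R[i] -> R[i]).

Lemma line_shift_kernel l h (A : R[i]) m (a b : R) : bergman l h -> 0 < a -> 0 < b ->
  a < complex.Re A -> b < complex.Re A ->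
  (line_sqnorm h a < +oo)%E -> (line_sqnorm h b < +oo)%E ->
  (\int[mu]_y (complex.Re (h (a +i* y) * (A - (a +i* y)) ^- m.+1))%:E =
   \int[mu]_y (complex.Re (h (b +i* y) * (A - (b +i* y)) ^- m.+1))%:E)%E.
Proof.
wlog ab : a b / a <= b.
  move=> W bh a0 b0 aA bA fa fb; have [|/ltW] := leP a b => ab.
    exact: W.
  by apply/esym; exact: W.
move=> bh a0 b0 aA bA fa fb.
apply: (@strip_shiftM _ h (fun w => (A - w) ^- m.+1)) => //.
  exact: bergman_L2strip bh a0 fa fb.
exact: kernel_L2strip.
Qed.

(** For almost every x the inner integral is moved from the line Re w = x to one fixed line Re w =
    s0 to the left of [z], while the kernel keeps its parameter x. Fubini's theorem then allows
    integrating in x first, which leaves Cauchy's formula on the fixed line. *)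
Lemma reproducing_Re l h (z : R[i]) : bergman l h -> Cplus z ->
  (\int[mu \x mu]_(p in D) (p.1 ^+ l * complex.Re (h (p.1 +i* p.2) * (ker l z (p.1 +i* p.2))^*))%:E =
   (pi * (2 / (2 ^+ l.+1 * l.+1%:R)) * complex.Re (h z))%:E)%E.
Proof.
move=> bh z0; have ah : analytic_Cplus h by case/bergmanE: bh.
have [s0 [s00 sz fs0]] := good_line_exists bh z0.
have [E1 _ m1] := integral_Cplus_xy_integrable (integrable_wdot bh (ker_bergman l z0)).
have Hs0 y : holo_at h (s0 +i* y) by exact: analytic_line.
have [E2 E3 m2] := integral_Cplus_xy_integrable (integrable_shifted l Hs0 sz fs0).
rewrite E1.
have mI : measurable (`]0%R, +oo[%classic : set (measurableTypeR R)) by exact: measurable_itv.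
have -> : (\int[mu]_(x in `]0%R, +oo[) \int[mu]_y (x ^+ l * complex.Re (h (x +i* y) * (ker l z (x +i* y))^*))%:E =
  \int[mu]_(x in `]0%R, +oo[) \int[mu]_y (x ^+ l * complex.Re (h (s0 +i* y) * (2 * x%:C + (z - (s0 +i* y))) ^- l.+2))%:E)%E.
  apply: ae_eq_integral => //.
  have := good_lines_ae bh; apply: filterS => x Hx; rewrite /= in_itv /= andbT => x0.
  have {Hx} fx := Hx x0.
  pose A := 2 * x%:C + z.
  have RA : complex.Re A = 2 * x + complex.Re z.
    by rewrite /A Re_addc -(rmorph_nat (real_complex R) 2) Re_realM.
  have xA : x < complex.Re A by rewrite RA; move: z0; rewrite /Cplus /=; lra.
  have sA : s0 < complex.Re A by rewrite RA; lra.
  have fk s : s < complex.Re A -> (line_sqnorm (fun w => ((A - w) ^- l.+2)%R) s < +oo)%E.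
    by move=> sA'; have [] := @kernel_L2strip R A l.+1 s s (lexx _) sA'.
  have Hk s y : s < complex.Re A -> holo_at (fun w => (A - w) ^- l.+2) (s +i* y).
    by move=> sA'; have [H _ _ _] := @kernel_L2strip R A l.+1 s s (lexx _) sA'; apply: H; rewrite lexx.
  have I s : 0 < s -> s < complex.Re A -> (line_sqnorm h s < +oo)%E ->
      mu.-integrable setT (EFin \o (fun y => complex.Re (h (s +i* y) * (A - (s +i* y)) ^- l.+2))).
    move=> sp sA' fs; apply: (@integrable_lineM _ h (fun w => (A - w) ^- l.+2)) => //.
    - by move=> y; exact: analytic_line.
    - by move=> y; exact: Hk.
    - exact: fk.
  transitivity ((x ^+ l)%:E * \int[mu]_y (complex.Re (h (x +i* y) * (A - (x +i* y)) ^- l.+2))%:E)%E.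
    rewrite -(integralZl measurableT (I _ x0 xA fx)); apply: eq_integral => y _.
    by rewrite ker_conj -/A EFinM.
  rewrite (line_shift_kernel (l := l) l.+1 bh x0 s00 xA sA fx fs0).
  rewrite -(integralZl measurableT (I _ s00 sA fs0)); apply: eq_integral => y _.
  by rewrite addrA -/A EFinM.
rewrite -E2 E3.
have zp y : 0 < complex.Re (z - (s0 +i* y)) by rewrite Re_addc Re_oppc /= subr_gt0.
have mF := measurable_shifted l z Hs0.
pose k (w : R[i]) := (z - w)^-1.
have Hk y : holo_at k (s0 +i* y).
  by apply: (@holo_inv_sub _ _ _ 0); apply/eqP => E; move: sz; rewrite -E /= ltxx.
have fk : (line_sqnorm k s0 < +oo)%E.
  by have [] := @kernel_L2strip R z 0 s0 s0 (lexx _) sz.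
set c := 2 ^+ l.+1 * l.+1%:R.
have c0 : 0 < c by rewrite mulr_gt0 // exprn_gt0.
transitivity (\int[mu]_y (c^-1%:E * (complex.Re (h (s0 +i* y) * k (s0 +i* y)))%:E))%E.
  apply: eq_integral => y _; rewrite integral_itv_obnd_cbnd.
    by have [-> _ _] := kernel_weight_integral l (h (s0 +i* y)) (zp y); rewrite -EFinM mulrC.
  apply: (measurable_funS measurableT (subsetT _)).
  by apply/measurable_EFinP; apply: (measurableT_comp mF); exact: measurable_pair2.
rewrite (integralZl measurableT (integrable_lineM Hs0 Hk fs0 fk)).
rewrite (cauchy_line bh s00 sz fs0) -EFinM; congr EFin.
by field; rewrite lt0r_neq0.
Qed.

Definition repro_const (l : nat) : R := 2 / (2 ^+ l.+1 * l.+1%:R).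

Lemma repro_const_gt0 l : 0 < repro_const l.
Proof. by rewrite divr_gt0 // mulr_gt0 // exprn_gt0. Qed.

(** Writing the imaginary part as the real part for -i h lets every real formula be used twice. *)
Lemma bergman_dotE l h k : bergman_dot l h k =
  (pi^-1)%:C * ((\int[(mu \x mu)%E]_(p in D) (p.1 ^+ l * complex.Re (h (p.1 +i* p.2) * (k (p.1 +i* p.2))^*))) +i*
   (\int[(mu \x mu)%E]_(p in D) (p.1 ^+ l * complex.Re ((- 'i * h (p.1 +i* p.2)) * (k (p.1 +i* p.2))^*)))).
Proof.
rewrite /bergman_dot; congr (_ * (_ +i* _)).
  by apply: eq_Rintegral => p _; rewrite Re_realM.
apply: eq_Rintegral => p _; rewrite -mulrA mulNr Re_oppc.
by case: (_ * _^*) => u v /=; ring.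
Qed.

Lemma bergman_Ni l h : bergman l h -> bergman l (fun w => - 'i * h w).
Proof.
move=> /bergmanE[ah fh]; apply/bergmanE; split.
  move/analytic_holo: ah => ah; apply/analytic_holo => w w0.
  by apply: holo_atM (holo_at_cst _ _) _; exact: ah.
apply: le_lt_trans fh; rewrite le_eqVlt; apply/orP; left; apply/eqP.
apply: eq_integral => p _; rewrite normcM normcN.
by have -> : normc ('i : R[i]) = 1; [rewrite /= expr0n /= add0r expr1n sqrtr1|rewrite mul1r].
Qed.

Theorem reproducing l h (z : R[i]) : bergman l h -> Cplus z ->
  bergman_dot l h (ker l z) = (repro_const l)%:C * h z.
Proof.
move=> bh z0; rewrite bergman_dotE /Rintegral (reproducing_Re bh z0).
rewrite (reproducing_Re (bergman_Ni bh) z0) /=.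
have pi0 : pi != 0 :> R by rewrite lt0r_neq0 // pi_gt0.
apply/eqP; rewrite eq_complex; case: (h z) => u v /=; rewrite /repro_const.
have c0 : 2 ^+ l.+1 * l.+1%:R != 0 :> R by rewrite mulf_neq0 ?expf_neq0 ?pnatr_eq0.
by apply/andP; split; apply/eqP; rewrite !(mul0r, mulr0, subr0, addr0, add0r, oppr0, mulN1r, mulNr, opprK, mul1r, sub0r);
  rewrite !mulrA mulVf // mul1r.
Qed.

End ReproducingFormula.

(** * Translations and inversions *)

Section Translations.
Context {R : realType}.
Local Notation mu := (@lebesgue_measure R).
Local Notation RR := (measurableTypeR R * measurableTypeR R)%type.
Local Notation D := (@Cplus_xy R).
Implicit Types (h k u : R[i] -> R[i]).

Definition wdot l h k :=
  (\int[mu \x mu]_(p in D) (p.1 ^+ l * complex.Re (h (p.1 +i* p.2) * (k (p.1 +i* p.2))^*))%:E)%E.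

Lemma bergman_dot_wdot l h k : bergman_dot l h k =
  (pi^-1)%:C * (fine (wdot l h k) +i* fine (wdot l (fun w => - 'i * h w) k)).
Proof. exact: bergman_dotE. Qed.

Lemma bergman_dot_adjoint l h k h' k' :
  wdot l h k = wdot l h' k' ->
  wdot l (fun w => - 'i * h w) k = wdot l (fun w => - 'i * h' w) k' ->
  bergman_dot l h k = bergman_dot l h' k'.
Proof.
by move=> E1 E2; rewrite !bergman_dot_wdot E1 E2.
Qed.

Definition shiftf (a : R[i]) h := fun w => h (w + a).

Lemma holo_shift a h w : holo_at h (w + a) -> holo_at (shiftf a h) w.
Proof.
move=> [d hd]; have D1 := cdiffD (cdiff_id w) (cdiff_cst a w).
by exists (d * (1 + 0)); exact: (cdiff_comp (h := h) (k := fun v => v + a) D1 hd).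
Qed.

Lemma Cplus_add (a w : R[i]) : 0 <= complex.Re a -> Cplus w -> Cplus (w + a).
Proof. by rewrite /Cplus /= Re_addc; lra. Qed.

Lemma analytic_shift a h : 0 <= complex.Re a -> analytic_Cplus h -> analytic_Cplus (shiftf a h).
Proof.
move=> a0 /analytic_holo H; apply/analytic_holo => w w0.
by apply: holo_shift; apply: H; exact: Cplus_add.
Qed.

Lemma line_sqnorm_shift a h x : analytic_Cplus h -> 0 < x + complex.Re a ->
  line_sqnorm (shiftf a h) x = line_sqnorm h (x + complex.Re a).
Proof.
move=> ah xa; rewrite /line_sqnorm.
rewrite (@ge0_integral_affine _ 1 (complex.Im a) (fun y => (normc (h ((x + complex.Re a) +i* y)) ^+ 2)%:E)) //.
- rewrite mul1e; apply: eq_integral => y _; rewrite mul1r /shiftf.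
  by congr ((normc (h _) ^+ 2)%:E); case: (a) => ? ?.
- by apply/measurable_EFinP; apply: measurable_line_sqr; exact: analytic_line.
- by move=> y; rewrite lee_fin sqr_ge0.
Qed.

(** The shift evaluates [h] further to the right, where the weight is larger, and never sees the
    lines to the left of Re a. *)
Lemma weighted_sqint_shift l a h : 0 <= complex.Re a -> analytic_Cplus h ->
  (weighted_sqint l (shiftf a h) <= weighted_sqint l h)%E.
Proof.
move=> a0 ah; have as_ := analytic_shift a0 ah.
rewrite (weighted_sqint_lines l as_) (weighted_sqint_lines l ah).
have mI : measurable (`]0%R, +oo[%classic : set (measurableTypeR R)) by exact: measurable_itv.
pose psi := (fun x : measurableTypeR R => ((x ^+ l)%:E * line_sqnorm h x)%E) \_ `]0%R, +oo[%classic.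
have mpsi : measurable_fun setT psi by apply/(measurable_restrictT _ mI); exact: measurable_weighted_lines.
have psi0 x : (0 <= psi x)%E.
  apply: erestrict_ge0 => {}x; rewrite /= in_itv /= andbT => x0.
  by rewrite mule_ge0 ?line_sqnorm_ge0 // lee_fin exprn_ge0 // ltW.
rewrite [leRHS]integral_mkcond -/psi (@ge0_integral_affine _ 1 (complex.Re a) psi) // mul1e.
rewrite [leLHS]integral_mkcond.
have mpsiA : measurable_fun setT (fun x : measurableTypeR R => psi (1 * x + complex.Re a)).
  apply: (measurableT_comp mpsi); apply: measurable_funD => //; exact: measurable_funM.
apply: ge0_le_integral => //.
- move=> x _; apply: erestrict_ge0 => {}x; rewrite /= in_itv /= andbT => x0.
  by rewrite mule_ge0 ?line_sqnorm_ge0 // lee_fin exprn_ge0 // ltW.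
- by apply/(measurable_restrictT _ mI); exact: measurable_weighted_lines.
- move=> x _; rewrite patchE; case: ifPn => [|_]; last exact: psi0.
  rewrite inE /= in_itv /= andbT => x0.
  rewrite mul1r /psi patchE mem_set; last by rewrite /= in_itv /= andbT; lra.
  rewrite line_sqnorm_shift //; last lra.
  apply: lee_pmul => //.
  + by rewrite lee_fin exprn_ge0 // ltW.
  + exact: line_sqnorm_ge0.
  + by rewrite lee_fin lerXn2r // ?nnegrE; lra.
Qed.

Lemma bergman_shift l a h : 0 <= complex.Re a -> bergman l h -> bergman l (shiftf a h).
Proof.
move=> a0 /bergmanE[ah fh]; apply/bergmanE; split; first exact: analytic_shift.
exact: le_lt_trans (weighted_sqint_shift l a0 ah) fh.
Qed.

Lemma integral_shiftR (f : R -> R) (b : R) : measurable_fun setT f ->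
  (\int[mu]_y (f (y + b))%:E = \int[mu]_y (f y)%:E)%E.
Proof.
move=> mf.
have mfE : measurable_fun setT (EFin \o f) by exact/measurable_EFinP.
rewrite integralE [RHS]integralE; congr (_ - _)%E.
- rewrite (@ge0_integral_affine _ 1 b ((EFin \o f)^\+)%E) //.
  + by rewrite mul1e; apply: eq_integral => y _; rewrite !funeposE /= mul1r.
  + exact: measurable_funepos.
- rewrite (@ge0_integral_affine _ 1 b ((EFin \o f)^\-)%E) //.
  + by rewrite mul1e; apply: eq_integral => y _; rewrite !funenegE /= mul1r.
  + exact: measurable_funeneg.
Qed.

Lemma wdot_shift_im l (t : R) h u : bergman l h -> bergman l u ->
  wdot l (shiftf (0 +i* t) h) u = wdot l h (shiftf (0 -i* t) u).
Proof.
move=> bh bu.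
have bh' : bergman l (shiftf (0 +i* t) h) by exact: bergman_shift.
have bu' : bergman l (shiftf (0 -i* t) u) by exact: bergman_shift.
have [E1 _ _] := integral_Cplus_xy_integrable (integrable_wdot bh' bu).
have [E2 _ _] := integral_Cplus_xy_integrable (integrable_wdot bh bu').
rewrite /wdot E1 E2; apply: eq_integral => x; rewrite inE /= in_itv /= andbT => x0.
pose f (y : R) := x ^+ l * complex.Re (h (x +i* y) * (shiftf (0 -i* t) u (x +i* y))^*).
have mf : measurable_fun setT f.
  have ah : analytic_Cplus h by case/bergmanE: bh.
  have au : analytic_Cplus (shiftf (0 -i* t) u) by case/bergmanE: bu'.
  apply: measurable_funM => //.
  have c1 : cmeas setT (fun y : measurableTypeR R => h (x +i* y)).
    by split; [apply: measurable_line_Re|apply: measurable_line_Im]; exact: analytic_line.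
  have c2 : cmeas setT (fun y : measurableTypeR R => shiftf (0 -i* t) u (x +i* y)).
    by split; [apply: measurable_line_Re|apply: measurable_line_Im]; exact: analytic_line.
  by have [] := cmeasM c1 (cmeas_conj c2).
rewrite -(integral_shiftR t mf); apply: eq_integral => y _; rewrite /f /shiftf.
congr (_ * complex.Re (h _ * (u _)^*))%:E.
- by apply/eqP; rewrite eq_complex /= addr0 !eqxx.
- by apply/eqP; rewrite eq_complex /= addr0 addrK !eqxx.
Qed.

Lemma cdiff_reflect u (A : R) w d : cdiff u (A%:C - w^*) d ->
  cdiff (fun v => (u (A%:C - v^*))^*) w (- d^*).
Proof.
move=> ud e e0; have [dl dl0 H] := ud e e0; exists dl => // v vw.
have E : A%:C - v^* - (A%:C - w^*) = - (v - w)^*.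
  by rewrite rmorphB; ring.
have := H (A%:C - v^*); rewrite E normcN normc_conj => /(_ vw).
apply: le_trans; rewrite le_eqVlt; apply/orP; left; apply/eqP.
rewrite -[LHS]normc_conj; congr normc.
move: (u _) (u _) (v - w) d {ud H E vw} => [? ?] [? ?] [? ?] [? ?].
by apply/eqP; rewrite eq_complex /=; apply/andP; split; apply/eqP; ring.
Qed.

Lemma strip_sqnorm_lines h a b : (forall x y, a <= x <= b -> holo_at h (x +i* y)) ->
  strip_sqnorm h a b = (\int[mu]_(x in `[a, b]) line_sqnorm h x)%E.
Proof.
move=> Hh; have mS := measurable_in_strip a b.
have ms : measurable_fun (in_strip a b) (fun p : RR => (normc (h (p.1 +i* p.2)) ^+ 2)%:E).
  apply/measurable_EFinP; apply: measurable_plane_sqr => // -[x y] [/=].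
  by rewrite in_itv /= => xab _; exact: Hh.
rewrite /strip_sqnorm integral_mkcond fubini_tonelli1; last 2 first.
- exact/(measurable_restrictT _ mS).
- by move=> p; apply: erestrict_ge0 => q _; rewrite lee_fin sqr_ge0.
rewrite [RHS]integral_mkcond; apply: eq_integral => x _; rewrite patchE /fubini_F.
case: ifPn => xab.
  apply: eq_integral => y _; rewrite patchE mem_set //.
  by split => //; move: xab; rewrite inE.
rewrite -[RHS](@integral0 _ _ _ mu setT); apply: eq_integral => y _.
by rewrite patchE memNset // => -[/=] xab' _; move: xab; rewrite notin_setE; exact.
Qed.

(** Reflection in the middle line of the strip exchanges its edges and preserves the strip. *)
Lemma L2strip_reflect u (x g : R) : 0 <= g -> L2strip u x (x + g) ->
  L2strip (fun w => (u ((2 * x + g)%:C - w^*))^*) x (x + g).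
Proof.
move=> g0 [Hu u1 u2 us]; set v := fun w => _.
have vE s y : v (s +i* y) = (u ((2 * x + g - s) +i* y))^*.
  by rewrite /v; congr ((u _)^*); apply/eqP; rewrite eq_complex /=; apply/andP; split; apply/eqP; ring.
have Hv s y : x <= s <= x + g -> holo_at v (s +i* y).
  move=> /andP[s1 s2]; have [d hd] : holo_at u ((2 * x + g)%:C - (s +i* y)^*).
    rewrite (_ : _ - _ = (2 * x + g - s) +i* y); first by apply: Hu; lra.
    by apply/eqP; rewrite eq_complex /=; apply/andP; split; apply/eqP; ring.
  by exists (- d^*); exact: cdiff_reflect hd.
have lv s : line_sqnorm v s = line_sqnorm u (2 * x + g - s).
  by apply: eq_integral => y _; rewrite vE normc_conj.
have x1 : 2 * x + g - x = x + g by ring.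
have x2 : 2 * x + g - (x + g) = x by ring.
split => //; first by rewrite lv x1.
  by rewrite lv x2.
rewrite (strip_sqnorm_lines Hv); under eq_integral do rewrite lv.
rewrite (strip_sqnorm_lines Hu) in us.
pose psi := (line_sqnorm u) \_ `[x, x + g]%classic.
have mS := measurable_in_strip x (x + g).
have mpsi : measurable_fun setT psi.
  have ms : measurable_fun (in_strip x (x + g)) (fun p : RR => (normc (u (p.1 +i* p.2)) ^+ 2)%:E).
    apply/measurable_EFinP; apply: measurable_plane_sqr => // -[s y] [/=].
    by rewrite in_itv /= => xab _; exact: Hu.
  have mP : measurable_fun setT ((fun p : RR => (normc (u (p.1 +i* p.2)) ^+ 2)%:E) \_ (in_strip x (x + g))).
    exact/(measurable_restrictT _ mS).
  have P0 p : (0 <= ((fun p : RR => (normc (u (p.1 +i* p.2)) ^+ 2)%:E) \_ (in_strip x (x + g))) p :> \bar R)%E.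
    by apply: erestrict_ge0 => q _; rewrite lee_fin sqr_ge0.
  have := measurable_fun_fubini_tonelli_F (m2 := mu) _ mP P0.
  apply: eq_measurable_fun => s _; rewrite /psi /fubini_F patchE; case: ifPn => xs.
    apply: eq_integral => y _; rewrite patchE mem_set //.
    by split => //; move: xs; rewrite inE.
  rewrite -[RHS](@integral0 _ _ _ mu setT); apply: eq_integral => y _.
  by rewrite patchE memNset // => -[/=] xab' _; move: xs; rewrite notin_setE; exact.
have psi0 s : (0 <= psi s)%E by apply: erestrict_ge0 => q _; exact: line_sqnorm_ge0.
rewrite [X in (X < _)%E]integral_mkcond.
have -> : (fun s : measurableTypeR R => line_sqnorm u (2 * x + g - s)) \_ `[x, x + g]%classic =
   (fun s => psi (- (1 * s + - (2 * x + g)))).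
  apply/funext => s; rewrite /psi !patchE.
  rewrite (_ : - (1 * s + - (2 * x + g)) = 2 * x + g - s); last by ring.
  rewrite (_ : (s \in `[x, x + g]%classic) = ((2 * x + g - s) \in `[x, x + g]%classic)) //.
  by apply/idP/idP; rewrite !inE /= !in_itv /= => /andP[? ?]; apply/andP; split; lra.
have mpsiN : measurable_fun setT (fun s : measurableTypeR R => psi (- s)).
  by apply: measurableT_comp => //; exact: oppr_measurable.
have := @ge0_integral_affine R 1 (- (2 * x + g)) _ ltr01 mpsiN (fun s => psi0 (- s)).
rewrite mul1e => <-; rewrite -(ge0_integral_opp mpsi psi0).
by move: us; rewrite integral_mkcond.
Qed.

(** For almost every x both sides are line integrals, with the same weight x^l, of [h] times the
    reflection of [u] in the middle of the strip from x to x + g: the left one over the edge at x +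
    g, the right one over the edge at x. Shifting across the strip identifies them. *)
Lemma wdot_shift_real l (g : R) h u : 0 <= g -> bergman l h -> bergman l u ->
  wdot l (shiftf g%:C h) u = wdot l h (shiftf g%:C u).
Proof.
move=> g0 bh bu.
have ah : analytic_Cplus h by case/bergmanE: bh.
have au : analytic_Cplus u by case/bergmanE: bu.
have bh' : bergman l (shiftf g%:C h) by exact: bergman_shift.
have bu' : bergman l (shiftf g%:C u) by exact: bergman_shift.
have [E1 _ m1] := integral_Cplus_xy_integrable (integrable_wdot bh' bu).
have [E2 _ m2] := integral_Cplus_xy_integrable (integrable_wdot bh bu').
rewrite /wdot E1 E2.
have mI : measurable (`]0%R, +oo[%classic : set (measurableTypeR R)) by exact: measurable_itv.
apply: ae_eq_integral => //.
have G1 := good_lines_ae bh; have G2 := good_lines_ae bh'.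
have G3 := good_lines_ae bu; have G4 := good_lines_ae bu'.
apply: filterS2 (filterI G1 G2) (filterI G3 G4) => x [H1 H2] [H3 H4].
rewrite /= in_itv /= andbT => x0.
have xg : 0 < x + g by lra.
have {}H1 := H1 x0; have {}H2 := H2 x0; have {}H3 := H3 x0; have {}H4 := H4 x0.
have H2' : (line_sqnorm h (x + g) < +oo)%E by rewrite line_sqnorm_shift in H2.
have H4' : (line_sqnorm u (x + g) < +oo)%E by rewrite line_sqnorm_shift in H4.
have Lh : L2strip h x (x + g) by exact: bergman_L2strip bh x0 H1 H2'.
have Lu : L2strip u x (x + g) by exact: bergman_L2strip bu x0 H3 H4'.
have Lv := L2strip_reflect g0 Lu.
set v := fun w => _ in Lv.
have xxg : x <= x + g by lra.
have S := strip_shiftM xxg Lh Lv.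
have Fx y : x ^+ l * complex.Re (h (x +i* y) * (shiftf g%:C u (x +i* y))^*) =
    x ^+ l * complex.Re (h (x +i* y) * v (x +i* y)).
  rewrite /v /shiftf; congr (_ * complex.Re (_ * (u _)^*)).
  by apply/eqP; rewrite eq_complex /=; apply/andP; split; apply/eqP; ring.
have Fg y : x ^+ l * complex.Re (shiftf g%:C h (x +i* y) * (u (x +i* y))^*) =
    x ^+ l * complex.Re (h ((x + g) +i* y) * v ((x + g) +i* y)).
  rewrite /v /shiftf; congr (_ * complex.Re (h _ * (u _)^*)).
    by apply/eqP; rewrite eq_complex /= addr0 !eqxx.
  by apply/eqP; rewrite eq_complex /=; apply/andP; split; apply/eqP; ring.
have [Hv v1 v2 _] := Lv.
have I1 : mu.-integrable setT (EFin \o (fun y => complex.Re (h (x +i* y) * v (x +i* y)))).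
  apply: integrable_lineM => // y; first exact: analytic_line.
  by apply: Hv; rewrite lexx.
have I2 : mu.-integrable setT (EFin \o (fun y => complex.Re (h ((x + g) +i* y) * v ((x + g) +i* y)))).
  apply: integrable_lineM => // y; first exact: analytic_line.
  by apply: Hv; rewrite lexx xxg.
transitivity ((x ^+ l)%:E * \int[mu]_y (complex.Re (h ((x + g) +i* y) * v ((x + g) +i* y)))%:E)%E.
  by rewrite -(integralZl measurableT I2); apply: eq_integral => y _; rewrite Fg EFinM.
rewrite -S -(integralZl measurableT I1); apply: eq_integral => y _; by rewrite Fx EFinM.
Qed.

Lemma wdot_shift l (a : R[i]) h u : 0 <= complex.Re a -> bergman l h -> bergman l u ->
  wdot l (shiftf a h) u = wdot l h (shiftf a^* u).
Proof.
case: a => g t /= g0 bh bu.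
have -> : shiftf (g +i* t) h = shiftf (0 +i* t) (shiftf g%:C h).
  apply/funext => w; rewrite /shiftf -addrA; congr (h (_ + _)).
  by apply/eqP; rewrite eq_complex /= add0r addr0 !eqxx.
rewrite wdot_shift_im ?wdot_shift_real //; try exact: bergman_shift.
congr (wdot _ _ _); apply/funext => w; rewrite /shiftf -addrA; congr (u (_ + _)).
by apply/eqP; rewrite eq_complex /= add0r addr0 !eqxx.
Qed.

End Translations.

(** * Inversion of the half-line *)

Section InversionSubstitution.
Context {R : realType}.
Local Notation mu := (@lebesgue_measure R).

Lemma derive1_divl (c x : R) : 0 < x -> derive1 (fun y : R => c / y) x = - (c / x ^+ 2).
Proof.
move=> x0; have x1 : x != 0 by rewrite lt0r_neq0.
rewrite derive1E.
have nz : x%:C != 0 by rewrite eq_complex /= eqxx andbT.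
have D1 := cdiff_is_derive (cdiffM (cdiff_cst c%:C x%:C) (cdiffV nz)).
have E : (fun t : R => complex.Re (c%:C * t%:C^-1)) = (fun y => c / y).
  by apply/funext => t; rewrite -fmorphV -rmorphM.
rewrite E in D1; rewrite (@derive_val _ _ _ _ _ _ _ D1) mul0r add0r.
by rewrite mulrN Re_oppc -rmorphXn -fmorphV -rmorphM.
Qed.

Lemma derivable_divl (c x : R) : 0 < x -> derivable (fun y : R => c / y) x 1.
Proof.
move=> x0; have x1 : x != 0 by rewrite lt0r_neq0.
by apply: derivableM; [exact: derivable_cst|exact: derivableV].
Qed.

Lemma continuous_divX (c x : R) n : 0 < x -> {for x, continuous (fun y : R => c / y ^+ n)}.
Proof.
move=> x0; apply: cvgM; first exact: cvg_cst.
apply: cvgV; first by rewrite expf_neq0 // lt0r_neq0.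
exact: exprn_continuous.
Qed.

Lemma continuous_derive1_divl (c x : R) : 0 < x -> {for x, continuous (derive1 (fun y : R => c / y))}.
Proof.
move=> x0; rewrite /prop_for /continuous_at derive1_divl //.
have H : (fun y : R => - (c / y ^+ 2)) y @[y --> x] --> - (c / x ^+ 2).
  by apply: cvgN; exact: continuous_divX.
apply: cvg_trans H; apply: near_eq_cvg; near=> y; rewrite derive1_divl //.
by near: y; exact: lt_nbhsr.
Unshelve. all: by end_near. Qed.

(** [c = a * b] makes x -> c / x exchange the endpoints, so that the interval is mapped onto
    itself. *)
Lemma inversion_itv (c a b : R) (g : R -> R) : 0 < a -> a <= b -> c = a * b ->
  (forall x, 0 < x -> {for x, continuous g}) ->
  (\int[mu]_(x in `[a, b]) (g x)%:E = \int[mu]_(x in `[a, b]) (c / x ^+ 2 * g (c / x))%:E)%E.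
Proof.
move=> a0 ab cE cg; have b0 := lt_le_trans a0 ab.
have Fb : c / b = a by rewrite cE mulfK // lt0r_neq0.
have Fa : c / a = b by rewrite cE mulrC mulKf // lt0r_neq0.
have c0 : 0 < c by rewrite cE mulr_gt0.
have := @integration_by_substitution_decreasing R (fun y => c / y) g a b ab.
rewrite Fb Fa => -> //.
- apply: eq_integral => x; rewrite inE /= in_itv /= => /andP[ax _].
  have x0 := lt_le_trans a0 ax.
  by congr EFin; rewrite !fctE /= derive1_divl // opprK mulrC.
- move=> x y; rewrite !in_itv /= => /andP[ax _] /andP[ay _] xy.
  have x0 := lt_le_trans a0 ax; have y0 := lt_le_trans a0 ay.
  by rewrite ltr_pM2l // ltf_pV2 // posrE.
- by move=> x; rewrite in_itv /= => /andP[ax _]; apply: continuous_derive1_divl; exact: lt_trans ax.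
- apply/cvg_ex; eexists; apply: cvg_at_right_filter; exact: continuous_derive1_divl.
- apply/cvg_ex; eexists; apply: cvg_at_left_filter; exact: continuous_derive1_divl.
- split.
  + by move=> x; rewrite in_itv /= => /andP[ax _]; apply: derivable_divl; exact: lt_trans ax.
  + apply: cvg_at_right_filter; have := @continuous_divX c a 1 a0; exact.
  + apply: cvg_at_left_filter; have := @continuous_divX c b 1 b0; exact.
- apply: continuous_in_subspaceT => x; rewrite inE /= in_itv /= => /andP[ax _].
  by apply: cg; exact: lt_le_trans ax.
Qed.

Lemma inversion_half_line (c : R) (g : R -> R) : 0 < c ->
  (forall x, 0 < x -> {for x, continuous g}) -> (forall x, 0 < x -> 0 <= g x) ->
  (\int[mu]_(x in `]0%R, +oo[) (g x)%:E = \int[mu]_(x in `]0%R, +oo[) (c / x ^+ 2 * g (c / x))%:E)%E.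
Proof.
move=> c0 cg g0.
(* The intervals [a n, b n] are stable under x -> c / x and exhaust the half-line; the summand c + 1
   ensures a n <= 1 <= b n. *)
pose b (n : nat) := c + 1 + n%:R; pose a n := c / b n.
have b1 n : 1 <= b n by rewrite /b; have := ler0n R n; lra.
have bc n : c <= b n by rewrite /b; have := ler0n R n; lra.
have a0 n : 0 < a n by rewrite divr_gt0 //; have := b1 n; lra.
have a1 n : a n <= 1 by rewrite ler_pdivrMr ?mul1r //; have := b1 n; lra.
have ab n : a n <= b n := le_trans (a1 n) (b1 n).
have cE n : c = a n * b n by rewrite divfK // lt0r_neq0 //; have := b1 n; lra.
pose F n : set (measurableTypeR R) := `[a n, b n]%classic.
have ndF : nondecreasing_seq F.
  move=> m n mn; apply/subsetPset => x; rewrite /F /= !in_itv /= => /andP[x1 x2].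
  have mnR : m%:R <= n%:R :> R by rewrite ler_nat.
  have bmn : b m <= b n by rewrite /b; lra.
  rewrite (le_trans x2 bmn) andbT; apply: le_trans x1.
  by rewrite /a ler_pM2l // lef_pV2 // posrE; [have := b1 n|have := b1 m]; lra.
have FT : \bigcup_n F n = `]0, +oo[%classic.
  apply/seteqP; split => x.
    by case=> n _; rewrite /F /= !in_itv /= andbT => /andP[x1 _]; exact: lt_le_trans x1.
  rewrite /= in_itv /= andbT => x0.
  exists (Num.truncn (x + c / x)).+1 => //; rewrite /F /= in_itv /=.
  have T := truncnS_gt (x + c / x); set N := (_.+1) in T *.
  have cx0 : 0 < c / x by rewrite divr_gt0.
  have bN : 0 < b N by have := b1 N; lra.
  apply/andP; split; last by rewrite /b; lra.
  rewrite /a ler_pdivrMr // mulrC -ler_pdivrMr // /b; lra.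
have mF i : measurable (F i) by exact: measurable_itv.
have mI : measurable (`]0%R, +oo[%classic : set (measurableTypeR R)) by exact: measurable_itv.
have sub i : F i `<=` `]0%R, +oo[%classic by rewrite -FT => x Fx; exists i.
have mg (k : R -> R) : (forall x, 0 < x -> {for x, continuous k}) ->
    measurable_fun (`]0%R, +oo[%classic : set (measurableTypeR R)) (EFin \o k).
  move=> ck; apply/measurable_EFinP; apply: open_continuous_measurable_fun; first exact: interval_open.
  by move=> x; rewrite inE /= in_itv /= andbT; exact: ck.
have cvg (k : R -> R) : (forall x, 0 < x -> {for x, continuous k}) -> (forall x, 0 < x -> 0 <= k x) ->
    (\int[mu]_(x in F i) (k x)%:E)%E @[i --> \oo] --> (\int[mu]_(x in `]0%R, +oo[) (k x)%:E)%E.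
  move=> ck k0; rewrite -FT; apply: ge0_nondecreasing_set_cvg_integral => //.
    by move=> i; apply: measurable_funS (mg _ ck).
  by move=> i x /sub; rewrite /= in_itv /= andbT => /k0; rewrite lee_fin.
have ck : forall x : R, 0 < x -> {for x, continuous (fun y : R => c / y ^+ 2 * g (c / y))}.
  move=> x x0; apply: cvgM; first exact: continuous_divX.
  apply: (@continuous_comp _ _ _ (fun y : R => c / y) g); first by have := @continuous_divX c x 1 x0; exact.
  by apply: cg; rewrite divr_gt0.
have C1 := cvg _ cg g0.
have k0 (x : R) : 0 < x -> 0 <= c / x ^+ 2 * g (c / x).
  move=> x0; apply: mulr_ge0; last by apply: g0; rewrite divr_gt0.
  by apply: divr_ge0; [exact: ltW|rewrite exprn_ge0 // ltW].
have C2 := cvg _ ck k0.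
have E : (fun i => \int[mu]_(x in F i) (g x)%:E)%E = (fun i => \int[mu]_(x in F i) (c / x ^+ 2 * g (c / x))%:E)%E.
  by apply/funext => i; exact: inversion_itv.
rewrite -(cvg_lim _ C1) // E; exact: cvg_lim C2.
Qed.

End InversionSubstitution.

(** * Inversion of the half-plane *)

Section PlaneInversion.
Context {R : realType}.
Local Notation mu := (@lebesgue_measure R).
Local Notation RR := (measurableTypeR R * measurableTypeR R)%type.
Local Notation D := (@Cplus_xy R).
Implicit Types (x t q : R).

Lemma Cplus_xyP (p : RR) : D p <-> 0 < p.1.
Proof. by []. Qed.

Lemma ge0_swap_Cplus_xy (F : RR -> \bar R) : measurable_fun D F ->
  (forall p, D p -> 0 <= F p)%E ->
  (\int[mu \x mu]_(p in D) F p = \int[mu]_y \int[mu]_(x in `]0%R, +oo[) F (x, y))%E /\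
  measurable_fun setT (fun y : measurableTypeR R => \int[mu]_(x in `]0%R, +oo[) F (x, y))%E.
Proof.
move=> mF F0.
have mP : measurable_fun setT (F \_ D) by exact/(measurable_restrictT _ (@measurable_Cplus_xy R)).
have P0 p : (0 <= (F \_ D) p)%E by exact: erestrict_ge0.
have E (y : measurableTypeR R) : (\int[mu]_x (F \_ D) (x, y) = \int[mu]_(x in `]0%R, +oo[) F (x, y))%E.
  rewrite [RHS]integral_mkcond; apply: eq_integral => x _.
  rewrite !patchE; case: ifPn => x0.
    by move: x0; rewrite inE => /Cplus_xyP /= x0; rewrite mem_set //= in_itv /= x0.
  move: x0; rewrite notin_setE => x0; rewrite memNset //= in_itv /= andbT => x0'.
  exact: x0.
split.
  by rewrite integral_mkcond (fubini_tonelli2 _ mP P0); apply: eq_integral => y _; exact: E.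
have := measurable_fun_fubini_tonelli_G (m1 := mu) _ mP P0.
by apply: eq_measurable_fun => y _; exact: E.
Qed.

Lemma measurable_slice (F : RR -> \bar R) x : measurable_fun D F -> 0 < x ->
  measurable_fun setT (fun y : measurableTypeR R => F (x, y)).
Proof.
move=> mF x0.
have mP : measurable_fun setT (F \_ D) by exact/(measurable_restrictT _ (@measurable_Cplus_xy R)).
have : measurable_fun setT (fun y : measurableTypeR R => (F \_ D) (x, y)).
  by apply: (measurableT_comp mP); exact: measurable_pair1.
by apply: eq_measurable_fun => y _; rewrite patchE mem_set.
Qed.

Lemma measurable_fst_Cplus_xy : measurable_fun D (fun p : RR => p.1).
Proof. by apply: (measurable_funS measurableT (subsetT _)); exact: measurable_fst. Qed.

(* In the coordinates x and t = y / x the inversion w |-> q / w is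
   (x, t) |-> (q / ((1 + t^2) x), - t), which reduces it to one variable. *)
Lemma plane_slope (G : RR -> \bar R) : measurable_fun D G ->
  (forall p, D p -> 0 <= G p)%E ->
  (\int[mu \x mu]_(p in D) G p = \int[mu]_t \int[mu]_(x in `]0%R, +oo[) (x%:E * G (x, x * t)%R))%E /\
  measurable_fun setT (fun t : measurableTypeR R => \int[mu]_(x in `]0%R, +oo[) (x%:E * G (x, x * t)%R))%E.
Proof.
move=> mG G0; have mD := @measurable_Cplus_xy R.
pose H (p : RR) := (p.1%:E * G (p.1, (p.1 * p.2)%R))%E.
have mphi : measurable_fun setT (fun p : RR => (p.1, p.1 * p.2) : RR).
  apply: measurable_fun_pair; first exact: measurable_fst.
  by apply: measurable_funM; [exact: measurable_fst|exact: measurable_snd].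
have {}mphi : measurable_fun D (fun p : RR => (p.1, p.1 * p.2) : RR) by exact: measurable_funS mphi.
have mH : measurable_fun D H.
  apply: emeasurable_funM; first by apply/measurable_EFinP; exact: measurable_fst_Cplus_xy.
  by apply: (measurable_comp mD _ mG mphi) => _ [p pD <-].
have H0 p : D p -> (0 <= H p)%E.
  move=> pD; rewrite /H mule_ge0 //; last exact: G0.
  by rewrite lee_fin ltW.
have [S1 S2] := ge0_swap_Cplus_xy mH H0.
split => //; rewrite -S1 (integral_Cplus_xy mG G0) (integral_Cplus_xy mH H0).
apply: eq_integral => x; rewrite inE /= in_itv /= andbT => x0.
rewrite (@ge0_integral_affine _ x 0 (fun y => G (x, y))) //; last 2 first.
- exact: measurable_slice.
- by move=> y; apply: G0.
rewrite -ge0_integralZl //; last 3 first.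
- apply: (measurableT_comp (measurable_slice mG x0)).
  by apply: measurable_funD => //; exact: measurable_funM.
- by move=> y _; exact: G0.
- by rewrite lee_fin ltW.
by apply: eq_integral => t _; rewrite /H /= addr0.
Qed.

Definition invxy q (p : RR) : RR :=
  (q * p.1 / (p.1 ^+ 2 + p.2 ^+ 2), - (q * p.2 / (p.1 ^+ 2 + p.2 ^+ 2))).

Lemma invxy_Cplus q p : 0 < q -> D p -> D (invxy q p).
Proof.
move=> q0 /Cplus_xyP p0; apply/Cplus_xyP => /=.
by rewrite divr_gt0 ?mulr_gt0 // ltr_pwDl ?sqr_ge0 ?exprn_gt0.
Qed.

Lemma measurable_sqnorm_inv : measurable_fun setT (fun p : RR => (p.1 ^+ 2 + p.2 ^+ 2)^-1).
Proof.
have [c1 c2] : cmeas setT (fun p : RR => (p.1 ^+ 2 + p.2 ^+ 2)%:C^-1).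
  apply: cmeasV; apply: (cmeas_ReIm (g := fun=> 0)); last exact: measurable_cst.
  by apply: measurable_funD; apply: measurable_funX;
    [exact: measurable_fst|exact: measurable_snd].
by apply: eq_measurable_fun c1 => p _; rewrite -fmorphV.
Qed.

Lemma measurable_invxy q : measurable_fun setT (invxy q).
Proof.
apply: measurable_fun_pair.
  apply: measurable_funM; last exact: measurable_sqnorm_inv.
  by apply: measurable_funM => //; exact: measurable_fst.
apply: measurable_funN; apply: measurable_funM; last exact: measurable_sqnorm_inv.
by apply: measurable_funM => //; exact: measurable_snd.
Qed.

(** In slope coordinates the inversion is a one-variable substitution for each slope; this is the
    continuity that it needs. *)
Definition ray_continuous (f : RR -> R) :=
  forall t x, 0 < x -> {for x, continuous (fun s : R => f (s, s * t))}.

(** The squared modulus of the derivative of q / w, that is q^2 / |w|^4. *)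
Definition jac q (p : RR) := q ^+ 2 / (p.1 ^+ 2 + p.2 ^+ 2) ^+ 2.

Lemma jac_ge0 q p : 0 <= jac q p.
Proof. by rewrite divr_ge0 ?sqr_ge0. Qed.

Lemma measurable_inversion q (f : RR -> R) : 0 < q -> measurable_fun D f ->
  measurable_fun D (fun p : RR => jac q p * f (invxy q p)).
Proof.
move=> q0 mf; apply: measurable_funM.
  apply: measurable_funM => //.
  under eq_fun do rewrite -exprVn.
  by apply: measurable_funX; exact: measurable_funS measurable_sqnorm_inv.
have mi : measurable_fun D (invxy q) by exact: measurable_funS (measurable_invxy q).
apply: (measurable_comp (@measurable_Cplus_xy R) _ mf mi).
by move=> _ [p pD <-]; exact: invxy_Cplus.
Qed.

Lemma ge0_plane_inversion q (f : RR -> R) : 0 < q -> measurable_fun D f ->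
  (forall p, D p -> 0 <= f p) -> ray_continuous f ->
  (\int[mu \x mu]_(p in D) (f p)%:E = \int[mu \x mu]_(p in D) (jac q p * f (invxy q p))%:E)%E.
Proof.
move=> q0 mf f0 cf.
have mfE : measurable_fun D (EFin \o f) by exact/measurable_EFinP.
have mgE : measurable_fun D (EFin \o (fun p : RR => jac q p * f (invxy q p))).
  by apply/measurable_EFinP; exact: measurable_inversion.
have f0E p : D p -> (0 <= (EFin \o f) p)%E by move=> /f0; rewrite lee_fin.
have g0E p : D p -> (0 <= (EFin \o (fun p : RR => (jac q p * f (invxy q p))%R)) p)%E.
  move=> pD; rewrite lee_fin mulr_ge0 ?jac_ge0 //; apply: f0; exact: invxy_Cplus.
have [S1 m1] := plane_slope mfE f0E.
have [S2 _] := plane_slope mgE g0E.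
rewrite S1 S2 (ge0_integral_opp m1); last first.
  move=> t; apply: integral_ge0 => x; rewrite /= in_itv /= andbT => x0.
  by apply: mule_ge0; [rewrite lee_fin ltW|exact: f0E].
apply: eq_integral => t _.
(* At slope t one has |w|^2 = (1 + t^2) x^2, so that q / w has abscissa c / x. *)
pose c := q / (1 + t ^+ 2).
have t1 : 0 < 1 + t ^+ 2 by rewrite ltr_pwDl ?sqr_ge0.
have c0 : 0 < c by rewrite divr_gt0.
under eq_integral do rewrite -EFinM.
have := @inversion_half_line R c (fun x => x * f (x, x * - t)) c0.
move=> -> .
- apply: eq_integral => x; rewrite inE /= in_itv /= andbT => x0; rewrite -EFinM; congr EFin.
  have x1 : x != 0 by rewrite lt0r_neq0.
  have E1 : x ^+ 2 + (x * t) ^+ 2 = x ^+ 2 * (1 + t ^+ 2) by ring.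
  have t2 : 1 + t ^+ 2 != 0 by rewrite lt0r_neq0.
  have -> : invxy q (x, x * t) = (c / x, c / x * - t).
    rewrite /invxy /= E1 /c; congr (_, _); field; by rewrite ?x1 ?t2.
  rewrite !mulrA; congr (_ * _); rewrite /jac /= E1 /c; field.
  by rewrite x1 t2.
- by move=> x x0; apply: cvgM; [exact: cvg_id|exact: cf].
- by move=> x x0; apply: mulr_ge0; [exact: ltW|exact: f0].
Qed.

(** Positive and negative parts are treated separately; they stay continuous along rays, and the
    nonnegative Jacobian passes through the maximum with 0. *)
Lemma plane_inversion q (f : RR -> R) : 0 < q -> measurable_fun D f -> ray_continuous f ->
  (\int[mu \x mu]_(p in D) (f p)%:E = \int[mu \x mu]_(p in D) (jac q p * f (invxy q p))%:E)%E.
Proof.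
move=> q0 mf cf; rewrite integralE [RHS]integralE.
have cm (g : RR -> R) : measurable_fun D g -> ray_continuous g ->
    (\int[mu \x mu]_(p in D) (maxr (g p) 0)%:E =
     \int[mu \x mu]_(p in D) (maxr (jac q p * g (invxy q p)) 0)%:E)%E.
  move=> mg cg; rewrite (@ge0_plane_inversion q (fun p => maxr (g p) 0)) //.
  - apply: eq_integral => p _; congr EFin.
    by rewrite (maxr_pMr _ _ (jac_ge0 q p)) mulr0.
  - by apply: measurable_maxr.
  - by move=> p _; rewrite le_max lexx orbT.
  - by move=> t x x0; apply: continuous_max; [exact: cg|exact: cvg_cst].
have posE (g : RR -> R) : (\int[mu \x mu]_(p in D) (fun p => (g p)%:E)^\+ p =
    \int[mu \x mu]_(p in D) (maxr (g p) 0)%:E)%E.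
  by apply: eq_integral => p _; rewrite funeposE EFin_max.
have negE (g : RR -> R) : (\int[mu \x mu]_(p in D) (fun p => (g p)%:E)^\- p =
    \int[mu \x mu]_(p in D) (maxr (- g p) 0)%:E)%E.
  by apply: eq_integral => p _; rewrite funenegE EFin_max.
rewrite (posE f) (negE f) (posE (fun p => jac q p * f (invxy q p))).
rewrite (negE (fun p => jac q p * f (invxy q p))) (cm f mf cf).
congr (_ - _)%E; rewrite (cm (fun p => - f p)).
- by apply: eq_integral => p _; rewrite mulrN.
- exact: measurable_funN.
- by move=> t x x0; apply: cvgN; exact: cf.
Qed.

End PlaneInversion.

(** * The inversion operator *)

Section InversionOperator.
Context {R : realType}.
Local Notation mu := (@lebesgue_measure R).
Local Notation RR := (measurableTypeR R * measurableTypeR R)%type.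
Local Notation D := (@Cplus_xy R).
Implicit Types (h k u : R[i] -> R[i]) (q : R).

Definition inversionf (l : nat) q h (w : R[i]) := w ^- l.+2 * h (q%:C / w).

Lemma Cplus_neq0 (w : R[i]) : Cplus w -> w != 0.
Proof. by move=> w0; apply/eqP => E; move: w0; rewrite /Cplus /= E ltxx. Qed.

Lemma Cplus_div q (w : R[i]) : 0 < q -> Cplus w -> Cplus (q%:C / w).
Proof.
move=> q0 w0; have nw : 0 < normc w by rewrite normc_gt0 Cplus_neq0.
by rewrite /Cplus /= Re_realM Re_invc mulr_gt0 // divr_gt0 // exprn_gt0.
Qed.

Lemma div_invxy q (p : RR) : q%:C / (p.1 +i* p.2) = (invxy q p).1 +i* (invxy q p).2.
Proof.
case: p => x y; rewrite /invxy /=; apply/eqP; rewrite eq_complex /=.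
by apply/andP; split; apply/eqP; rewrite ?mul0r ?subr0 ?addr0 ?mulrN mulrA.
Qed.

Lemma analytic_inv l q h : 0 < q -> analytic_Cplus h -> analytic_Cplus (inversionf l q h).
Proof.
move=> q0 /analytic_holo H; apply/analytic_holo => w w0.
have nw := Cplus_neq0 w0.
apply: holo_atM.
  have D1 := cdiffX l.+1 (cdiff_id w).
  by eexists; exact: (cdiff_inv D1 (expf_neq0 l.+2 nw)).
have [d hd] := H _ (Cplus_div q0 w0).
have D1 := cdiffM (cdiff_cst q%:C w) (cdiffV nw).
by eexists; exact: (cdiff_comp (k := fun v => q%:C / v) D1 hd).
Qed.

Lemma ray_continuous_wdot l h k : analytic_Cplus h -> analytic_Cplus k ->
  ray_continuous (fun p : RR => p.1 ^+ l * complex.Re (h (p.1 +i* p.2) * (k (p.1 +i* p.2))^*)).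
Proof.
move=> /analytic_holo Hh /analytic_holo Hk t x x0.
have E s : s +i* (s * t) = s%:C * (1 +i* t).
  by apply/eqP; rewrite eq_complex /=; apply/andP; split; apply/eqP; ring.
have C v : (forall w, Cplus w -> holo_at v w) ->
    {for x, continuous (fun s : R => complex.Re (v (s +i* (s * t))))} /\
    {for x, continuous (fun s : R => complex.Im (v (s +i* (s * t))))}.
  move=> Hv.
  have wx : Cplus (x%:C * (1 +i* t)) by rewrite /Cplus /= mul0r subr0 mulr1.
  have [d vd] := Hv _ wx.
  have D1 := cdiffM (cdiff_id x%:C) (cdiff_cst (1 +i* t) x%:C).
  have [c1 c2 _ _] := cdiff_cont_lines (cdiff_comp (k := fun w => w * (1 +i* t)) D1 vd).
  have E1 : (fun s : R => v (s +i* (s * t))) = (fun s => v (s%:C * (1 +i* t))).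
    by apply/funext => s; rewrite E.
  split.
    by rewrite (_ : (fun s => _) = (@complex.Re R) \o (fun s : R => v (s +i* (s * t)))) // E1.
  by rewrite (_ : (fun s => _) = (@complex.Im R) \o (fun s : R => v (s +i* (s * t)))) // E1.
have [h1 h2] := C h Hh; have [k1 k2] := C k Hk.
have F (z z' : R[i]) : complex.Re (z * z'^*) =
    complex.Re z * complex.Re z' + complex.Im z * complex.Im z'.
  by case: z z' => [? ?] [? ?] /=; ring.
rewrite (_ : (fun s => _) = (fun s : R => s ^+ l *
  (complex.Re (h (s +i* (s * t))) * complex.Re (k (s +i* (s * t))) +
   complex.Im (h (s +i* (s * t))) * complex.Im (k (s +i* (s * t)))))); last first.
  by apply/funext => s; rewrite /= F.
apply: cvgM; first exact: exprn_continuous.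
by apply: cvgD; apply: cvgM.
Qed.

(** Under w -> q / w the weighted measure acquires the factor (q / |w|^2)^(l+2). Since |w|^2 is w
    times its conjugate, this cancels the factor that [inversionf] puts on the conjugate of [u] and
    leaves w^-(l+2) on [h]. *)
Lemma wdot_inv l q h u : 0 < q -> analytic_Cplus h -> analytic_Cplus u ->
  wdot l (inversionf l q h) u = wdot l h (inversionf l q u).
Proof.
move=> q0 ah au; rewrite {2}/wdot.
have ai := analytic_inv (l:=l) q0 au.
rewrite (plane_inversion q0 (measurable_wdot l ah ai) (ray_continuous_wdot (l:=l) ah ai)).
apply: eq_integral => p; rewrite inE => /Cplus_xyP p0; congr EFin.
rewrite -div_invxy; set w := p.1 +i* p.2.
have w0 : Cplus w by [].
have nw := Cplus_neq0 w0; have q1 : q%:C != 0 :> R[i] by rewrite fmorph_eq0 lt0r_neq0.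
have -> : (invxy q p).1 = p.1 * (q * (p.1 ^+ 2 + p.2 ^+ 2)^-1) by rewrite /invxy /=; ring.
have -> : jac q p = q ^+ 2 * (p.1 ^+ 2 + p.2 ^+ 2) ^- 2 by [].
have E : p.1 ^+ 2 + p.2 ^+ 2 = normc w ^+ 2 by rewrite sqr_normcE.
rewrite E; have nn : normc w != 0 by rewrite lt0r_neq0 // normc_gt0.
set N := normc w ^+ 2; have N0 : N != 0 by rewrite expf_neq0.
have NC : N%:C = w * w^*.
  by rewrite /N sqr_normcE; case: (w) => a b; apply/eqP; rewrite eq_complex /=; apply/andP; split; apply/eqP; ring.
have nwc : w^* != 0 by rewrite fmorph_eq0.
set X := complex.Re (h _ * _).
have -> : q ^+ 2 / (normc w ^+ 2 * normc w ^+ 2) * ((p.1 * (q / N)) ^+ l * X) =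
   p.1 ^+ l * ((q ^+ 2 * N ^- 2 * (q * N^-1) ^+ l) * X).
  by rewrite -/N exprMn; ring.
rewrite {}/X; clearbody N; congr (_ * _); rewrite -Re_realM; congr complex.Re.
have -> : inversionf l q u (q%:C / w) = (q%:C / w) ^- l.+2 * u w.
  by rewrite /inversionf invf_div mulrCA divff // mulr1.
have -> : (((q%:C / w) ^- l.+2 * u w)^* = (q%:C / w^*) ^- l.+2 * (u w)^*).
  by rewrite rmorphM fmorphV rmorphXn fmorph_div /= (conjc_real q : (q%:C)^* = q%:C).
rewrite /inversionf (_ : ((w ^- l.+2 * h (q%:C / w))) = N%:C ^- l.+2 * w^* ^+ l.+2 * h (q%:C / w)); last first.
  by rewrite NC exprMn (invfM (w ^+ l.+2)) mulfVK // expf_neq0.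
have -> : (q ^+ 2 * N ^- 2 * (q * N^-1) ^+ l) = q ^+ l.+2 * N ^- l.+2.
  by rewrite exprMn exprVn -[l.+2]addn2 !exprD (invfM (N ^+ l)); ring.
rewrite rmorphM fmorphV !rmorphXn /= expr_div_n invf_div.
have qn : q%:C ^+ l.+2 != 0 :> R[i] by rewrite expf_neq0.
move: qn; set a := q%:C ^+ _; set b := N%:C ^- _; set c := _ ^+ l.+2; move=> qn.
have -> : a * b * (h (q%:C / w) * (c / a * (u w)^*)) =
  (a / a) * (b * c * h (q%:C / w) * (u w)^*) by ring.
by rewrite divff // mul1r.
Qed.

Lemma weighted_sqint_wdot l h : weighted_sqint l h = wdot l h h.
Proof.
apply: eq_integral => p _; congr (_ * _)%:E; rewrite sqr_normcE.
by case: (h _) => a b /=; ring.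
Qed.

Lemma invf_invf l q h w : 0 < q -> Cplus w -> inversionf l q (inversionf l q h) w = (q ^- l.+2)%:C * h w.
Proof.
move=> q0 w0; rewrite {1}/inversionf; have nw := Cplus_neq0 w0; have q1 : q%:C != 0 :> R[i] by rewrite fmorph_eq0 lt0r_neq0.
have -> : inversionf l q h (q%:C / w) = (q%:C / w) ^- l.+2 * h w.
  by rewrite /inversionf invf_div mulrCA divff // mulr1.
rewrite mulrA; congr (_ * _).
by rewrite fmorphV rmorphXn /= expr_div_n invf_div mulrA mulVf ?expf_neq0 // mul1r.
Qed.

(** Symmetry reduces the norm to [invf_invf]: the square of the operator is the scalar q^-(l+2). *)
Lemma weighted_sqint_inv l q h : 0 < q -> analytic_Cplus h ->
  (weighted_sqint l (inversionf l q h) = (q ^- l.+2)%:E * weighted_sqint l h)%E.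
Proof.
move=> q0 ah; have ai := analytic_inv (l:=l) q0 ah.
have qn : 0 <= q ^- l.+2 by rewrite invr_ge0 exprn_ge0 // ltW.
rewrite weighted_sqint_wdot (wdot_inv _ q0 ah ai) weighted_sqint_wdot.
rewrite -weighted_sqint_wdot /weighted_sqint -(ge0_integralZl _ (@measurable_Cplus_xy R) (measurable_weight l ah) (@weight_ge0 _ l h)); last by rewrite lee_fin.
apply: eq_integral => p; rewrite inE => p0; rewrite -EFinM; congr EFin.
rewrite (invf_invf _ _ q0 p0) rmorphM /= (conjc_real _ : (q ^- l.+2)%:C^* = (q ^- l.+2)%:C).
have -> : h (p.1 +i* p.2) * ((q ^- l.+2)%:C * (h (p.1 +i* p.2))^*) =
  (q ^- l.+2)%:C * (h (p.1 +i* p.2) * (h (p.1 +i* p.2))^*) by ring.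
rewrite Re_realM mulrCA; congr (_ * (_ * _)); rewrite sqr_normcE.
by case: (h _) => a b /=; ring.
Qed.

Lemma bergman_inv l q h : 0 < q -> bergman l h -> bergman l (inversionf l q h).
Proof.
move=> q0 /bergmanE[ah fh]; apply/bergmanE; split; first exact: analytic_inv.
rewrite weighted_sqint_inv //; apply: lte_mul_pinfty => //.
by rewrite lee_fin invr_ge0 exprn_ge0 // ltW.
Qed.

End InversionOperator.

(** * Bounded symmetric weighted composition operators *)

Section HermitianCriterion.
Context {R : realType}.
Local Notation mu := (@lebesgue_measure R).
Local Notation RR := (measurableTypeR R * measurableTypeR R)%type.
Local Notation D := (@Cplus_xy R).
Implicit Types (h k u v : R[i] -> R[i]) (l : nat).

Lemma analytic_eq h k : (forall w, Cplus w -> h w = k w) -> analytic_Cplus h -> analytic_Cplus k.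
Proof.
move=> E /analytic_holo H; apply/analytic_holo => w w0; have [d hd] := H w w0.
exists d; apply: cdiff_eq w0 _ hd => v vw; apply: E; rewrite /Cplus /=.
have := le_lt_trans (ler_Re_normc _) vw; rewrite Re_addc Re_oppc ltr_norml; lra.
Qed.

Lemma weighted_sqint_eq l h k : (forall w, Cplus w -> h w = k w) ->
  weighted_sqint l h = weighted_sqint l k.
Proof. by move=> E; apply: eq_integral => p; rewrite inE => pD; rewrite E. Qed.

Lemma bergman_eq l h k : (forall w, Cplus w -> h w = k w) -> bergman l h -> bergman l k.
Proof.
move=> E /(bergmanE l h).1 [ah fh]; apply: (bergmanE l k).2; split.
  exact: (analytic_eq E ah).
by move: fh; rewrite (weighted_sqint_eq l E).
Qed.

Lemma wdot_eq l h h' k k' : (forall w, Cplus w -> h w = h' w) ->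
  (forall w, Cplus w -> k w = k' w) -> wdot l h k = wdot l h' k'.
Proof. by move=> E E'; apply: eq_integral => p; rewrite inE => pD; rewrite E // E'. Qed.

Lemma bergman_dot_eq l h h' k k' : (forall w, Cplus w -> h w = h' w) ->
  (forall w, Cplus w -> k w = k' w) -> bergman_dot l h k = bergman_dot l h' k'.
Proof.
move=> E E'; apply: bergman_dot_adjoint; first exact: wdot_eq.
by apply: wdot_eq => // w w0; rewrite E.
Qed.

Lemma bergman_norm_weighted l h : bergman l h ->
  bergman_norm l h = Num.sqrt (pi^-1 * fine (weighted_sqint l h)).
Proof.
move=> /(bergmanE l h).1 [_ fh]; rewrite /bergman_norm /bergman_sqnorm -/(weighted_sqint l h).
by rewrite fineM // ge0_fin_numE // weighted_sqint_ge0.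
Qed.

Lemma wdot_sym l h k : wdot l h k = wdot l k h.
Proof.
apply: eq_integral => p _; congr (_ * _)%:E.
by case: (h _) (k _) => [? ?] [? ?] /=; ring.
Qed.

Lemma bergman_dot_conj l h k : bergman l h -> bergman l k ->
  bergman_dot l k h = (bergman_dot l h k)^*.
Proof.
move=> bh bk; rewrite !bergman_dot_wdot wdot_sym.
have bi := bergman_Ni bh.
have I := integrable_wdot bi bk.
have -> : wdot l (fun w => - 'i * k w) h = (- wdot l (fun w => (- 'i * h w)%R) k)%E.
  rewrite /wdot -integralN; last first.
    exact: (integrable_add_def (@measurable_Cplus_xy R) I).
  apply: eq_integral => p _; rewrite -EFinN -mulrN; congr (_ * _)%:E.
  by case: (h _) (k _) => [? ?] [? ?] /=; ring.
rewrite fineN rmorphM /= (conjc_real _ : (_%:C)^* = _%:C); congr (_ * _).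
Qed.

Lemma ker_separates l v v' : bergman l v -> bergman l v' ->
  (forall z, Cplus z -> bergman_dot l (ker l z) v = bergman_dot l (ker l z) v') ->
  forall z, Cplus z -> v z = v' z.
Proof.
move=> bv bv' E z z0; have bk := ker_bergman l z0.
have := congr1 (fun x : R[i] => x^*) (E z z0).
rewrite -!bergman_dot_conj // !reproducing //; apply: mulfI.
by rewrite fmorph_eq0 lt0r_neq0 // repro_const_gt0.
Qed.

(** A bounded, everywhere defined operator and its adjoint, tested on real parts. Commuting with
    multiplication by -i is the amount of complex linearity that turns the real identity into the
    complex one. *)
Definition adjoint_pair l (A B : (R[i] -> R[i]) -> R[i] -> R[i]) :=
  [/\ forall h, bergman l h -> bergman l (A h),
      forall u, bergman l u -> bergman l (B u),
      exists2 C : R, 0 < C & forall h, bergman l h ->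
        (weighted_sqint l (A h) <= C%:E * weighted_sqint l h)%E,
      forall h, A (fun w => - 'i * h w) = (fun w => - 'i * A h w)
    & forall h u, bergman l h -> bergman l u -> wdot l (A h) u = wdot l h (B u)].

Lemma adjoint_pair_comp l A B A' B' : adjoint_pair l A B -> adjoint_pair l A' B' ->
  adjoint_pair l (A \o A') (B' \o B).
Proof.
move=> [a1 a2 [C C0 a3] a4 a5] [b1 b2 [C' C0' b3] b4 b5]; split => /=.
- by move=> h /b1/a1.
- by move=> u /a2/b2.
- exists (C * C'); first exact: mulr_gt0.
  move=> h bh; apply: (le_trans (a3 _ (b1 _ bh))).
  by rewrite EFinM -muleA lee_pmul2l // ?lte_fin // b3.
- by move=> h; rewrite b4 a4.
- by move=> h u bh bu; rewrite (a5 _ _ (b1 _ bh) bu) (b5 _ _ bh (a2 _ bu)).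
Qed.

Lemma adjoint_pair_dot l A B h u : adjoint_pair l A B -> bergman l h -> bergman l u ->
  bergman_dot l (A h) u = bergman_dot l h (B u).
Proof.
move=> [_ _ _ Ai AB] bh bu; apply: bergman_dot_adjoint; first exact: AB.
by rewrite -AB // ?Ai //; exact: bergman_Ni.
Qed.

(** W has full domain and is symmetric, so W u is an adjoint value at u. The value that [xget] picks
    in [adjoint] has the same pairings with the kernels, hence agrees with W u on the half-plane. *)
Lemma hermitian_bounded l f g A : adjoint_pair l A A ->
  (forall h w, Cplus w -> f w * h (g w) = A h w) ->
  hermitian_op l (Wmax l f g) /\ bounded_op l (Wmax l f g).
Proof.
move=> AA WA; have [A1 _ [C C0 A3] _ _] := AA.
have bW h : bergman l h -> bergman l (fun w => f w * h (g w)).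
  by move=> bh; apply: bergman_eq (A1 _ bh) => w w0; rewrite WA.
have domW : op_dom (Wmax l f g) = bergman l.
  by apply/seteqP; split=> [h []//|h bh]; split => //; exact: bW.
have symW h u : bergman l h -> bergman l u ->
    bergman_dot l (op_act (Wmax l f g) h) u = bergman_dot l h (op_act (Wmax l f g) u).
  move=> bh bu; have := adjoint_pair_dot AA bh bu.
  rewrite -(bergman_dot_eq l (WA h) (fun _ _ => erefl)).
  by rewrite -(bergman_dot_eq l (fun _ _ => erefl) (WA u)).
have advW u : bergman l u -> adjoint_value l (Wmax l f g) u (op_act (Wmax l f g) u).
  by move=> bu; split=> [|h [bh _]]; [exact: bW|exact: symW].
split; last first.
  split=> //; exists (Num.sqrt C); first by rewrite sqrtr_gt0.
  move=> h bh; rewrite !bergman_norm_weighted //; last exact: bW.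
  have <- := sqrtrM (pi^-1 * fine (weighted_sqint l h)) (ltW C0).
  apply: ler_wsqrtr; rewrite mulrCA.
  rewrite ler_pM2l ?invr_gt0 ?pi_gt0 // (weighted_sqint_eq l (WA h)).
  have [_ fh] := (bergmanE l h).1 bh; have [_ fA] := (bergmanE l _).1 (A1 _ bh).
  have fin1 : weighted_sqint l h \is a fin_num by rewrite ge0_fin_numE // weighted_sqint_ge0.
  have fin2 : weighted_sqint l (A h) \is a fin_num by rewrite ge0_fin_numE // weighted_sqint_ge0.
  by rewrite -lee_fin EFinM !fineK // A3.
split.
  move=> u bu e e0; exists u; first by rewrite domW.
  rewrite /bergman_norm /bergman_sqnorm integral0_eq; last first.
    by move=> p _; rewrite subrr normc0 expr0n /= mulr0.
  by rewrite mule0 sqrtr0.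
split.
  rewrite domW; apply/seteqP; split=> [u bu|u []//].
  by split => //; exists (op_act (Wmax l f g) u); exact: advW.
move=> u; rewrite domW => bu w w0.
have [bv Hv] : adjoint_value l (Wmax l f g) u (op_act (adjoint l (Wmax l f g)) u).
  by apply: xgetPex; exists (op_act (Wmax l f g) u); exact: advW.
apply: (ker_separates (bW _ bu) bv) w0 => z z0; have bk := ker_bergman l z0.
by rewrite -Hv ?domW // symW.
Qed.

End HermitianCriterion.

(** * Scalars, translations, inversions and rank one operators *)

Section BoundedSymmetric.
Context {R : realType}.
Local Notation mu := (@lebesgue_measure R).
Local Notation RR := (measurableTypeR R * measurableTypeR R)%type.
Local Notation D := (@Cplus_xy R).
Implicit Types (h k u v : R[i] -> R[i]) (l : nat).

Lemma weighted_sqint_scale l (c : R[i]) h : analytic_Cplus h ->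
  weighted_sqint l (fun w => c * h w) = ((normc c ^+ 2)%:E * weighted_sqint l h)%E.
Proof.
move=> ah; rewrite /weighted_sqint -(ge0_integralZl _ (@measurable_Cplus_xy R) (measurable_weight l ah) (@weight_ge0 _ l h)); last by rewrite lee_fin sqr_ge0.
by apply: eq_integral => p _; rewrite -EFinM normcM exprMn mulrCA.
Qed.

Lemma bergman_scale l (c : R[i]) h : bergman l h -> bergman l (fun w => c * h w).
Proof.
move=> /(bergmanE l h).1 [ah fh]; apply: (bergmanE l _).2; split.
  move/analytic_holo: ah => ah; apply/analytic_holo => w w0.
  by apply: holo_atM (holo_at_cst _ _) _; exact: ah.
by rewrite (weighted_sqint_scale _ _ ah); apply: lte_mul_pinfty => //; rewrite lee_fin sqr_ge0.
Qed.

Lemma adjoint_pair_scale l (c : R) :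
  adjoint_pair l (fun h w => c%:C * h w) (fun h w => c%:C * h w).
Proof.
split=> [h|u||h|h u _ _]; try exact: bergman_scale.
- exists (normc c%:C ^+ 2 + 1); first by rewrite ltr_wpDl ?sqr_ge0.
  move=> h /(bergmanE l h).1 [ah _]; rewrite (weighted_sqint_scale _ _ ah).
  apply: lee_wpmul2r; first exact: weighted_sqint_ge0.
  by rewrite lee_fin lerDl.
- by apply/funext => w; rewrite mulrCA.
- apply: eq_integral => p _; congr (_ * _)%:E.
  by case: (h _) (u _) => [? ?] [? ?] /=; ring.
Qed.

Lemma adjoint_pair_shift l (a : R[i]) : 0 <= complex.Re a ->
  adjoint_pair l (shiftf a) (shiftf a^*).
Proof.
move=> a0; have a0' : 0 <= complex.Re a^* by case: a a0.
split=> [h|u||//|h u]; first exact: bergman_shift; first exact: bergman_shift.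
- by exists 1 => // h /(bergmanE l h).1 [ah _]; rewrite mul1e weighted_sqint_shift.
- exact: wdot_shift.
Qed.

Lemma adjoint_pair_inv l (q : R) : 0 < q -> adjoint_pair l (inversionf l q) (inversionf l q).
Proof.
move=> q0; split=> [h|u||h|h u]; try exact: bergman_inv.
- exists (q ^- l.+2); first by rewrite invr_gt0 exprn_gt0.
  by move=> h /(bergmanE l h).1 [ah _]; rewrite weighted_sqint_inv.
- by apply/funext => w; rewrite /inversionf mulrCA.
- move=> /(bergmanE l h).1 [ah _] /(bergmanE l u).1 [au _]; exact: wdot_inv.
Qed.

Lemma wdot_le l h k : bergman l h -> bergman l k ->
  (wdot l h k <= weighted_sqint l h + weighted_sqint l k)%E.
Proof.
move=> bh bk; have I := integrable_wdot bh bk.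
have [ah fh] := (bergmanE l h).1 bh; have [ak fk] := (bergmanE l k).1 bk.
have mh := measurable_weight l ah; have mk := measurable_weight l ak.
rewrite /weighted_sqint -(ge0_integralD _ (@measurable_Cplus_xy R) (@weight_ge0 _ l h) mh (@weight_ge0 _ l k) mk).
apply: (le_trans (lee_abs _)).
apply: (le_trans (le_abse_integral _ (@measurable_Cplus_xy R) (measurable_int _ I))).
apply: ge0_le_integral => //.
- exact: measurable_Cplus_xy.
- by apply: measurableT_comp => //; exact: measurable_int I.
- exact: emeasurable_funD.
- move=> p; rewrite /Cplus_xy /Cplus /= => p0.
  rewrite -EFinD lee_fin normrM (ger0_norm (exprn_ge0 _ (ltW p0))) -mulrDr.
  apply: ler_wpM2l; first by rewrite exprn_ge0 // ltW.
  by apply: (le_trans (Re_mul_le _ _)); rewrite normc_conj.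
Qed.

Lemma wdot_ker l h (z : R[i]) : bergman l h -> Cplus z ->
  wdot l h (ker l z) = (pi * repro_const l * complex.Re (h z))%:E.
Proof. exact: reproducing_Re. Qed.

(* The reproducing formula for (h m)^* h at m, with h scaled by s and the kernel
   by 1 / s, where s is so large that the kernel's share of the AM-GM bound is
   absorbed on the left. *)
Lemma eval_bounded l (m : R[i]) : Cplus m -> exists2 C : R, 0 < C &
  forall h, bergman l h -> ((normc (h m) ^+ 2)%:E <= C%:E * weighted_sqint l h)%E.
Proof.
move=> m0; have bk := ker_bergman l m0.
have [ak fk] := (bergmanE l _).1 bk.
have kE : (fine (weighted_sqint l (ker l m)))%:E = weighted_sqint l (ker l m).
  by rewrite fineK // ge0_fin_numE // weighted_sqint_ge0.
set K := fine _ in kE; have K0 : 0 <= K by rewrite -lee_fin kE weighted_sqint_ge0.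
pose c : R := pi * repro_const l; have c0 : 0 < c by rewrite mulr_gt0 ?pi_gt0 ?repro_const_gt0.
pose s2 := 2 * (K + 1) / c; have s20 : 0 < s2 by rewrite divr_gt0 // mulr_gt0 //; lra.
pose s := Num.sqrt s2; have s0 : 0 < s by rewrite sqrtr_gt0.
have ss : s ^+ 2 = s2 by rewrite sqr_sqrtr // ltW.
exists (2 * s2 / c); first by rewrite divr_gt0 // mulr_gt0.
move=> h bh; have [ah fh] := (bergmanE l _).1 bh.
have hE : (fine (weighted_sqint l h))%:E = weighted_sqint l h.
  by rewrite fineK // ge0_fin_numE // weighted_sqint_ge0.
set H := fine _ in hE; have H0 : 0 <= H by rewrite -lee_fin hE weighted_sqint_ge0.
set a := h m.
have := wdot_le (bergman_scale s%:C bh) (bergman_scale ((s^-1)%:C * a) bk).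
have -> : wdot l (fun w => s%:C * h w) (fun w => (s^-1)%:C * a * ker l m w) =
    wdot l (fun w => a^* * h w) (ker l m).
  apply: eq_integral => p _; congr (_ * complex.Re _)%:E.
  rewrite !rmorphM /= (conjc_real _ : (_%:C)^* = _%:C) fmorphV /=.
  have s1 : s%:C != 0 :> R[i] by rewrite fmorph_eq0 lt0r_neq0.
  by field.
rewrite (wdot_ker (bergman_scale _ bh) m0) -/c -/a !weighted_sqint_scale // -hE -kE.
rewrite -!EFinM -EFinD !lee_fin normcM !normc_real !gtr0_norm ?invr_gt0 // exprMn exprVn ss.
have -> : complex.Re (a^* * a) = normc a ^+ 2.
  by rewrite sqr_normcE; case: a => [? ?] /=; ring.
set N := normc a ^+ 2; have N0 : 0 <= N by exact: sqr_ge0.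
move=> L.
have c1 : c != 0 by rewrite lt0r_neq0.
have K1 : K + 1 != 0 by rewrite lt0r_neq0 // ltr_wpDl.
have KN : s2^-1 * N * K <= c / 2 * N.
  have -> : s2^-1 * N * K = (c / 2 * N) * (K / (K + 1)).
    by rewrite /s2; field; rewrite ?c1 ?K1.
  rewrite -[leRHS]mulr1; apply: ler_wpM2l; first by rewrite mulr_ge0 // divr_ge0 // ltW.
  by rewrite ler_pdivrMr ?ltr_wpDl // mul1r lerDl.
have -> : 2 * s2 / c * H = (s2 * H) / (c / 2) by field; rewrite ?c1.
rewrite ler_pdivlMr; last by rewrite divr_gt0.
lra.
Qed.

Definition rank_one l (c : R) (m : R[i]) h w := c%:C * ker l m w * h m.

(** By the reproducing formula both sides are, up to the constant of the kernel, c times the real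
    part of h(m) times the conjugate of u(m); [eval_bounded] gives the norm bound. *)
Lemma adjoint_pair_rank_one l c (m : R[i]) : Cplus m ->
  adjoint_pair l (rank_one l c m) (rank_one l c m).
Proof.
move=> m0; have bk := ker_bergman l m0; have [ak fk] := (bergmanE l _).1 bk.
have E h : rank_one l c m h = (fun w => (c%:C * h m) * ker l m w).
  by apply/funext => w; rewrite /rank_one mulrAC.
have kE : (fine (weighted_sqint l (ker l m)))%:E = weighted_sqint l (ker l m).
  by rewrite fineK // ge0_fin_numE // weighted_sqint_ge0.
set K := fine _ in kE; have K0 : 0 <= K by rewrite -lee_fin kE weighted_sqint_ge0.
split=> [h|u||h|h u bh bu]; rewrite ?E; try by move=> _; exact: bergman_scale.
- have [C C0 H] := eval_bounded l m0.
  exists ((c ^+ 2 * K + 1) * C).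
    by rewrite mulr_gt0 // ltr_wpDl // mulr_ge0 // sqr_ge0.
  move=> h bh; rewrite E weighted_sqint_scale // normcM normc_real exprMn real_normK ?num_real //.
  rewrite -kE -EFinM [X in (_ <= X * _)%E]EFinM -muleA.
  have cK : 0 <= c ^+ 2 * K + 1 by rewrite addr_ge0 // mulr_ge0 // sqr_ge0.
  apply: (@le_trans _ _ ((c ^+ 2 * K + 1)%:E * (normc (h m) ^+ 2)%:E)%E).
    rewrite -!EFinM lee_fin.
    have := sqr_ge0 (normc (h m)); set N := normc _ ^+ 2; nra.
  by apply: lee_wpmul2l (H h bh); rewrite lee_fin.
- by apply/funext => w; rewrite /rank_one; ring.
- have -> : wdot l (fun w => c%:C * h m * ker l m w) u = wdot l (fun w => (c%:C * (h m)^*) * u w) (ker l m).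
    apply: eq_integral => p _; congr (_ * _)%:E.
    by case: (h _) (u _) (ker _ _ _) => [? ?] [? ?] [? ?] /=; ring.
  have -> : wdot l h (fun w => c%:C * u m * ker l m w) = wdot l (fun w => (c%:C * (u m)^*) * h w) (ker l m).
    apply: eq_integral => p _; congr (_ * _)%:E.
    by case: (h _) (u _) (ker _ _ _) => [? ?] [? ?] [? ?] /=; ring.
  rewrite (wdot_ker (bergman_scale _ bu) m0) (wdot_ker (bergman_scale _ bh) m0).
  congr (_ * _)%:E; by case: (h _) (u _) => [? ?] [? ?] /=; ring.
Qed.

End BoundedSymmetric.

(** * The listed operators are hermitian and bounded *)

Section Sufficiency.
Context {R : realType}.
Implicit Types (f g h : R[i] -> R[i]) (l : nat).

(** If [A] composes with a map phi, the sandwich composes with w -> phi (w + p) + conj p, which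
    gives the general pole -p. *)
Lemma adjoint_pair_sandwich l (p : R[i]) A : 0 <= complex.Re p -> adjoint_pair l A A ->
  adjoint_pair l (shiftf p \o A \o shiftf p^*) (shiftf p \o A \o shiftf p^*).
Proof.
move=> p0 AA; have p0' : 0 <= complex.Re p^* by case: p p0.
have P1 := adjoint_pair_shift l p0; have P2 := adjoint_pair_shift l p0'.
have := adjoint_pair_comp (adjoint_pair_comp P1 AA) P2.
by rewrite (conjcK p : p^*^* = p).
Qed.

Lemma adjoint_pair_scale_comm l (c : R) A : adjoint_pair l A A ->
  (forall h, A (fun w => c%:C * h w) = fun w => c%:C * A h w) ->
  adjoint_pair l (fun h w => c%:C * A h w) (fun h w => c%:C * A h w).
Proof.
move=> AA Ac; have := adjoint_pair_comp (adjoint_pair_scale l c) AA.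
have -> : A \o (fun h w => c%:C * h w) = (fun h w => c%:C * A h w) by apply/funext => h /=.
by [].
Qed.

Lemma case_zero_adjoint l f g : case_zero f ->
  hermitian_op l (Wmax l f g) /\ bounded_op l (Wmax l f g).
Proof.
move=> f0; apply: (hermitian_bounded (adjoint_pair_scale l 0)) => h w w0.
by rewrite f0 // !mul0r.
Qed.

Lemma case_constant_adjoint l f g : case_constant l f g ->
  hermitian_op l (Wmax l f g) /\ bounded_op l (Wmax l f g).
Proof.
move=> [m [e [m0 H]]]; apply: (hermitian_bounded (adjoint_pair_rank_one l e m0)) => h w w0.
by have [-> ->] := H w w0.
Qed.

Lemma case_translation_adjoint l f g : case_translation f g ->
  hermitian_op l (Wmax l f g) /\ bounded_op l (Wmax l f g).
Proof.
move=> [c [la [c0 H]]].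
have P := adjoint_pair_shift l (c0 : 0 <= complex.Re c%:C).
rewrite (conjc_real c : (c%:C)^* = c%:C) in P.
apply: (hermitian_bounded (adjoint_pair_scale_comm (c := la) P _)) => // h w w0.
by have [-> ->] := H w w0.
Qed.

Lemma inversion_sandwich_adjoint l f g (p : R[i]) (q c : R) : 0 <= complex.Re p -> 0 < q ->
  (forall w, Cplus w -> g w = q%:C / (w + p) + p^* /\ f w = c%:C * (w + p) ^- l.+2) ->
  hermitian_op l (Wmax l f g) /\ bounded_op l (Wmax l f g).
Proof.
move=> p0 q0 H.
have P : adjoint_pair l (fun h w => c%:C * inversionf l q h w) (fun h w => c%:C * inversionf l q h w).
  apply: adjoint_pair_scale_comm (adjoint_pair_inv l q0) _ => h.
  by apply/funext => w; rewrite /inversionf mulrCA.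
apply: (hermitian_bounded (adjoint_pair_sandwich p0 P)) => h w w0.
by have [-> ->] := H w w0; rewrite /= /shiftf /inversionf mulrA.
Qed.

(* Conjugating the translation by 1 / s with the inversion w |-> 1 / w gives
   the parabolic map w |-> s - s^2 / (w + s). *)
Lemma translation_sandwich_adjoint l f g (p : R[i]) (s c : R) : 0 < s -> s <= complex.Re p ->
  (forall w, Cplus w -> g w = p^* - (s ^+ 2)%:C / (w + p) /\ f w = c%:C * (w + p) ^- l.+2) ->
  hermitian_op l (Wmax l f g) /\ bounded_op l (Wmax l f g).
Proof.
move=> s0 sp H.
have b0 : 0 <= complex.Re (s^-1)%:C by rewrite /= invr_ge0 ltW.
have P := adjoint_pair_shift l b0.
rewrite (conjc_real s^-1 : ((s^-1)%:C)^* = (s^-1)%:C) in P.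
have J := adjoint_pair_inv l (ltr01 : 0 < 1 :> R).
have {}P := adjoint_pair_comp (adjoint_pair_comp J P) J.
have {}P : adjoint_pair l
    (fun h w => (c / s ^+ l.+2)%:C * (inversionf l 1 \o shiftf (s^-1)%:C \o inversionf l 1) h w)
    (fun h w => (c / s ^+ l.+2)%:C * (inversionf l 1 \o shiftf (s^-1)%:C \o inversionf l 1) h w).
  apply: adjoint_pair_scale_comm P _ => h.
  by apply/funext => w; rewrite /= /shiftf /inversionf; ring.
have p0 : 0 <= complex.Re (p - s%:C) by rewrite Re_addc Re_oppc subr_ge0.
apply: (hermitian_bounded (adjoint_pair_sandwich p0 P)) => h w w0.
have [-> ->] := H w w0; rewrite /= /shiftf /inversionf addrA.
have s1 : s%:C != 0 :> R[i] by rewrite fmorph_eq0 lt0r_neq0.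
have wp : w + p != 0.
  by apply/eqP => /(congr1 (@complex.Re R)); move: w0; rewrite /Cplus /= Re_addc; lra.
have w1 : w + p - s%:C != 0.
  apply/eqP => /(congr1 (@complex.Re R)); move: w0; rewrite /Cplus /= !Re_addc Re_oppc /=; lra.
set x := w + p - s%:C.
have E1 : 1%:C / x + (s^-1)%:C = (w + p) / (s%:C * x).
  by rewrite fmorphV /x; field; rewrite s1 w1.
have E2 : 1%:C / (1%:C / x + (s^-1)%:C) + (p - s%:C)^* = p^* - (s ^+ 2)%:C / (w + p).
  rewrite E1 rmorphB /= (conjc_real s : (s%:C)^* = s%:C) rmorphXn /= /x.
  by field; rewrite s1 wp w1.
rewrite E2 !mulrA; congr (_ * _).
rewrite E1 expr_div_n invf_div exprMn rmorphM fmorphV rmorphXn /=.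
have xn : x ^+ l.+2 != 0 by rewrite expf_neq0.
have sn : s%:C ^+ l.+2 != 0 :> R[i] by rewrite expf_neq0.
set a := x ^+ _ in xn *; set b := s%:C ^+ _ in sn *.
have -> : c%:C / b / a * (b * a / (w + p) ^+ l.+2) = (b / b) * (a / a) * (c%:C / (w + p) ^+ l.+2) by ring.
by rewrite !divff // !mul1r.
Qed.

(** Normal form with the pole at -p. The sign of 2 / alpha tells a sandwiched inversion, when
    negative, from a sandwiched parabolic map, when positive. *)
Lemma moebius_formE l (alpha delta : R) (beta : R[i]) f g (p := - (beta^* / alpha%:C)) :
  alpha != 0 -> moebius_form l alpha delta beta f g ->
  complex.Re p = - (complex.Re beta / alpha) /\
  forall w, Cplus w -> g w = p^* - (2 / alpha)%:C / (w + p) /\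
    f w = (delta / alpha ^+ l.+2)%:C * (w + p) ^- l.+2.
Proof.
move=> a0 H; have a1 : alpha%:C != 0 :> R[i] by rewrite fmorph_eq0.
split; first by rewrite /p Re_oppc mulrC -fmorphV Re_realM mulrC; case: (beta).
move=> w w0; have [-> ->] := H w w0.
have -> : alpha%:C * w - beta^* = alpha%:C * (w + p).
  by rewrite /p mulrDr mulrN [X in _ = _ - X]mulrC mulfVK.
have -> : p^* = - (beta / alpha%:C).
  by rewrite /p rmorphN fmorph_div /= (conjc_real alpha : (alpha%:C)^* = alpha%:C) (conjcK beta : beta^*^* = beta).
rewrite !fmorph_div rmorphXn rmorph_nat /= exprMn; split.
  by rewrite invfM !mulrA.
by rewrite (invfM (alpha%:C ^+ l.+2)) mulrA.
Qed.

(** Covers Re beta = 0 and Re beta > 0 together: the inversion with q = -2 / alpha asks for Re p >=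
    0, and Re p = -Re beta / alpha. *)
Lemma case_moebius_neg_adjoint l f g (alpha delta : R) (beta : R[i]) :
  alpha < 0 -> 0 <= complex.Re beta -> moebius_form l alpha delta beta f g ->
  hermitian_op l (Wmax l f g) /\ bounded_op l (Wmax l f g).
Proof.
move=> a0 b0 H; have [pE {}H] := moebius_formE (ltr0_neq0 a0) H.
set p := - _ in pE H.
have p0 : 0 <= complex.Re p by rewrite pE oppr_ge0 mulr_ge0_le0 // invr_le0 ltW.
have q0 : 0 < - (2 / alpha) by rewrite oppr_gt0 pmulr_rlt0 // invr_lt0.
apply: (inversion_sandwich_adjoint (c := delta / alpha ^+ l.+2) p0 q0) => w w0.
have [-> ->] := H w w0.
by rewrite (rmorphN (real_complex R)) mulNr addrC.
Qed.

Lemma case_moebius_gt0_adjoint l f g (alpha delta : R) (beta : R[i]) :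
  complex.Re beta < 0 -> 0 < alpha -> alpha <= complex.Re beta ^+ 2 / 2 ->
  moebius_form l alpha delta beta f g ->
  hermitian_op l (Wmax l f g) /\ bounded_op l (Wmax l f g).
Proof.
move=> b0 a0 ab H; have [pE {}H] := moebius_formE (lt0r_neq0 a0) H.
set p := - _ in pE H; set s := Num.sqrt (2 / alpha).
have r0 : 0 < 2 / alpha by rewrite divr_gt0.
have s0 : 0 < s by rewrite sqrtr_gt0.
have ss : s ^+ 2 = 2 / alpha by rewrite sqr_sqrtr // ltW.
have p0 : 0 <= complex.Re p by rewrite pE -mulNr divr_ge0 // ?oppr_ge0 ltW.
(* After squaring, this is the condition alpha <= (Re beta)^2 / 2. *)
have sp : s <= complex.Re p.
  rewrite -(ler_pXn2r (n := 2)) ?nnegrE ?(ltW s0) // ss pE sqrrN expr_div_n.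
  rewrite ler_pdivlMr ?exprn_gt0 //; have -> : 2 / alpha * alpha ^+ 2 = 2 * alpha.
    by field; rewrite lt0r_neq0.
  lra.
apply: (translation_sandwich_adjoint (c := delta / alpha ^+ l.+2) s0 sp) => w w0.
by have [-> ->] := H w w0; rewrite ss.
Qed.

End Sufficiency.

(** * Classification of the hermitian operators *)

Section Necessity.
Context {R : realType}.
Implicit Types (f g h X Y : R[i] -> R[i]) (l n : nat).

Lemma bergman_dot_scale_ker l h (c z : R[i]) : bergman l h -> Cplus z ->
  bergman_dot l h (fun w => c^* * ker l z w) = (repro_const l)%:C * (c * h z).
Proof.
move=> bh z0; rewrite -(reproducing (bergman_scale c bh) z0).
by apply: bergman_dot_adjoint; apply: eq_integral => p _; congr (_ * complex.Re _)%:E;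
  rewrite rmorphM /= (conjcK c : c^*^* = c); ring.
Qed.

Lemma hermitian_kernel_identity l f g : (forall w, Cplus w -> Cplus (g w)) ->
  hermitian_op l (Wmax l f g) -> forall w z, Cplus w -> Cplus z ->
  f w * (w + (g z)^*) ^+ l.+2 = (f z)^* * (g w + z^*) ^+ l.+2.
Proof.
move=> gC [_ [domE actE]].
have adv z : Cplus z ->
    adjoint_value l (Wmax l f g) (ker l z) (fun w => (f z)^* * ker l (g z) w).
  move=> z0; split; first exact: bergman_scale (ker_bergman l (gC _ z0)).
  move=> h [bh bfh]; rewrite (bergman_dot_scale_ker (f z) bh (gC _ z0)).
  exact: (reproducing bfh z0).
(* Membership of the kernels in the domain of W is not clear directly; by [adv] they lie in the
   domain of the adjoint, and the two domains coincide. *)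
have kdom z : Cplus z -> op_dom (Wmax l f g) (ker l z).
  move=> z0; rewrite domE; split; first exact: ker_bergman.
  by exists (fun w => (f z)^* * ker l (g z) w); exact: adv.
move=> w z w0 z0.
have [bv Hv] : adjoint_value l (Wmax l f g) (ker l z) (op_act (adjoint l (Wmax l f g)) (ker l z)).
  by apply: xgetPex; eexists; exact: adv.
have [bv' Hv'] := adv z z0.
have : f w * ker l z (g w) = (f z)^* * ker l (g z) w.
  have := actE _ (kdom z z0) w w0; rewrite [LHS]/= => ->.
  apply: (ker_separates bv bv') w0 => y y0.
  by rewrite -Hv ?Hv' //; exact: kdom.
have d1 : g w + z^* != 0.
  apply/eqP => /(congr1 (@complex.Re R)); move: (gC _ w0) z0; rewrite /Cplus /= Re_addc.
  by case: (z) => a b /=; lra.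
have d2 : w + (g z)^* != 0.
  apply/eqP => /(congr1 (@complex.Re R)); move: (gC _ z0) w0; rewrite /Cplus /= Re_addc.
  by case: (g z) => a b /=; lra.
by rewrite /ker => /eqP; rewrite eqr_div ?expf_neq0 // => /eqP ->.
Qed.

(** This is f'/f + (n+1) X'/X = (n+1) Y'/Y cleared of denominators. The constant [C] and the powers
    disappear without any choice of a root. *)
Lemma power_wronskian f X Y n (w f' X' Y' C : R[i]) (r : R) : 0 < r ->
  cdiff f w f' -> cdiff X w X' -> cdiff Y w Y' ->
  (forall v, normc (v - w) < r -> f v * X v ^+ n.+1 = C * Y v ^+ n.+1) ->
  X w != 0 ->
  (f' * X w + n.+1%:R * f w * X') * Y w = n.+1%:R * f w * Y' * X w.
Proof.
move=> r0 df dX dY E X0.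
have D1 := cdiffM df (cdiffX n dX).
have D2 := cdiffM (cdiff_cst C w) (cdiffX n dY).
have := cdiff_unique (cdiff_eq r0 E D1) D2.
have : f w * X w ^+ n.+1 = C * Y w ^+ n.+1 by apply: E; rewrite subrr normc0.
rewrite mul0r add0r !exprSr; set x := X w ^+ n; set y := Y w ^+ n => E0 E1.
have x0 : x * X w != 0 by rewrite mulf_neq0 // expf_neq0.
apply: (mulfI x0).
have -> : x * X w * ((f' * X w + n.+1%:R * f w * X') * Y w) =
  (f' * (x * X w) + f w * (n.+1%:R * x * X')) * (X w * Y w) by ring.
rewrite E1; have -> : C * (n.+1%:R * y * Y') * (X w * Y w) = n.+1%:R * Y' * X w * (C * (y * Y w)) by ring.
by rewrite -E0; ring.
Qed.

Lemma quadratic_eq0 (a b c : R[i]) :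
  (forall t : R, 0 < t -> a * t%:C ^+ 2 + b * t%:C + c = 0) -> [/\ a = 0, b = 0 & c = 0].
Proof.
move=> H; have E1 := H 1 ltr01; have E2 := H 2 (ltr0Sn _ _); have E3 := H 3 (ltr0Sn _ _).
rewrite !rmorph_nat rmorph1 in E1 E2 E3.
have a0 : a = 0.
  apply: (@mulfI _ 2); first by rewrite pnatr_eq0.
  (* The second difference at 1, 2, 3. *)
  have -> : 2 * a = (a * 3 ^+ 2 + b * 3 + c) - 2 * (a * 2 ^+ 2 + b * 2 + c) + (a * 1 ^+ 2 + b * 1 + c) by ring.
  by rewrite E1 E2 E3 !mulr0; ring.
rewrite a0 !mul0r !add0r in E1 E2.
have b0 : b = 0.
  have -> : b = (b * 2 + c) - (b * 1 + c) by ring.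
  by rewrite E1 E2 subrr.
by split => //; rewrite b0 mul0r add0r in E1.
Qed.

Definition kernel_symmetric n f g := forall w z : R[i], Cplus w -> Cplus z ->
  f w * (w + (g z)^*) ^+ n.+1 = (f z)^* * (g w + z^*) ^+ n.+1.

Lemma Cplus_conj_add (w z : R[i]) : Cplus w -> Cplus z -> w + z^* != 0.
Proof.
move=> w0 z0; apply/eqP => /(congr1 (@complex.Re R)); move: w0 z0; rewrite /Cplus /= Re_addc.
by case: z => a b /=; lra.
Qed.

(** With the second variable at the zero of [f], the right side of the identity vanishes, while the
    base of the power on the left never does. *)
Lemma kernel_symmetric_zero n f g (w : R[i]) : (forall z, Cplus z -> Cplus (g z)) ->
  kernel_symmetric n f g -> Cplus w -> f w = 0 -> case_zero f.
Proof.
move=> gC S w0 fw z z0; have := S z w z0 w0; rewrite fw rmorph0 mul0r => /eqP.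
by rewrite mulf_eq0 expf_eq0 /= (negbTE (Cplus_conj_add z0 (gC _ w0))) orbF => /eqP.
Qed.

Lemma Cplus_ball (w v : R[i]) : normc (v - w) < complex.Re w -> Cplus v.
Proof.
move=> vw; have := le_lt_trans (ler_Re_normc _) vw.
by rewrite /Cplus /= Re_addc Re_oppc ltr_norml; lra.
Qed.

(* The logarithmic derivative at 1 of the kernel identity, as a function of the other variable. *)
Lemma kernel_symmetric_bilinear n f g : analytic_Cplus f -> analytic_Cplus g ->
  (forall z, Cplus z -> Cplus (g z)) -> kernel_symmetric n f g -> f 1 != 0 ->
  exists a c : R[i], forall z, Cplus z ->
    (1 + g z) * (a - c * ((g 1)^* + z)) = (g 1)^* + z.
Proof.
move=> /analytic_holo af /analytic_holo ag gC S f1.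
have p1 : Cplus (1 : R[i]) by exact: ltr01.
have [f' df] := af _ p1; have [g' dg] := ag _ p1.
have n0 : n.+1%:R != 0 :> R[i] by rewrite pnatr_eq0.
(* The logarithmic derivative at w = 1 reads f'/((n+1) f(1)) + 1/(1 + conj g(z)) = g'/(g(1) + conj
   z); the witnesses come from clearing denominators and conjugating. *)
exists g'^*, (f' / (n.+1%:R * f 1))^* => z z0.
have dX := cdiffD (cdiff_id 1) (cdiff_cst (g z)^* 1).
have dY := cdiffD dg (cdiff_cst z^* 1).
have H : forall v, normc (v - 1) < 1 :> R ->
    f v * (v + (g z)^*) ^+ n.+1 = (f z)^* * (g v + z^*) ^+ n.+1.
  by move=> v v1; apply: S => //; exact: (@Cplus_ball 1).
have := power_wronskian (X := fun v => v + (g z)^*) (Y := fun v => g v + z^*)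
  ltr01 df dX dY H (Cplus_conj_add p1 (gC _ z0)).
rewrite !addr0 mulr1 => E.
have E' : (1 + (g z)^*) * (g' - (f' / (n.+1%:R * f 1)) * (g 1 + z^*)) = g 1 + z^*.
  have nf : n.+1%:R * f 1 != 0 by rewrite mulf_neq0.
  apply: (mulfI nf); rewrite mulrA mulrAC.
  have -> : n.+1%:R * f 1 * (g 1 + z^*) = (f' * (1 + (g z)^*) + n.+1%:R * f 1) * (g 1 + z^*) -
    f' * (1 + (g z)^*) * (g 1 + z^*) by ring.
  by rewrite E; field; rewrite f1 addrC natr1.
have := congr1 (fun x : R[i] => x^*) E'.
rewrite rmorphM !rmorphD rmorphN rmorphM rmorphD /= rmorph1.
by rewrite (conjcK z : z^*^* = z) (conjcK (g z) : (g z)^*^* = g z).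
Qed.

End Necessity.

(** * Constant and affine maps *)

Section Classification.
Context {R : realType}.
Implicit Types (f g : R[i] -> R[i]) (l n : nat).

Lemma conj_eq_real (x : R[i]) : x^* = x -> x = (complex.Re x)%:C.
Proof.
case: x => a b /eqP; rewrite eq_complex /= => /andP[_ /eqP E]; congr (_ +i* _); lra.
Qed.

Lemma conjC1 : (1 : R[i])^* = 1.
Proof. exact: rmorph1. Qed.

(** The logarithmic derivatives of both sides agree at v = 1; after removal of the common term
    [X1 * Y1] the conclusion says that the two affine functions are proportional. *)
Lemma power_wronskian_const n (k X0 X1 Y0 Y1 C : R[i]) :
  k != 0 -> X0 + X1 != 0 ->
  (forall v, Cplus v -> k * (X0 + v * X1) ^+ n.+1 = C * (Y0 + v * Y1) ^+ n.+1) ->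
  X1 * (Y0 + Y1) = Y1 * (X0 + X1).
Proof.
move=> k0 X0n E.
have D (u v : R[i]) : cdiff (fun w => u + w * v) 1 v.
  apply: (cdiff_val (cdiffD (cdiff_cst u 1) (cdiffM (cdiff_id 1) (cdiff_cst v 1)))).
  by rewrite add0r mul1r mulr0 addr0.
have H v : normc (v - 1) < 1 -> k * (X0 + v * X1) ^+ n.+1 = C * (Y0 + v * Y1) ^+ n.+1.
  by move=> v1; apply: E; exact: (@Cplus_ball _ 1).
have W := power_wronskian ltr01 (cdiff_cst k 1) (D X0 X1) (D Y0 Y1) H.
have nk : n.+1%:R * k != 0 by rewrite mulf_neq0 // pnatr_eq0.
apply: (mulfI nk); rewrite !mulrA.
by move: W; rewrite !mul1r mul0r add0r => ->.
Qed.

Lemma conj_expr_real n (k x : R[i]) : x != 0 -> k * x ^+ n = k^* * x ^+ n -> k = k^*.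
Proof. by move=> x0 /(mulIf (expf_neq0 n x0)). Qed.

(** The identity at z = 1 determines f up to a constant factor, and at w = z = 1 it says that this
    factor is real. *)
Lemma kernel_symmetric_constant n f g (m : R[i]) : kernel_symmetric n.+1 f g ->
  (forall z, Cplus z -> Cplus (g z)) ->
  (forall z, Cplus z -> g z = m) -> case_constant n f g.
Proof.
move=> S gC gm; have p1 : Cplus (1 : R[i]) by exact: ltr01.
have m0 : Cplus m by rewrite -(gm _ p1); exact: gC.
pose E := (f 1)^* * (m + 1) ^+ n.+2.
have fE w : Cplus w -> f w * (w + m^*) ^+ n.+2 = E.
  by move=> w0; have := S w 1 w0 p1; rewrite !gm // conjC1.
have Er : E^* = E.
  rewrite -[RHS](fE _ p1) /E rmorphM rmorphXn rmorphD /= conjC1 (conjcK (f 1) : (f 1)^*^* = f 1).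
  by rewrite addrC.
exists m, (complex.Re E); split => // w w0; split; first exact: gm.
rewrite -(conj_eq_real Er) -(fE w w0) mulfK // expf_neq0 //.
exact: Cplus_conj_add.
Qed.

(** For real z = s the identity compares powers of two affine functions of w, and the coefficients
    in s give |k| = 1 and t = k conj t. As g preserves the half-plane, k = 1 and t is real and
    nonnegative. *)
Lemma kernel_symmetric_affine n f g (k t C : R[i]) : kernel_symmetric n f g ->
  (forall z, Cplus z -> Cplus (g z)) -> C != 0 ->
  (forall z, Cplus z -> g z = k * z + t /\ f z = C) -> case_translation f g.
Proof.
move=> S gC C0 H; have p1 : Cplus (1 : R[i]) by exact: ltr01.
have E (s : R) : 0 < s -> k + t + s%:C = k * (1 + k^* * s%:C + t^*).
  move=> s0; have ps : Cplus s%:C by [].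
  have [gs _] := H _ ps.
  have gsE : (g s%:C)^* = k^* * s%:C + t^*.
    by rewrite gs rmorphD rmorphM /= (conjc_real s : (s%:C)^* = s%:C).
  have := @power_wronskian_const n C (k^* * s%:C + t^*) 1 (t + s%:C) k C^* C0.
  rewrite -{1}gsE addrC => /(_ (Cplus_conj_add p1 (gC _ ps))) W.
  have -> : k + t + s%:C = 1 * (t + s%:C + k) by ring.
  have -> : k * (1 + k^* * s%:C + t^*) = k * (k^* * s%:C + t^* + 1) by ring.
  apply: W => v v0; have := S v _ v0 ps; have [-> ->] := H v v0; have [_ ->] := H _ ps.
  rewrite gsE mulr1 (conjc_real s : (s%:C)^* = s%:C) addrC => ->.
  by congr (_ * _ ^+ _); ring.
have [_ kk tt] : [/\ 0 = 0 :> R[i], 1 - k * k^* = 0 & t - k * t^* = 0].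
  apply: quadratic_eq0 => s s0; rewrite mul0r add0r.
  have -> : (1 - k * k^*) * s%:C + (t - k * t^*) = (k + t + s%:C) - k * (1 + k^* * s%:C + t^*) by ring.
  by rewrite E // subrr.
have rg (x y : R) : 0 < x -> 0 < complex.Re k * x - complex.Im k * y + complex.Re t.
  move=> x0; have pz : Cplus (x +i* y) by [].
  by have := gC _ pz; have [-> _] := H _ pz; rewrite /Cplus /= Re_addc Re_mulc.
have k1 : complex.Im k = 0.
  (* With abscissa 1, this ordinate makes the real part of g equal to 0. *)
  apply/eqP/negP => /negP k0; have := rg 1 ((complex.Re k + complex.Re t) / complex.Im k) ltr01.
  by rewrite mulrCA divff // !mulr1 addrAC subrr ltxx.
have k2 : 0 <= complex.Re k.
  rewrite leNgt; apply/negP => kn.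
  (* Makes the linear term equal to -(|Re t| + 1), so that the real part of g at x is negative. *)
  pose x := (`|complex.Re t| + 1) / - complex.Re k.
  have x0 : 0 < x by rewrite divr_gt0 ?oppr_gt0 // ltr_wpDl.
  have xE : complex.Re k * x = - (`|complex.Re t| + 1).
    by rewrite /x; field; rewrite ltr0_neq0.
  by have := rg x 0 x0; have := ler_norm (complex.Re t); rewrite xE; lra.
have kE : k = (complex.Re k)%:C.
  by case: (k) k1 => a b /= ->.
have {}kE : k = 1.
  move: kk; rewrite kE (conjc_real _ : (_%:C)^* = _%:C) -rmorphM => /eqP.
  rewrite subr_eq0 eq_sym => /eqP/(congr1 (@complex.Re R)) /= kk.
  rewrite kE; congr (_%:C); apply/eqP; rewrite -(@eqrXn2 _ 2) // ?ler01 //.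
  by rewrite expr1n expr2 kk.
have tc : t^* = t by move/eqP: tt; rewrite kE mul1r subr_eq0 => /eqP.
have tE := conj_eq_real tc.
have t0 : 0 <= complex.Re t.
  rewrite leNgt; apply/negP => tn; have := rg (- complex.Re t) 0.
  by rewrite oppr_gt0 kE /= => /(_ tn); lra.
have CE : C = (complex.Re C)%:C.
  apply: conj_eq_real.
  have [g1 f1] := H _ p1; rewrite kE mul1r in g1.
  have g1c : (g 1)^* = 1 + t by rewrite g1 rmorphD /= tc; congr (_ + _); exact: conjC1.
  have := S 1 1 p1 p1; rewrite g1c f1 g1 conjC1 [1 + t + 1]addrC.
  by move=> E1; apply/esym/(conj_expr_real _ E1); rewrite -g1c; apply: Cplus_conj_add (gC _ p1).
exists (complex.Re t), (complex.Re C); split => // w w0.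
by have [-> ->] := H _ w0; rewrite {1}kE mul1r -tE -CE.
Qed.

End Classification.

(** * Maps with a pole *)

Section MoebiusClassification.
Context {R : realType}.
Implicit Types (f g : R[i] -> R[i]) (l n : nat).

(** Clearing denominators turns the identity into an equality of powers of two functions affine in
    w. Its logarithmic derivative at w = 1 is polynomial in real z = t, and the vanishing of the
    coefficients gives s = conj p and r real; that k is real is read off at w = z = 1. *)
Lemma kernel_symmetric_moebius n f g (k p s r : R[i]) : kernel_symmetric n f g ->
  (forall z, Cplus z -> Cplus (g z)) -> k != 0 ->
  (forall z, Cplus z -> z + p != 0 /\ g z = s - r / (z + p) /\ f z = k * (z + p) ^- n.+1) ->
  [/\ s = p^*, r^* = r & k^* = k].
Proof.
move=> S gC k0 H; have p1 : Cplus (1 : R[i]) by exact: ltr01.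
have conj_neq0 (z : R[i]) : z != 0 -> z^* != 0 by rewrite fmorph_eq0.
have gE z w : Cplus z -> Cplus w -> (z + p)^* * (w + (g z)^*) = (w + s^*) * (z + p)^* - r^*.
  move=> z0 w0; have [zp [-> _]] := H _ z0; have zp' := conj_neq0 _ zp.
  by rewrite rmorphB fmorph_div /=; field; rewrite -rmorphD.
have gE' z w : Cplus z -> Cplus w -> (w + p) * (g w + z^*) = (s + z^*) * (w + p) - r.
  by move=> z0 w0; have [wp [-> _]] := H _ w0; field; rewrite wp.
have E w z : Cplus w -> Cplus z ->
    k * ((w + s^*) * (z + p)^* - r^*) ^+ n.+1 = k^* * ((s + z^*) * (w + p) - r) ^+ n.+1.
  move=> w0 z0; rewrite -gE // -gE' // !exprMn.
  have := S w z w0 z0; have [wp [_ ->]] := H _ w0; have [zp [_ ->]] := H _ z0.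
  have zp' := conj_neq0 _ zp.
  rewrite rmorphM fmorphV rmorphXn /=.
  set a := (w + p) ^+ _; set b := (z + p)^* ^+ _; set c := _ ^+ n.+1; set d := _ ^+ n.+1.
  have a0 : a != 0 by rewrite expf_neq0.
  have b0 : b != 0 by rewrite expf_neq0.
  clearbody a b c d; move=> S'; have -> : k * (b * c) = k / a * c * (a * b) by field.
  by rewrite S'; field.
have X0 z w : Cplus z -> Cplus w -> (w + s^*) * (z + p)^* - r^* != 0.
  move=> z0 w0; rewrite -gE // mulf_neq0 //; last exact: Cplus_conj_add (gC _ z0).
  by apply: conj_neq0; have [] := H _ z0.
have [ps rr _] : [/\ p - s^* = 0, (p^* + s) * (p - s^*) - r + r^* = 0 &
    s * p^* * (p - s^*) - r * p^* + r^* * s = 0].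
  apply: quadratic_eq0 => t t0; have pt : Cplus t%:C by [].
  have tc : (t%:C + p)^* = t%:C + p^* by rewrite rmorphD /= (conjc_real t : (t%:C)^* = t%:C).
  have := @power_wronskian_const _ n k (s^* * (t%:C + p^*) - r^*) (t%:C + p^*)
    ((s + t%:C) * p - r) (s + t%:C) k^* k0.
  have -> : s^* * (t%:C + p^*) - r^* + (t%:C + p^*) = (1 + s^*) * (t%:C + p^*) - r^* by ring.
  rewrite -tc => /(_ (X0 _ _ pt p1)); rewrite tc => W.
  have {}W : (t%:C + p^*) * ((s + t%:C) * p - r + (s + t%:C)) = (s + t%:C) * ((1 + s^*) * (t%:C + p^*) - r^*).
    apply: W => v v0; have := E v _ v0 pt; rewrite tc (conjc_real t : (t%:C)^* = t%:C) => E1.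
    have -> : s^* * (t%:C + p^*) - r^* + v * (t%:C + p^*) = (v + s^*) * (t%:C + p^*) - r^* by ring.
    by rewrite E1; congr (_ * _ ^+ _); ring.
  have -> : (p - s^*) * t%:C ^+ 2 + ((p^* + s) * (p - s^*) - r + r^*) * t%:C +
     (s * p^* * (p - s^*) - r * p^* + r^* * s) =
     (t%:C + p^*) * ((s + t%:C) * p - r + (s + t%:C)) - (s + t%:C) * ((1 + s^*) * (t%:C + p^*) - r^*) by ring.
  by rewrite W subrr.
have pE : p = s^* by apply/eqP; rewrite -subr_eq0 ps.
have rE : r^* = r.
  by move: rr; rewrite ps mulr0 add0r addrC => /eqP; rewrite subr_eq0 => /eqP.
split => //; first by rewrite pE (conjcK s : s^*^* = s).
apply/esym/(conj_expr_real (n := n.+1) (X0 _ _ p1 p1)).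
have e1 : (1 + p)^* = 1 + s.
  by rewrite pE rmorphD /= (conjcK s : s^*^* = s); congr (_ + _); exact: conjC1.
rewrite (E 1 1 p1 p1) e1 rE pE conjC1.
by congr (_ * _ ^+ _); ring.
Qed.

(** What remains is the condition Re g > 0. It is tested on the horizontal ray where w + p is real,
    on which it says Re p > r / (x + Re p). *)
Lemma kernel_symmetric_moebius_case l f g (k p s r : R[i]) : kernel_symmetric l.+1 f g ->
  (forall z, Cplus z -> Cplus (g z)) -> k != 0 -> r != 0 ->
  (forall z, Cplus z -> z + p != 0 /\ g z = s - r / (z + p) /\ f z = k * (z + p) ^- l.+2) ->
  case_moebius l f g \/ case_moebius_pos l f g.
Proof.
move=> S gC k0 r0 H; have [sE rr kk] := kernel_symmetric_moebius S gC k0 H.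
set r1 := complex.Re r; set k1 := complex.Re k.
have rE : r = r1%:C := conj_eq_real rr; have kE : k = k1%:C := conj_eq_real kk.
have r10 : r1 != 0 by apply: contra_neq r0 => r10; rewrite rE r10.
have k10 : k1 != 0 by apply: contra_neq k0 => k10; rewrite kE k10.
set P := complex.Re p; set Q := complex.Im p.
have pE : p = P +i* Q by rewrite /P /Q; case: (p).
have P0 : 0 <= P.
  (* Otherwise the pole -p would lie in the half-plane. *)
  rewrite leNgt; apply/negP => Pn; have pn : Cplus (- p) by rewrite /Cplus /= Re_oppc oppr_gt0.
  by have [] := H _ pn; rewrite addNr eqxx.
have rg x : 0 < x -> 0 < P - r1 / (x + P).
  move=> x0; have px : Cplus (x -i* Q) by [].
  have := gC _ px; have [_ [-> _]] := H _ px.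
  have -> : (x -i* Q) + p = (x + P)%:C by rewrite pE; apply/eqP; rewrite eq_complex /= eqxx addNr eqxx.
  by rewrite /Cplus /= sE rE -fmorphV -rmorphM Re_addc Re_oppc pE.
(* Inverts [moebius_formE]: 2 / alpha = r, -conj(beta) / alpha = p and delta / alpha^(l+2) = k. *)
pose a := 2 / r1; pose b := - (a%:C * p^*); pose d := k1 * a ^+ l.+2.
have a0 : a != 0 by rewrite mulf_neq0 ?invr_eq0 // pnatr_eq0.
have ac : a%:C != 0 :> R[i] by rewrite fmorph_eq0.
have d0 : d != 0 by rewrite mulf_neq0 // expf_neq0.
have bP : complex.Re b = - (a * P) by rewrite /b Re_oppc Re_realM pE.
have M : moebius_form l a d b f g.
  move=> w w0; have [wp [-> ->]] := H _ w0.
  have -> : a%:C * w - b^* = a%:C * (w + p).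
    have conjM (x : R) (y : R[i]) : (- (x%:C * y^*))^* = - (x%:C * y).
      by case: y => u v; apply/eqP; rewrite eq_complex /=; apply/andP; split; apply/eqP; ring.
    by rewrite conjM; ring.
  have aE : a%:C = 2 / r by rewrite rE /a fmorph_div rmorph_nat.
  have dE : d%:C = k * a%:C ^+ l.+2 by rewrite kE -rmorphXn -rmorphM.
  rewrite sE dE exprMn; split.
    have -> : - (b / a%:C) = p^* by rewrite /b mulNr opprK mulrAC divff // mul1r.
    by rewrite aE; congr (_ - _); field; rewrite r0 wp.
  have an : a%:C ^+ l.+2 != 0 by rewrite expf_neq0.
  by rewrite (invfM (a%:C ^+ l.+2)) mulrA mulfK.
(* For negative r one has alpha < 0, and Re p = 0 or Re p > 0 decides between [case_moebius] and
   [case_moebius_pos]. *)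
case: (ltrgtP r1 0) r10 => // r1s _.
  have an : a < 0 by rewrite /a pmulr_rlt0 // invr_lt0.
  move: P0; rewrite le_eqVlt => /orP[/eqP P0|P0].
    by left; exists a, d, b; split => //; right; split=> //; rewrite bP -P0 mulr0 oppr0.
  by right; exists a, d, b; split => //; rewrite bP oppr_gt0 nmulr_rlt0.
have ap : 0 < a by rewrite divr_gt0.
have rP : r1 <= P ^+ 2.
  rewrite leNgt; apply/negP => rP; move: P0; rewrite le_eqVlt => /orP[/eqP P0|P0].
    have := rg 1 ltr01; rewrite -P0 addr0 divr1; lra.
  (* At this abscissa the real part of g would be 0. *)
  have x0 : 0 < (r1 - P ^+ 2) / P by rewrite divr_gt0 // subr_gt0.
  have := rg _ x0; have -> : (r1 - P ^+ 2) / P + P = r1 / P by field; rewrite lt0r_neq0.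
  rewrite invf_div mulrCA divff ?lt0r_neq0 // mulr1.
  by rewrite subrr ltxx.
have P1 : 0 < P.
  by rewrite lt_neqAle P0 andbT; apply/eqP => E; move: rP; rewrite -E expr0n /=; lra.
left; exists a, d, b; split => //; left; split; first by rewrite bP oppr_lt0 mulr_gt0.
split => //; rewrite bP sqrrN exprMn ler_pdivlMr // expr2 -mulrA ler_pM2l //.
by rewrite /a mulrAC ler_pdivlMr // ler_pM2l.
Qed.

Theorem kernel_symmetric_cases l f g : analytic_Cplus f -> analytic_Cplus g ->
  (forall z, Cplus z -> Cplus (g z)) -> kernel_symmetric l.+1 f g ->
  (case_constant l f g \/ case_translation f g \/ case_moebius l f g) \/
  (case_zero f \/ case_moebius_pos l f g).
Proof.
move=> af ag gC S; have p1 : Cplus (1 : R[i]) by exact: ltr01.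
have [f1|f1] := eqVneq (f 1) 0.
  by right; left; exact: kernel_symmetric_zero gC S p1 f1.
have [a [c H]] := kernel_symmetric_bilinear af ag gC S f1.
set b := (g 1)^* in H.
have bz z : Cplus z -> b + z != 0.
  by move=> z0; rewrite addrC; exact: Cplus_conj_add (gC _ p1).
(* The denominator of g cannot vanish, because the right side b + z of [H] does not. *)
have den z : Cplus z -> a - c * (b + z) != 0.
  by move=> z0; apply: contra_neq (bz z z0) => E; rewrite -H // E mulr0.
have f1c : (f 1)^* != 0 by rewrite fmorph_eq0.
have fE w : Cplus w -> f w = (f 1)^* * (a - c * (b + w)) ^- l.+2.
  move=> w0; have := S w 1 w0 p1; rewrite conjC1 -/b [g w + 1]addrC.
  have -> : 1 + g w = (b + w) / (a - c * (b + w)) by rewrite -{1}H // mulfK ?den.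
  rewrite expr_div_n [w + b]addrC [X in _ = _ * X]mulrC [X in _ = X -> _]mulrA.
  by move/(mulIf (expf_neq0 l.+2 (bz _ w0))).
have gE w : Cplus w -> g w = (b + w) / (a - c * (b + w)) - 1.
  by move=> w0; rewrite -{1}H // mulfK ?den // addrC addKr.
have [c0|c0] := eqVneq c 0.
  left; right; left.
  have a0 : a != 0 by have := den _ p1; rewrite c0 mul0r subr0.
  apply: (@kernel_symmetric_affine _ l.+1 f g a^-1 (b / a - 1) ((f 1)^* * a ^- l.+2)) => //.
    by rewrite mulf_neq0 // invr_eq0 expf_neq0.
  move=> z z0; rewrite gE // fE // c0 mul0r subr0; split => //.
  by field.
have [a0|a0] := eqVneq a 0.
  left; left; apply: (@kernel_symmetric_constant _ l f g (- c^-1 - 1)) => // z z0.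
  by rewrite gE // a0 sub0r invrN mulrN (invfM c) mulrCA divff ?bz // mulr1.
(* The pole is at -p with p = b - a / c, and b + z = (z + p) + a / c; this yields the remaining
   parameters -1 / c - 1 and a / c^2 of g. *)
have dE z : a - c * (b + z) = - c * (z + (b - a / c)) by field.
pose k := (f 1)^* * (- c) ^- l.+2.
have k0 : k != 0 by rewrite mulf_neq0 // invr_eq0 expf_neq0 // oppr_eq0.
have r0 : a / c ^+ 2 != 0 by rewrite mulf_neq0 // invr_eq0 expf_neq0.
have [] := @kernel_symmetric_moebius_case l f g k (b - a / c) (- c^-1 - 1) (a / c ^+ 2) S gC k0 r0; last 2 first.
- by left; right; right.
- by right; right.
move=> z z0; have := den z z0; rewrite dE mulf_eq0 oppr_eq0 (negbTE c0) /= => zp.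
split => //; split.
  rewrite gE // dE; have zp' : z * c + (b * c - a) != 0.
    by rewrite (_ : _ + _ = c * (z + (b - a / c))) ?mulf_neq0 //; field.
  by field; rewrite c0 /=; exact: zp'.
by rewrite fE // dE exprMn (invfM ((- c) ^+ _)) mulrA.
Qed.

End MoebiusClassification.

Theorem theorem3p3 (R : realType) (l : nat) (f g : R[i]%C -> R[i]%C)
  (f_analytic : analytic_Cplus f) (g_analytic : analytic_Cplus g)
  (g_Cplus : forall w, Cplus w -> Cplus (g w)) :
  (hermitian_op l (Wmax l f g) <->
     (case_constant l f g \/ case_translation f g \/ case_moebius l f g)
     \/ (case_zero f \/ case_moebius_pos l f g))
  /\ (hermitian_op l (Wmax l f g) -> bounded_op l (Wmax l f g)).
Proof.
have sufH : (case_constant l f g \/ case_translation f g \/ case_moebius l f g)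
     \/ (case_zero f \/ case_moebius_pos l f g) ->
    hermitian_op l (Wmax l f g) /\ bounded_op l (Wmax l f g).
  move=> [[H|[H|]]|[H|]].
  - exact: case_constant_adjoint H.
  - exact: case_translation_adjoint H.
  - move=> [a [d [b [_ _ [[b0 [a0 ab]]|[a0 b0]] M]]]].
      exact: case_moebius_gt0_adjoint M.
    by apply: case_moebius_neg_adjoint a0 _ M; rewrite b0.
  - exact: case_zero_adjoint H.
  - by move=> [a [d [b [a0 _ b0 M]]]]; apply: case_moebius_neg_adjoint a0 (ltW b0) M.
have nec : hermitian_op l (Wmax l f g) ->
    (case_constant l f g \/ case_translation f g \/ case_moebius l f g)
     \/ (case_zero f \/ case_moebius_pos l f g).
  move=> H; apply: kernel_symmetric_cases => //.
  exact: hermitian_kernel_identity H.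
by split; [split=> [/nec|/sufH[]]|move=> /nec/sufH[]].
Qed.
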